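(* Fix $a>0$ and $\xi_0\in\mathcal{S}_+$, where $\mathcal{S}_+=\{\xi=x+iy\in\mathbb{C}:\ x\ge 1,\ x-1-\tfrac12\log(x^2+y^2)=0\}$. Then there exist, for all sufficiently large real $b>0$, complex numbers $z^*_b$ satisfying ${}_1F_1(a;b;z^*_b)=0$ and $\lim_{b\to\infty} z^*_b/b=\xi_0$.
   Context: ${}_1F_1(a;b;z)=\sum_{k=0}^\infty \frac{(a)_k}{(b)_k}\frac{z^k}{k!}$ is Kummer's confluent hypergeometric function, with $(x)_k=\Gamma(x+k)/\Gamma(x)$. *)

(* Defs.v *)
From Stdlib Require Import Reals Factorial.
From Coquelicot Require Import Coquelicot.
Open Scope R_scope.

Fixpoint poch (x : R) (k : nat) : R :=
  match k with
  | O => 1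
  | S k' => poch x k' * (x + INR k')
  end.

Fixpoint cpow (z : C) (k : nat) : C :=
  match k with
  | O => RtoC 1
  | S k' => Cmult (cpow z k') z
  end.

Definition kummer_term (a b : R) (z : C) (k : nat) : C :=
  Cmult (RtoC (poch a k / (poch b k * INR (Factorial.fact k)))) (cpow z k).

Definition hyp1F1_eq (a b : R) (z w : C) : Prop :=
  is_series (K := C_AbsRing) (V := C_NormedModule) (kummer_term a b z) w.

Definition S_plus (xi : C) : Prop :=
  1 <= Re xi /\ Re xi - 1 - / 2 * ln (Re xi ^ 2 + Im xi ^ 2) = 0.

(* Main.v *)
(* With [n = b - a - 1], Euler's integral writes 1F1(a;b;z), up to a positive factor, as the
   integral of [a r^(a-1) (1-r)^n e^(z r)] over [0,1], that is, in the variable [v = 1 - r],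
   as an integral of [v^n e^(z (1-v))].  For [z = n xi + om] the phase
   [log v + xi (1 - v)] has its saddle at [1/xi], and on the curve S_+ the saddle [v = 1/xi]
   and the endpoint [v = 1] have the same height.  The path 0 -> conj xi -> 1 separates the
   two: on its first side [xi v] is real and the saddle is a strict maximum of the modulus;
   on its second side the modulus decays exponentially away from 1, and the linear part of
   the phase is real.  Hence for [om = O(log n)] the integral is, up to a non-zero factor,
   [1 + o(1) + ratio n * e^(kap om) (1 + o(1))] with [kap = 1 - 1/xi] and [ratio n] between
   powers of [n].  Choosing [om] with [ratio n * e^(kap om) = -1] and perturbing it by [t] turns this
   into [1 - e^(kap t) + o(1)], which is small at [t = 0] and bounded below on the boundary of
   a fixed square; by the minimum modulus principle there is a zero in the square.
   The only real point [xi = 1] of the curve is a limit of non-real ones, where the argument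
   applies. *)

Require Import Defs.
From Stdlib Require Import Reals Factorial Wf_nat Lia Lra Psatz ClassicalEpsilon.
From Coquelicot Require Import Coquelicot.
Open Scope R_scope.

(** * Calculus of complex-valued functions of a real variable *)

(** Cauchy's theorem is replaced by calculus in real parameters: the integral over the segment from
    [t w] to [1], with [w = conj xi], satisfies a first order differential equation in [t] whose
    inhomogeneous term is the integrand at [t w], and integrating it over [0,1] produces both sides
    of the path. The corner [conj xi] is dictated by two identities: [xi * conj xi = |xi|^2] and
    [(1 - conj xi) * (1 - xi) = |1 - xi|^2]. They allow each contribution to be compared with a
    positive real integral, [saddle_mass] or [laplace]. The relative errors are controlled only
    pointwise in [z], without any regularity; a minimum modulus argument compares the centre of a
    square with its boundary, so pointwise bounds suffice. Finally, one zero per [b] has to serve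
    all tolerances of the limit at once; it is taken almost as close to [b * xi0] as possible. *)

Definition cexp (z : C) : C := (exp (Re z) * cos (Im z), exp (Re z) * sin (Im z)).

Definition ccont (f : R -> C) (t : R) : Prop :=
  continuous (fun s => Re (f s)) t /\ continuous (fun s => Im (f s)) t.

Definition cderiv (f : R -> C) (t : R) (l : C) : Prop :=
  is_derive (fun s => Re (f s)) t (Re l) /\ is_derive (fun s => Im (f s)) t (Im l).

Definition CI (f : R -> C) : C :=
  (RInt (fun t => Re (f t)) 0 1, RInt (fun t => Im (f t)) 0 1).

Lemma C_ext (z w : C) : Re z = Re w -> Im z = Im w -> z = w.
Proof. destruct z, w; simpl; congruence. Qed.

Lemma exp_le (x y : R) : x <= y -> exp x <= exp y.
Proof. intros [H|<-]; [left; apply exp_increasing; auto|right; auto]. Qed.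

Lemma cexp_0 : cexp 0 = 1.
Proof. unfold cexp; simpl. rewrite exp_0, cos_0, sin_0. apply C_ext; simpl; ring. Qed.

Lemma cexp_plus (z w : C) : cexp (z + w) = (cexp z * cexp w)%C.
Proof.
  unfold cexp; rewrite re_plus, im_plus, exp_plus, cos_plus, sin_plus.
  apply C_ext; simpl; ring.
Qed.

Lemma Cmod_cexp (z : C) : Cmod (cexp z) = exp (Re z).
Proof.
  unfold Cmod, cexp; simpl fst; simpl snd.
  replace (_ + _) with (Rsqr (exp (Re z))).
  - apply sqrt_Rsqr, Rlt_le, exp_pos.
  - transitivity (Rsqr (exp (Re z)) * (Rsqr (sin (Im z)) + Rsqr (cos (Im z)))).
    + rewrite sin2_cos2; ring.
    + unfold Rsqr; ring.
Qed.

Lemma cexp_neq_0 (z : C) : cexp z <> 0.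
Proof. apply Cmod_gt_0. rewrite Cmod_cexp. apply exp_pos. Qed.

Lemma cexp_RtoC (x : R) : cexp x = exp x.
Proof. unfold cexp; simpl. rewrite cos_0, sin_0. apply C_ext; simpl; ring. Qed.

Lemma Re_le_Cmod (z : C) : Re z <= Cmod z.
Proof. generalize (re_le_Cmod z) (Rle_abs (Re z)); lra. Qed.

Lemma Cmod_eq (z : C) : Cmod z ^ 2 = Re z ^ 2 + Im z ^ 2.
Proof. apply Cmod2_alt. Qed.

Lemma Cmod_le_Re_Im (z : C) : Cmod z <= Rabs (Re z) + Rabs (Im z).
Proof.
  pose proof (Cmod_eq z). pose proof (Cmod_ge_0 z).
  pose proof (Rabs_pos (Re z)). pose proof (Rabs_pos (Im z)).
  rewrite <- (pow2_abs (Re z)), <- (pow2_abs (Im z)) in H. nra.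
Qed.

Lemma Im_le_Cmod (z : C) : Rabs (Im z) <= Cmod z.
Proof.
  pose proof (Cmod_eq z). pose proof (Cmod_ge_0 z).
  rewrite <- (pow2_abs (Re z)), <- (pow2_abs (Im z)) in H.
  pose proof (Rabs_pos (Re z)). pose proof (Rabs_pos (Im z)). nra.
Qed.

Lemma Cmod_minus_triangle (x y : C) : Cmod x <= Cmod y + Cmod (x - y).
Proof. replace x with (y + (x - y))%C at 1 by ring. apply Cmod_triangle. Qed.

Lemma Cmod_sym (x y : C) : Cmod (x - y) = Cmod (y - x).
Proof. rewrite <- Cmod_opp. f_equal. ring. Qed.

Lemma cderiv_cont (f : R -> C) t l : cderiv f t l -> ccont f t.
Proof.
  intros [H1 H2]; split; apply (@ex_derive_continuous _ R_NormedModule); eexists; eauto.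
Qed.

Lemma ccont_const (c : C) t : ccont (fun _ => c) t.
Proof. split; apply continuous_const. Qed.

Lemma ccont_plus f g t : ccont f t -> ccont g t -> ccont (fun s => f s + g s)%C t.
Proof.
  intros [F1 F2] [G1 G2]; split.
  - apply (continuous_plus (V := R_NormedModule) _ _ _ F1 G1).
  - apply (continuous_plus (V := R_NormedModule) _ _ _ F2 G2).
Qed.

Lemma ccont_mult f g t : ccont f t -> ccont g t -> ccont (fun s => f s * g s)%C t.
Proof.
  intros [F1 F2] [G1 G2]; split.
  - apply (continuous_minus (V := R_NormedModule));
      apply (continuous_mult (K := R_AbsRing)); assumption.
  - apply (continuous_plus (V := R_NormedModule));
      apply (continuous_mult (K := R_AbsRing)); assumption.
Qed.

Lemma ccont_opp f t : ccont f t -> ccont (fun s => - f s)%C t.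
Proof. intros [F1 F2]; split; apply (continuous_opp (V := R_NormedModule)); assumption. Qed.

Lemma ccont_minus f g t : ccont f t -> ccont g t -> ccont (fun s => f s - g s)%C t.
Proof. intros; apply ccont_plus; [|apply ccont_opp]; assumption. Qed.

Lemma ccont_RtoC (f : R -> R) t : continuous f t -> ccont (fun s => RtoC (f s)) t.
Proof. intros F; split; [exact F | apply continuous_const]. Qed.

Lemma ccont_cexp f t : ccont f t -> ccont (fun s => cexp (f s)) t.
Proof.
  intros [F1 F2].
  assert (HE : continuous (fun s => exp (Re (f s))) t)
    by exact (continuous_comp (fun s => Re (f s)) exp t F1 (continuous_exp _)).
  assert (HC : continuous (fun s => cos (Im (f s))) t)
    by exact (continuous_comp (fun s => Im (f s)) cos t F2 (continuous_cos _)).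
  assert (HS : continuous (fun s => sin (Im (f s))) t)
    by exact (continuous_comp (fun s => Im (f s)) sin t F2 (continuous_sin _)).
  split; simpl; apply (continuous_mult (K := R_AbsRing)); assumption.
Qed.

Lemma continuous_Cmod f t : ccont f t -> continuous (fun s => Cmod (f s)) t.
Proof.
  intros [F1 F2]. unfold Cmod.
  apply (continuous_comp (fun s => fst (f s) ^ 2 + snd (f s) ^ 2) sqrt).
  - apply (continuous_plus (V := R_NormedModule)).
    + apply (continuous_comp (fun s => Re (f s)) (fun x => x ^ 2)); [exact F1|].
      apply (@ex_derive_continuous _ R_NormedModule). auto_derive. auto.
    + apply (continuous_comp (fun s => Im (f s)) (fun x => x ^ 2)); [exact F2|].
      apply (@ex_derive_continuous _ R_NormedModule). auto_derive. auto.
  - apply continuous_sqrt.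
Qed.

Lemma ccont_inv (f : R -> C) t : f t <> 0 -> ccont f t -> ccont (fun s => / f s)%C t.
Proof.
  intros Hf [F1 F2].
  assert (H0 : Re (f t) ^ 2 + Im (f t) ^ 2 <> 0).
  { rewrite <- Cmod_eq. apply pow_nonzero. pose proof (proj1 (Cmod_gt_0 _) Hf). lra. }
  assert (HS : continuous (fun s => / (Re (f s) ^ 2 + Im (f s) ^ 2)) t).
  { apply (continuous_comp (fun s => Re (f s) ^ 2 + Im (f s) ^ 2) Rinv).
    - apply (continuous_plus (V := R_NormedModule)).
      + apply (continuous_comp (fun s => Re (f s)) (fun x => x ^ 2)); [exact F1|].
        apply (@ex_derive_continuous _ R_NormedModule). auto_derive. auto.
      + apply (continuous_comp (fun s => Im (f s)) (fun x => x ^ 2)); [exact F2|].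
        apply (@ex_derive_continuous _ R_NormedModule). auto_derive. auto.
    - apply continuous_Rinv. exact H0. }
  split.
  - apply (continuous_mult (K := R_AbsRing)); assumption.
  - apply (continuous_mult (K := R_AbsRing)); [|assumption].
    apply (continuous_opp (V := R_NormedModule)); assumption.
Qed.

Lemma cderiv_const (c : C) t : cderiv (fun _ => c) t 0.
Proof. split; apply (is_derive_const (V := R_NormedModule)). Qed.

Lemma cderiv_plus f g t l m :
  cderiv f t l -> cderiv g t m -> cderiv (fun s => f s + g s)%C t (l + m)%C.
Proof.
  intros [F1 F2] [G1 G2]; split.
  - apply (is_derive_plus (V := R_NormedModule) _ _ _ _ _ F1 G1).
  - apply (is_derive_plus (V := R_NormedModule) _ _ _ _ _ F2 G2).
Qed.

Lemma cderiv_ext_val f t l m : l = m -> cderiv f t l -> cderiv f t m.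
Proof. intros ->; auto. Qed.

Lemma is_derive_eq (f : R -> R) t l m : l = m -> is_derive f t l -> is_derive f t m.
Proof. intros ->; auto. Qed.

Lemma cderiv_mult f g t l m :
  cderiv f t l -> cderiv g t m -> cderiv (fun s => f s * g s)%C t (l * g t + f t * m)%C.
Proof.
  intros [F1 F2] [G1 G2]; split.
  - eapply is_derive_eq; [|apply (is_derive_minus (V := R_NormedModule));
      apply (is_derive_mult (K := R_AbsRing)); try eassumption; apply Rmult_comm].
    unfold minus, plus, opp, mult, Re, Im; simpl; unfold Re, Im. ring.
  - eapply is_derive_eq; [|apply (is_derive_plus (V := R_NormedModule));
      apply (is_derive_mult (K := R_AbsRing)); try eassumption; apply Rmult_comm].
    unfold minus, plus, opp, mult, Re, Im; simpl; unfold Re, Im. ring.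
Qed.

Ltac bring := cbv beta;
  match goal with |- @eq _ ?x ?y => first [ring | change (@eq R x y); ring | change (@eq C x y); ring] end.

Lemma cderiv_scal (c : C) f t l : cderiv f t l -> cderiv (fun s => c * f s)%C t (c * l)%C.
Proof.
  intros F. eapply cderiv_ext_val; [|apply cderiv_mult; [apply cderiv_const | exact F]].
  bring.
Qed.

Lemma cderiv_opp f t l : cderiv f t l -> cderiv (fun s => - f s)%C t (- l)%C.
Proof. intros [F1 F2]; split; apply (is_derive_opp (V := R_NormedModule)); assumption. Qed.

Lemma cderiv_minus f g t l m :
  cderiv f t l -> cderiv g t m -> cderiv (fun s => f s - g s)%C t (l - m)%C.
Proof. intros; apply cderiv_plus; [|apply cderiv_opp]; assumption. Qed.

Lemma cderiv_RtoC (f : R -> R) (t l : R) :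
  is_derive f t l -> cderiv (fun s => RtoC (f s)) t l.
Proof.
  intros F; split; [exact F | exact (is_derive_const (V := R_NormedModule) 0 t)].
Qed.

Lemma cderiv_id t : cderiv (fun s => RtoC s) t 1.
Proof. apply cderiv_RtoC, (is_derive_id (K := R_AbsRing)). Qed.

Lemma cderiv_cexp f t l :
  cderiv f t l -> cderiv (fun s => cexp (f s)) t (l * cexp (f t))%C.
Proof.
  intros [F1 F2].
  assert (HE : is_derive (fun s => exp (Re (f s))) t (Re l * exp (Re (f t)))).
  { apply (is_derive_comp exp (fun s => Re (f s))); [apply is_derive_exp | exact F1]. }
  assert (HC : is_derive (fun s => cos (Im (f s))) t (Im l * - sin (Im (f t)))).
  { apply (is_derive_comp cos (fun s => Im (f s))); [apply is_derive_cos | exact F2]. }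
  assert (HS : is_derive (fun s => sin (Im (f s))) t (Im l * cos (Im (f t)))).
  { apply (is_derive_comp sin (fun s => Im (f s))); [apply is_derive_sin | exact F2]. }
  split; (eapply is_derive_eq; [|apply (is_derive_mult (K := R_AbsRing));
     try eassumption; apply Rmult_comm]); unfold plus, mult, Re, Im; simpl; unfold Re, Im; bring.
Qed.

(** * Mean value inequalities and Taylor bounds *)

Lemma continuity_pt_cont (f : R -> R) t : continuous f t -> continuity_pt f t.
Proof. apply continuity_pt_filterlim. Qed.

Lemma nonincreasing_of_derive (p p' : R -> R) (a b : R) :
  a <= b -> (forall t, a < t < b -> is_derive p t (p' t)) ->
  (forall t, a <= t <= b -> continuous p t) ->
  (forall t, a < t < b -> p' t <= 0) -> p b <= p a.
Proof.
  intros Hab Dp Cp Hp.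
  (* [MVT_gen] may return an endpoint, where [p'] is unconstrained: cap it at [0]. *)
  destruct (MVT_gen p a b (fun t => Rmin 0 (p' t))) as [c [_ Heq]].
  - intros x Hx. rewrite Rmin_left, Rmax_right in Hx by lra.
    rewrite Rmin_right by auto. auto.
  - intros x Hx. rewrite Rmin_left, Rmax_right in Hx by lra.
    apply continuity_pt_cont; auto.
  - pose proof (Rmin_l 0 (p' c)). nra.
Qed.

(** Multiplying by the conjugate of [d = f b - f a] reduces to a real function:
    [Re (conj d * f) - |d| * g] has derivative at most [|d| * (|f'| - g') <= 0], and its increment
    is [|d|^2 - |d| * (g b - g a)]. *)
Lemma mean_value_ineq (f f' : R -> C) (g g' : R -> R) (a b : R) :
  a <= b ->
  (forall t, a < t < b -> cderiv f t (f' t)) -> (forall t, a <= t <= b -> ccont f t) ->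
  (forall t, a < t < b -> is_derive g t (g' t)) -> (forall t, a <= t <= b -> continuous g t) ->
  (forall t, a < t < b -> Cmod (f' t) <= g' t) ->
  Cmod (f b - f a) <= g b - g a.
Proof.
  intros Hab Df Cf Dg Cg Hle.
  set (d := (f b - f a)%C).
  destruct (Ceq_dec d 0) as [Hd|Hd].
  - rewrite Hd, Cmod_0.
    enough (- g b <= - g a) by lra.
    apply (nonincreasing_of_derive (fun t => - g t) (fun t => - g' t)); auto.
    + intros; apply (is_derive_opp (V := R_NormedModule)); auto.
    + intros; apply (continuous_opp (V := R_NormedModule)); auto.
    + intros t Ht. specialize (Hle t Ht). pose proof (Cmod_ge_0 (f' t)). lra.
  - pose proof (proj1 (Cmod_gt_0 _) Hd) as Hd'.
    assert (H : Re (Cconj d * f b) - Cmod d * g b <= Re (Cconj d * f a) - Cmod d * g a).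
    { apply (nonincreasing_of_derive (fun t => Re (Cconj d * f t) - Cmod d * g t)
                (fun t => Re (Cconj d * f' t) - Cmod d * g' t)); auto.
      - intros t Ht. apply (is_derive_minus (V := R_NormedModule)).
        + apply (cderiv_scal (Cconj d) f t (f' t)); auto.
        + apply is_derive_scal; auto.
      - intros t Ht. apply (continuous_minus (V := R_NormedModule)).
        + apply (ccont_mult (fun _ => Cconj d) f t); [apply ccont_const | auto].
        + apply (continuous_mult (K := R_AbsRing)); [apply continuous_const|auto].
      - intros t Ht. pose proof (Re_le_Cmod (Cconj d * f' t)) as H1.
        rewrite Cmod_mult, Cmod_conj in H1. specialize (Hle t Ht). nra. }
    assert (H2 : Re (Cconj d * f b) - Re (Cconj d * f a) = Cmod d * Cmod d).
    { transitivity (Re d ^ 2 + Im d ^ 2).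
      - unfold d; simpl; bring.
      - rewrite <- Cmod_eq; bring. }
    apply (Rmult_le_reg_l (Cmod d)); [assumption|]. lra.
Qed.

Lemma mean_value_const (f f' : R -> C) (M a b : R) :
  a <= b ->
  (forall t, a < t < b -> cderiv f t (f' t)) -> (forall t, a <= t <= b -> ccont f t) ->
  (forall t, a < t < b -> Cmod (f' t) <= M) ->
  Cmod (f b - f a) <= M * (b - a).
Proof.
  intros Hab Df Cf Hle. replace (M * (b - a)) with (M * b - M * a) by bring.
  apply (mean_value_ineq f f' (fun t => M * t) (fun _ => M)); auto.
  - intros; auto_derive; auto; bring.
  - intros; apply (@ex_derive_continuous _ R_NormedModule). auto_derive; auto.
Qed.

Lemma mean_value_const_abs (f f' : R -> C) (M a b : R) (t u : R) :
  (forall s, a <= s <= b -> cderiv f s (f' s)) ->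
  (forall s, a <= s <= b -> Cmod (f' s) <= M) ->
  a <= t <= b -> a <= u <= b ->
  Cmod (f u - f t) <= M * Rabs (u - t).
Proof.
  intros Df Hle Ht Hu.
  destruct (Rle_dec t u) as [H|H].
  - rewrite Rabs_right by lra.
    apply (mean_value_const f f'); auto; intros; [apply Df|eapply cderiv_cont, Df|apply Hle]; lra.
  - rewrite Rabs_left, Cmod_sym by lra.
    replace (- (u - t)) with (t - u) by bring.
    apply (mean_value_const f f'); auto; intros;
      try (apply Df); try (eapply cderiv_cont, Df); try (apply Hle); lra.
Qed.

(** The mean value inequality is applied twice: [f'] stays within [M |u - t|] of [f' t] between [t]
    and [u], and this bounds the slope of [f s - s * f' t] there. Hence the constant [M] instead of
    [M / 2]. *)
Lemma taylor1 (f f' f'' : R -> C) (M a b : R) (t u : R) :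
  (forall s, a <= s <= b -> cderiv f s (f' s)) ->
  (forall s, a <= s <= b -> cderiv f' s (f'' s)) ->
  (forall s, a <= s <= b -> Cmod (f'' s) <= M) ->
  a <= t <= b -> a <= u <= b ->
  Cmod (f u - f t - (u - t)%R * f' t) <= M * (u - t) ^ 2.
Proof.
  intros Df Df' Hle Ht Hu.
  assert (HM : 0 <= M) by (eapply Rle_trans; [apply Cmod_ge_0|apply (Hle t Ht)]).
  set (g := fun s => (f s - RtoC s * f' t)%C).
  replace (f u - f t - (u - t)%R * f' t)%C with (g u - g t)%C
    by (unfold g; rewrite RtoC_minus; bring).
  rewrite <- pow2_abs, <- Rsqr_pow2. unfold Rsqr. rewrite <- Rmult_assoc.
  apply (mean_value_const_abs g (fun s => f' s - f' t)%C (M * Rabs (u - t))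
           (Rmin t u) (Rmax t u)).
  - intros s Hs. apply cderiv_minus.
    + apply Df. revert Hs. unfold Rmin, Rmax; destruct Rle_dec; lra.
    + eapply cderiv_ext_val; [|apply cderiv_mult; [apply cderiv_id|apply cderiv_const]].
      bring.
  - intros s Hs.
    eapply Rle_trans.
    + apply (mean_value_const_abs f' f'' M a b); auto.
      revert Hs; unfold Rmin, Rmax; destruct Rle_dec; lra.
    + apply Rmult_le_compat_l; auto.
      revert Hs; unfold Rmin, Rmax, Rabs; destruct Rle_dec; repeat destruct Rcase_abs; lra.
  - unfold Rmin, Rmax; destruct Rle_dec; lra.
  - unfold Rmin, Rmax; destruct Rle_dec; lra.
Qed.

(** On the segment from [v] to [u] the real part stays below [m], so the derivative along it has
    modulus at most [|u - v| e^m]. *)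
Lemma cexp_diff_le (u v : C) (m : R) :
  Re u <= m -> Re v <= m -> Cmod (cexp u - cexp v) <= Cmod (u - v) * exp m.
Proof.
  intros Hu Hv.
  set (g := fun s : R => cexp (v + RtoC s * (u - v))%C).
  replace (cexp u) with (g 1) by (unfold g; f_equal; bring).
  replace (cexp v) with (g 0) by (unfold g; f_equal; bring).
  replace (Cmod (u - v) * exp m) with (Cmod (u - v) * exp m * (1 - 0)) by bring.
  assert (D : forall t, cderiv g t ((u - v) * g t)%C).
  { intros t. apply cderiv_cexp. eapply cderiv_ext_val;
      [|apply cderiv_plus; [apply cderiv_const|apply cderiv_mult; [apply cderiv_id|apply cderiv_const]]].
    bring. }
  apply (mean_value_const g (fun t => (u - v) * g t)%C); try lra; intros t Ht; auto.
  - eapply cderiv_cont, D.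
  - rewrite Cmod_mult. apply Rmult_le_compat_l; [apply Cmod_ge_0|].
    unfold g. rewrite Cmod_cexp. apply exp_le.
    unfold Re in *; simpl. nra.
Qed.

(** * Taylor polynomials of the exponential *)

Fixpoint cexp_sum (u : C) (K : nat) : C :=
  match K with
  | O => RtoC 1
  | S K' => (cexp_sum u K' + RtoC (/ INR (fact (S K'))) * u ^ (S K'))%C
  end.

Lemma cexp_sum_0 (K : nat) : cexp_sum 0 K = 1.
Proof.
  induction K as [|K IH]; [reflexivity|].
  change (cexp_sum 0 (S K)) with (cexp_sum 0 K + RtoC (/ INR (fact (S K))) * 0 ^ S K)%C.
  rewrite IH, Cpow_S. bring.
Qed.

Lemma cderiv_Cpow (u : C) (k : nat) t :
  cderiv (fun s => (RtoC s * u) ^ S k)%C t (INR (S k) * u * (RtoC t * u) ^ k)%C.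
Proof.
  assert (D : cderiv (fun s => RtoC s * u)%C t u).
  { eapply cderiv_ext_val; [|apply cderiv_mult; [apply cderiv_id|apply cderiv_const]]. bring. }
  induction k as [|k IH].
  - eapply cderiv_ext_val; [|apply cderiv_mult; [exact D|apply cderiv_const]].
    simpl; bring.
  - eapply cderiv_ext_val; [|exact (cderiv_mult _ (fun s => (RtoC s * u) ^ S k)%C t _ _ D IH)].
    rewrite (S_INR (S k)), RtoC_plus. cbv beta. rewrite !Cpow_S. ring.
Qed.

Lemma cderiv_cexp_sum (u : C) (k : nat) t :
  cderiv (fun s => cexp_sum (RtoC s * u) (S k)) t (u * cexp_sum (RtoC t * u) k)%C.
Proof.
  assert (HF : forall j, (RtoC (/ INR (fact (S j))) * RtoC (INR (S j)))%C = RtoC (/ INR (fact j))).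
  { intros j. rewrite <- RtoC_mult. f_equal. rewrite fact_simpl, mult_INR.
    field. split; [apply INR_fact_neq_0|apply not_0_INR; auto]. }
  induction k as [|k IH].
  - eapply cderiv_ext_val; [|apply cderiv_plus; [apply cderiv_const|apply cderiv_scal, cderiv_Cpow]].
    replace (RtoC (/ INR (fact 1)) * (INR 1 * u * (RtoC t * u) ^ 0))%C
      with (RtoC (/ INR (fact 1)) * RtoC (INR 1) * (u * (RtoC t * u) ^ 0))%C by bring.
    rewrite HF. change (cexp_sum (RtoC t * u) 0) with (RtoC 1).
    replace (/ INR (fact 0)) with 1 by (simpl; field). bring.
  - eapply cderiv_ext_val; [|apply cderiv_plus; [exact IH|apply cderiv_scal, cderiv_Cpow]].
    replace (RtoC (/ INR (fact (S (S k)))) * (INR (S (S k)) * u * (RtoC t * u) ^ S k))%C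
      with (RtoC (/ INR (fact (S (S k)))) * RtoC (INR (S (S k))) * (u * (RtoC t * u) ^ S k))%C by bring.
    rewrite HF.
    change (cexp_sum (RtoC t * u) (S k)) with
      (cexp_sum (RtoC t * u) k + RtoC (/ INR (fact (S k))) * (RtoC t * u) ^ S k)%C. bring.
Qed.

Lemma cexp_remainder (u : C) (K : nat) :
  Cmod (cexp u - cexp_sum u K) <= Cmod u ^ S K / INR (fact (S K)) * exp (Cmod u).
Proof.
  (* The bound is proved along the whole segment [s * u], with the factor [s ^ S K]: the
     [s]-derivative of the remainder of degree [S K] is [u] times the remainder of degree [K], so
     integrating the induction hypothesis produces the next factorial. *)
  assert (H : forall s, 0 <= s <= 1 ->
    Cmod (cexp (s * u) - cexp_sum (s * u) K)
      <= Cmod u ^ S K / INR (fact (S K)) * exp (Cmod u) * s ^ S K).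
  { induction K as [|K IH]; intros s Hs.
    - simpl cexp_sum. rewrite <- cexp_0.
      eapply Rle_trans; [apply (cexp_diff_le _ _ (Cmod u))|].
      + eapply Rle_trans; [apply Re_le_Cmod|]. rewrite Cmod_mult, Cmod_R, Rabs_right by lra.
        pose proof (Cmod_ge_0 u). nra.
      + simpl. apply Cmod_ge_0.
      + replace (s * u - 0)%C with (s * u)%C by bring.
        rewrite Cmod_mult, Cmod_R, Rabs_right by lra. simpl. apply Req_le. field.
    - set (f := fun s : R => (cexp (s * u) - cexp_sum (s * u) (S K))%C).
      set (c := Cmod u ^ S (S K) / INR (fact (S (S K))) * exp (Cmod u)).
      assert (E0 : f 0 = 0).
      { unfold f. replace (0 * u)%C with (RtoC 0) by bring. rewrite cexp_0.
        rewrite cexp_sum_0. bring. }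
      replace (cexp (s * u) - cexp_sum (s * u) (S K))%C with (f s - f 0)%C
        by (rewrite E0; unfold f; bring).
      replace (c * s ^ S (S K)) with (c * s ^ S (S K) - c * 0 ^ S (S K)) by (simpl; bring).
      assert (D : forall t, cderiv f t (u * (cexp (t * u) - cexp_sum (t * u) K))%C).
      { intros t. eapply cderiv_ext_val; [|apply cderiv_minus; [apply cderiv_cexp|apply cderiv_cexp_sum]].
        2: apply cderiv_mult; [apply cderiv_id|apply cderiv_const].
        bring. }
      apply (mean_value_ineq f (fun t => u * (cexp (t * u) - cexp_sum (t * u) K))%C
        (fun t => c * t ^ S (S K)) (fun t => c * (INR (S (S K)) * t ^ S K))); try lra.
      + auto.
      + intros; eapply cderiv_cont, D.
      + intros t _. apply (is_derive_scal (fun t => t ^ S (S K)) t c).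
        eapply is_derive_eq; [|apply (is_derive_pow (fun t => t) (S (S K)) t 1), (is_derive_id (K := R_AbsRing))].
        simpl pred. bring.
      + intros t _. apply (@ex_derive_continuous _ R_NormedModule). eexists.
        apply (is_derive_scal (fun t => t ^ S (S K)) t c).
        apply (is_derive_pow (fun t => t) (S (S K)) t 1), (is_derive_id (K := R_AbsRing)).
      + intros t Ht. rewrite Cmod_mult.
        eapply Rle_trans; [apply Rmult_le_compat_l; [apply Cmod_ge_0|apply IH; lra]|].
        apply Req_le. unfold c. rewrite (fact_simpl (S K)), mult_INR. simpl pow.
        field. split; [apply INR_fact_neq_0|apply not_0_INR; auto]. }
  specialize (H 1 ltac:(lra)). rewrite pow1, Rmult_1_r in H.
  replace (1 * u)%C with u in H by bring. exact H.
Qed.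

(** * Integrals over the unit interval *)

Lemma ccont_ex_RInt (f : R -> C) (a b : R) :
  (forall t, ccont f t) ->
  ex_RInt (fun t => Re (f t)) a b /\ ex_RInt (fun t => Im (f t)) a b.
Proof.
  intros H; split; apply (ex_RInt_continuous (V := R_CompleteNormedModule)); intros; apply H.
Qed.

Lemma cont_ex_RInt (f : R -> R) (a b : R) : (forall t, continuous f t) -> ex_RInt f a b.
Proof. intros H; apply (ex_RInt_continuous (V := R_CompleteNormedModule)); auto. Qed.

Lemma CI_plus f g : (forall t, ccont f t) -> (forall t, ccont g t) ->
  CI (fun t => f t + g t)%C = (CI f + CI g)%C.
Proof.
  intros Hf Hg. destruct (ccont_ex_RInt f 0 1 Hf), (ccont_ex_RInt g 0 1 Hg).
  apply C_ext; simpl; apply (RInt_plus (V := R_CompleteNormedModule)); auto.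
Qed.

Lemma CI_scal (c : C) f : (forall t, ccont f t) -> CI (fun t => c * f t)%C = (c * CI f)%C.
Proof.
  intros Hf. destruct (ccont_ex_RInt f 0 1 Hf).
  assert (S : forall (r : R) (g : R -> R), ex_RInt g 0 1 -> ex_RInt (fun t => r * g t) 0 1 /\
     RInt (fun t => r * g t) 0 1 = r * RInt g 0 1).
  { intros r g Hg; split; [apply (ex_RInt_scal (V := R_CompleteNormedModule))|
      apply (RInt_scal (V := R_CompleteNormedModule))]; auto. }
  apply C_ext; simpl.
  - rewrite <- (proj2 (S (fst c) _ H)), <- (proj2 (S (snd c) _ H0)).
    apply (RInt_minus (V := R_CompleteNormedModule)); apply S; auto.
  - rewrite <- (proj2 (S (fst c) _ H0)), <- (proj2 (S (snd c) _ H)).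
    apply (RInt_plus (V := R_CompleteNormedModule)); apply S; auto.
Qed.

Lemma CI_minus f g : (forall t, ccont f t) -> (forall t, ccont g t) ->
  CI (fun t => f t - g t)%C = (CI f - CI g)%C.
Proof.
  intros Hf Hg. destruct (ccont_ex_RInt f 0 1 Hf), (ccont_ex_RInt g 0 1 Hg).
  apply C_ext; simpl; apply (RInt_minus (V := R_CompleteNormedModule)); auto.
Qed.

Lemma CI_ext f g : (forall t, 0 < t < 1 -> f t = g t) -> CI f = CI g.
Proof.
  intros H. unfold CI. f_equal; apply (RInt_ext (V := R_CompleteNormedModule)); intros t;
    rewrite Rmin_left, Rmax_right by lra; intros Ht; rewrite H; auto.
Qed.

Lemma CI_RtoC (f : R -> R) : CI (fun t => RtoC (f t)) = RInt f 0 1.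
Proof.
  apply C_ext; simpl; auto.
  rewrite (RInt_const (V := R_CompleteNormedModule)). unfold scal; simpl; unfold mult; simpl. bring.
Qed.

(** Multiplication by the conjugate of the value of the integral makes that value real and
    non-negative; the real part of the new integrand is then bounded by its modulus. *)
Lemma CI_norm (f : R -> C) (g : R -> R) :
  (forall t, ccont f t) -> (forall t, continuous g t) ->
  (forall t, 0 < t < 1 -> Cmod (f t) <= g t) -> Cmod (CI f) <= RInt g 0 1.
Proof.
  intros Hf Hg Hle. set (d := CI f).
  destruct (Ceq_dec d 0) as [Hd|Hd].
  - rewrite Hd, Cmod_0. apply RInt_ge_0; [lra|apply cont_ex_RInt; auto|].
    intros t Ht. eapply Rle_trans; [apply Cmod_ge_0|apply Hle; auto].
  - pose proof (proj1 (Cmod_gt_0 _) Hd) as Hd'.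
    assert (E : Cmod d * Cmod d = Re (CI (fun t => Cconj d * f t)%C)).
    { rewrite CI_scal by auto. fold d. transitivity (Re d ^ 2 + Im d ^ 2).
      - rewrite <- Cmod_eq; bring.
      - simpl; bring. }
    assert (Hc : forall t, ccont (fun t => Cconj d * f t)%C t)
      by (intros; apply ccont_mult; [apply ccont_const|auto]).
    apply (Rmult_le_reg_l (Cmod d)); [assumption|]. rewrite E.
    rewrite <- (RInt_scal (V := R_CompleteNormedModule)) by (apply cont_ex_RInt; auto).
    apply RInt_le; [lra|apply (ccont_ex_RInt _ 0 1 Hc)|
      apply (ex_RInt_scal (V := R_CompleteNormedModule)), cont_ex_RInt; auto|].
    intros t Ht. eapply Rle_trans; [apply Re_le_Cmod|].
    rewrite Cmod_mult, Cmod_conj. apply Rmult_le_compat_l; [lra|auto].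
Qed.

Lemma CI_norm_const (f : R -> C) (M : R) :
  (forall t, ccont f t) -> (forall t, 0 < t < 1 -> Cmod (f t) <= M) -> Cmod (CI f) <= M.
Proof.
  intros Hf Hle. replace M with (RInt (fun _ => M) 0 1).
  - apply CI_norm; auto. intros; apply continuous_const.
  - rewrite (RInt_const (V := R_CompleteNormedModule)). unfold scal; simpl; unfold mult; simpl. bring.
Qed.

Lemma is_derive_RInt_cont (g : R -> R) (a x : R) :
  (forall t, continuous g t) -> is_derive (fun x => RInt g a x) x (g x).
Proof.
  intros Cg. apply (is_derive_RInt (V := R_CompleteNormedModule) g _ a).
  - apply filter_forall. intros y. apply (RInt_correct (V := R_CompleteNormedModule)).
    apply cont_ex_RInt; auto.
  - apply Cg.
Qed.

(** The derivative is required only inside the interval because [q^(1/a)] need not be differentiable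
    at [0] and its clamped extension may have a corner at [1]. The function [f - RInt g 0] is
    continuous on [0,1] with zero derivative inside. *)
Lemma FTC_open_R (f g : R -> R) :
  (forall t, continuous g t) -> (forall t, 0 <= t <= 1 -> continuous f t) ->
  (forall t, 0 < t < 1 -> is_derive f t (g t)) -> RInt g 0 1 = f 1 - f 0.
Proof.
  intros Cg Cf Df.
  set (p := fun x => f x - RInt g 0 x).
  pose proof (fun x => is_derive_RInt_cont g 0 x Cg) as DI.
  destruct (MVT_gen p 0 1 (fun _ => 0)) as [c [_ Heq]].
  - intros x Hx. rewrite Rmin_left, Rmax_right in Hx by lra.
    eapply is_derive_eq; [|apply (is_derive_minus (V := R_NormedModule)); [apply Df; auto|apply DI]].
    unfold minus, plus, opp; simpl; bring.
  - intros x Hx. rewrite Rmin_left, Rmax_right in Hx by lra.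
    apply continuity_pt_cont, (continuous_minus (V := R_NormedModule)); [auto|].
    apply (@ex_derive_continuous _ R_NormedModule). eexists; apply DI.
  - unfold p in Heq. rewrite (RInt_point (V := R_CompleteNormedModule)) in Heq.
    unfold zero in Heq; simpl in Heq. lra.
Qed.

Lemma FTC_open (f g : R -> C) :
  (forall t, ccont g t) -> (forall t, 0 <= t <= 1 -> ccont f t) ->
  (forall t, 0 < t < 1 -> cderiv f t (g t)) -> CI g = (f 1 - f 0)%C.
Proof.
  intros Cg Cf Df. apply C_ext; simpl; apply (FTC_open_R (fun t => _ (f t)) (fun t => _ (g t)));
    intros; try apply Cg; try apply Cf; try apply Df; auto.
Qed.

(** * Logarithms and real powers *)

(** Principal logarithm on the right half-plane; because of the quotient in [atan] the formula is
    used only there. The paths below stay in that half-plane, apart from the end point [0]. *)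
Definition clog (v : C) : C := (/ 2 * ln (Re v ^ 2 + Im v ^ 2), atan (Im v / Re v)).

Lemma Cmod_exp_ln (v : C) : v <> 0 -> exp (/ 2 * ln (Re v ^ 2 + Im v ^ 2)) = Cmod v.
Proof.
  intros Hv. rewrite <- Cmod_eq. pose proof (proj1 (Cmod_gt_0 _) Hv).
  replace (ln (Cmod v ^ 2)) with (2 * ln (Cmod v)).
  - replace (/ 2 * (2 * ln (Cmod v))) with (ln (Cmod v)) by field. apply exp_ln; auto.
  - simpl. rewrite Rmult_1_r, ln_mult by auto. ring.
Qed.

Lemma cexp_clog (v : C) : 0 < Re v -> cexp (clog v) = v.
Proof.
  intros Hv.
  assert (Hv0 : v <> 0) by (intros ->; simpl in Hv; lra).
  unfold cexp. change (Re (clog v)) with (/ 2 * ln (Re v ^ 2 + Im v ^ 2)).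
  change (Im (clog v)) with (atan (Im v / Re v)).
  rewrite Cmod_exp_ln, cos_atan, sin_atan by auto.
  set (s := sqrt (1 + (Im v / Re v)²)).
  assert (Hs : s * s = 1 + (Im v / Re v)²).
  { apply sqrt_sqrt. pose proof (Rle_0_sqr (Im v / Re v)). lra. }
  assert (Hs0 : 0 < s). { apply sqrt_lt_R0. pose proof (Rle_0_sqr (Im v / Re v)). lra. }
  assert (HC : Cmod v = Re v * s).
  { apply Rsqr_inj; [apply Cmod_ge_0|nra|].
    rewrite Rsqr_mult. unfold Rsqr at 3. rewrite Hs.
    rewrite Rsqr_pow2, Cmod_eq. unfold Rsqr. field. lra. }
  rewrite HC. apply C_ext; simpl; field; lra.
Qed.

Lemma is_derive_polar (p q : R -> R) (t lp lq : R) :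
  0 < p t -> is_derive p t lp -> is_derive q t lq ->
  is_derive (fun s => / 2 * ln (p s ^ 2 + q s ^ 2)) t
    ((lp * p t + lq * q t) / (p t ^ 2 + q t ^ 2)) /\
  is_derive (fun s => atan (q s / p s)) t
    ((lq * p t - lp * q t) / (p t ^ 2 + q t ^ 2)).
Proof.
  intros Hp Dp Dq.
  assert (HX : 0 < p t ^ 2 + q t ^ 2) by nra.
  pose proof (is_derive_unique _ _ _ Dp) as D1.
  pose proof (is_derive_unique _ _ _ Dq) as D2.
  assert (E1 : ex_derive p t) by (eexists; eauto).
  assert (E2 : ex_derive q t) by (eexists; eauto).
  split; auto_derive; simpl in HX.
  - repeat split; auto.
  - change (fun x : R => p x) with p. change (fun x : R => q x) with q.
    rewrite D1, D2. field. lra.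
  - repeat split; auto; lra.
  - change (fun x : R => p x) with p. change (fun x : R => q x) with q.
    rewrite D1, D2. field. repeat split; nra.
Qed.

Lemma cderiv_clog (f : R -> C) t l :
  0 < Re (f t) -> cderiv f t l -> cderiv (fun s => clog (f s)) t (l / f t)%C.
Proof.
  intros Hf [F1 F2].
  assert (HX : 0 < Re (f t) ^ 2 + Im (f t) ^ 2) by nra.
  destruct (is_derive_polar (fun s => Re (f s)) (fun s => Im (f s)) t _ _ Hf F1 F2) as [A B].
  split; simpl.
  - eapply is_derive_eq; [|exact A]. unfold Re, Im in *. match goal with |- @eq _ ?x ?y => change (@eq R x y) end.
    field. simpl in HX; lra.
  - eapply is_derive_eq; [|exact B]. unfold Re, Im in *. match goal with |- @eq _ ?x ?y => change (@eq R x y) end.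
    field. simpl in HX; lra.
Qed.

Lemma Re_clog (v : C) : v <> 0 -> Re (clog v) = ln (Cmod v).
Proof. intros Hv. rewrite <- Cmod_exp_ln by auto. rewrite ln_exp. reflexivity. Qed.

Lemma clog_scal (r : R) (v : C) : 0 < r -> 0 < Re v -> clog (r * v)%C = (ln r + clog v)%C.
Proof.
  intros Hr Hv.
  assert (H : 0 < Re v ^ 2 + Im v ^ 2) by nra.
  unfold clog. rewrite re_scal_l, im_scal_l. apply C_ext; simpl.
  - replace (r * Re v * (r * Re v * 1) + r * Im v * (r * Im v * 1))
      with (r * r * (Re v ^ 2 + Im v ^ 2)) by ring.
    rewrite !ln_mult by nra. simpl. field.
  - rewrite Rplus_0_l. f_equal. field. lra.
Qed.

(** A factor [-1], [i] or [-i] moves [v] into the right half-plane if it is not already there, at a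
    cost of at most [PI <= 4] in the imaginary part. What matters is a bound independent of [v]: it
    will keep the shift [om] of logarithmic size. *)
Lemma cexp_surj (v : C) : v <> 0 ->
  exists u, cexp u = v /\ Re u = ln (Cmod v) /\ Rabs (Im u) <= 8.
Proof.
  intros Hv.
  pose proof PI_4 as P4. pose proof PI_RGT_0 as P0.
  assert (HR : forall w, 0 < Re w -> exists u, cexp u = w /\ Re u = ln (Cmod w) /\ Rabs (Im u) <= 2).
  { intros w Hw. assert (Hw0 : w <> 0) by (intros ->; simpl in Hw; lra).
    exists (clog w). split; [apply cexp_clog; auto|]. split; [apply Re_clog; auto|].
    simpl. pose proof (atan_bound (Im w / Re w)). apply Rabs_le. lra. }
  destruct (Rtotal_order (Re v) 0) as [H|[H|H]].
  - destruct (HR (- v)%C) as [u [H1 [H2 H3]]]; [simpl; unfold Re in *; lra|].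
    exists (u + (0, PI))%C. split; [|split].
    + rewrite cexp_plus, H1.
      replace (cexp (0, PI)) with (- (1))%C; [ring|].
      unfold cexp; simpl. rewrite exp_0, cos_PI, sin_PI. apply C_ext; simpl; ring.
    + rewrite re_plus, H2, Cmod_opp. simpl. ring.
    + rewrite im_plus. simpl. eapply Rle_trans; [apply Rabs_triang|].
      rewrite (Rabs_right PI) by lra. lra.
  - destruct (HR (v * (0, (- sign (Im v))%R))%C) as [u [H1 [H2 H3]]].
    + assert (Im v <> 0) by (intros H0; apply Hv, C_ext; auto).
      simpl. change (snd v) with (Im v). change (fst v) with (Re v). rewrite H.
      destruct (Rdichotomy _ _ H0); [rewrite sign_eq_m1|rewrite sign_eq_1]; lra.
    + assert (S : sign (Im v) * sign (Im v) = 1).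
      { assert (Im v <> 0) by (intros H0; apply Hv, C_ext; auto).
        destruct (Rdichotomy _ _ H0); [rewrite sign_eq_m1|rewrite sign_eq_1]; lra. }
      assert (SA : Rabs (sign (Im v)) = 1).
      { assert (Im v <> 0) by (intros H0; apply Hv, C_ext; auto).
        destruct (Rdichotomy _ _ H0); [rewrite sign_eq_m1|rewrite sign_eq_1]; auto;
          unfold Rabs; destruct Rcase_abs; lra. }
      exists (u + (0, (sign (Im v) * (PI / 2))%R))%C. split; [|split].
      * rewrite cexp_plus, H1.
        replace (cexp (0, sign (Im v) * (PI / 2))) with ((0, sign (Im v)) : C).
        -- clear - S. revert S. generalize (sign (Im v)). intros e S. destruct v as [v1 v2].
           simpl in *. apply C_ext; simpl; [transitivity (v1 * (e * e))|transitivity (v2 * (e * e))];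
             try ring; rewrite S; ring.
        -- unfold cexp; simpl.
           assert (Im v <> 0) by (intros H0; apply Hv, C_ext; auto).
           destruct (Rdichotomy _ _ H0); [rewrite sign_eq_m1|rewrite sign_eq_1]; auto;
             apply C_ext; simpl; rewrite exp_0.
           ++ replace (-1 * (PI / 2)) with (- (PI / 2)) by ring. rewrite cos_neg, cos_PI2; ring.
           ++ replace (-1 * (PI / 2)) with (- (PI / 2)) by ring. rewrite sin_neg, sin_PI2; ring.
           ++ rewrite !Rmult_1_l, cos_PI2; ring.
           ++ rewrite !Rmult_1_l, sin_PI2; ring.
      * rewrite re_plus, H2, Cmod_mult. simpl.
        replace (Cmod (0, - sign (Im v))) with 1; [rewrite Rmult_1_r; ring|].
        unfold Cmod; simpl. replace (0 * (0 * 1) + - sign (Im v) * (- sign (Im v) * 1)) with 1 by lra.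
        symmetry; apply sqrt_1.
      * rewrite im_plus. simpl. eapply Rle_trans; [apply Rabs_triang|].
        rewrite Rabs_mult, SA, (Rabs_right (PI / 2)) by lra. lra.
  - destruct (HR v H) as [u [H1 [H2 H3]]]. exists u. repeat split; auto; lra.
Qed.

(** The power [x^s], continued by [0] to [x <= 0]. For [s > 0] it is continuous on the whole line,
    so integrands built from it need no separate discussion at the ends. *)
Definition rpw (s x : R) : R := if Rle_dec x 0 then 0 else exp (s * ln x).

Lemma rpw_pos s x : 0 < x -> rpw s x = exp (s * ln x).
Proof. intros; unfold rpw; destruct Rle_dec; auto; lra. Qed.

Lemma rpw_neg s x : x <= 0 -> rpw s x = 0.
Proof. intros; unfold rpw; destruct Rle_dec; auto; lra. Qed.

Lemma rpw_ge_0 s x : 0 <= rpw s x.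
Proof. unfold rpw; destruct Rle_dec; [lra|left; apply exp_pos]. Qed.

Lemma rpw_1 s : rpw s 1 = 1.
Proof. rewrite rpw_pos, ln_1, Rmult_0_r, exp_0; lra. Qed.

Lemma rpw_le s x y : 0 < s -> x <= y -> rpw s x <= rpw s y.
Proof.
  intros Hs Hxy. destruct (Rle_lt_dec x 0).
  - rewrite (rpw_neg s x) by auto. apply rpw_ge_0.
  - rewrite !rpw_pos by lra. apply exp_le, Rmult_le_compat_l; [lra|].
    destruct Hxy as [H|<-]; [left; apply ln_increasing; auto|lra].
Qed.

Lemma rpw_succ s x : rpw (s + 1) x = Rmax x 0 * rpw s x.
Proof.
  destruct (Rle_lt_dec x 0).
  - rewrite !rpw_neg by auto. ring.
  - rewrite !rpw_pos, Rmax_left by lra.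
    replace ((s + 1) * ln x) with (ln x + s * ln x) by ring.
    rewrite exp_plus, exp_ln by auto. reflexivity.
Qed.

Lemma is_derive_rpw s x : 0 < x -> is_derive (rpw s) x (s * rpw s x / x).
Proof.
  intros Hx. apply (is_derive_ext_loc (fun y => exp (s * ln y))).
  - exists (mkposreal x Hx). intros y Hy.
    unfold ball in Hy; simpl in Hy. unfold AbsRing_ball, abs, minus, plus, opp in Hy; simpl in Hy.
    apply Rabs_def2 in Hy. rewrite rpw_pos by lra. reflexivity.
  - rewrite rpw_pos by auto. auto_derive; auto. field; lra.
Qed.

Lemma continuous_R_iff (f : R -> R) x :
  continuous f x <->
  forall e, 0 < e -> exists d, 0 < d /\ forall y, Rabs (y - x) < d -> Rabs (f y - f x) < e.
Proof.
  split.
  - intros H e He.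
    destruct (proj1 (filterlim_locally _ _) H (mkposreal e He)) as [d Hd].
    exists d; split; [apply cond_pos|]. intros y Hy. apply Hd, Hy.
  - intros H. apply (proj2 (filterlim_locally _ _)). intros e.
    destruct (H e (cond_pos e)) as [d [Hd Hy]].
    exists (mkposreal d Hd). intros y Hb. apply Hy, Hb.
Qed.

Lemma continuous_rpw s x : 0 < s -> continuous (rpw s) x.
Proof.
  intros Hs. destruct (Rtotal_order x 0) as [H|[->|H]].
  - apply continuous_R_iff. intros e He. exists (- x). split; [lra|].
    intros y Hy. apply Rabs_def2 in Hy. rewrite !rpw_neg by lra.
    rewrite Rminus_0_r, Rabs_R0. auto.
  - apply continuous_R_iff. intros e He. exists (exp (ln e / s)). split; [apply exp_pos|].
    intros y Hy. rewrite (rpw_neg s 0), Rminus_0_r by lra. rewrite Rminus_0_r in Hy.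
    rewrite Rabs_pos_eq by apply rpw_ge_0.
    destruct (Rle_lt_dec y 0); [rewrite rpw_neg; lra|].
    rewrite rpw_pos by auto. rewrite Rabs_pos_eq in Hy by lra.
    rewrite <- (exp_ln e) by auto. apply exp_increasing.
    apply ln_increasing in Hy; auto. rewrite ln_exp in Hy.
    replace (ln e) with (s * (ln e / s)) by (field; lra). apply Rmult_lt_compat_l; auto.
  - apply (@ex_derive_continuous _ R_NormedModule). eexists. apply is_derive_rpw; auto.
Qed.

(** Retraction onto [0,1]: it extends functions that matter only on [0,1] to continuous functions on
    the line. *)
Definition clamp (q : R) : R := Rmax 0 (Rmin q 1).

Lemma clamp_id q : 0 <= q <= 1 -> clamp q = q.
Proof. intros; unfold clamp, Rmax, Rmin; repeat destruct Rle_dec; lra. Qed.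

Lemma clamp_range q : 0 <= clamp q <= 1.
Proof. unfold clamp, Rmax, Rmin; repeat destruct Rle_dec; lra. Qed.

Lemma clamp_lip p q : Rabs (clamp p - clamp q) <= Rabs (p - q).
Proof.
  unfold clamp, Rmax, Rmin, Rabs; repeat destruct Rle_dec; repeat destruct Rcase_abs; lra.
Qed.

Lemma continuous_clamp q : continuous clamp q.
Proof.
  apply continuous_R_iff. intros e He. exists e; split; auto. intros y Hy.
  eapply Rle_lt_trans; [apply clamp_lip|auto].
Qed.

(* Integrating against [q], with [rho q = q^(1/a)], absorbs the weight [a rho^(a-1) d rho],
   which is singular at [0] when [a < 1]. *)
Definition rho (a q : R) : R := rpw (/ a) (clamp q).

Lemma rho_range a q : 0 < a -> 0 <= rho a q <= 1.
Proof.
  intros Ha. unfold rho. split; [apply rpw_ge_0|]. rewrite <- (rpw_1 (/ a)).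
  apply rpw_le; [apply Rinv_0_lt_compat; auto|apply clamp_range].
Qed.

Lemma rho_lt_1 a q : 0 < a -> 0 < q < 1 -> 0 < rho a q < 1.
Proof.
  intros Ha Hq. unfold rho. rewrite clamp_id, rpw_pos by lra.
  split; [apply exp_pos|]. rewrite <- exp_0. apply exp_increasing.
  rewrite <- ln_1. pose proof (ln_increasing q 1 ltac:(lra) ltac:(lra)).
  rewrite ln_1 in *. pose proof (Rinv_0_lt_compat a Ha). nra.
Qed.

Lemma rho_0 a : rho a 0 = 0.
Proof. unfold rho. rewrite clamp_id by lra. apply rpw_neg; lra. Qed.

Lemma rho_1 a : rho a 1 = 1.
Proof. unfold rho. rewrite clamp_id by lra. apply rpw_1. Qed.

Lemma continuous_rho a q : 0 < a -> continuous (rho a) q.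
Proof.
  intros Ha. apply (continuous_comp clamp (rpw (/ a))); [apply continuous_clamp|].
  apply continuous_rpw, Rinv_0_lt_compat; auto.
Qed.

Lemma is_derive_rho a q : 0 < a -> 0 < q < 1 -> is_derive (rho a) q (rho a q / (a * q)).
Proof.
  intros Ha Hq. apply (is_derive_ext_loc (rpw (/ a))).
  - assert (Hm : 0 < Rmin q (1 - q)) by (apply Rmin_pos; lra).
    exists (mkposreal _ Hm). intros y Hy.
    unfold ball in Hy; simpl in Hy. unfold AbsRing_ball, abs, minus, plus, opp in Hy; simpl in Hy.
    apply Rabs_def2 in Hy. unfold rho. rewrite clamp_id; auto.
    pose proof (Rmin_l q (1 - q)). pose proof (Rmin_r q (1 - q)). lra.
  - unfold rho. rewrite clamp_id by lra.
    eapply is_derive_eq; [|apply is_derive_rpw; lra].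
    match goal with |- @eq _ ?x ?y => change (@eq R x y) end. field; lra.
Qed.

(** * Exponential integrals and the minimum modulus principle *)

(** An entire function of [z]. The weight is an arbitrary complex function so that the class is
    closed under translation: passing from [z] to [z0 + h] multiplies the weight by
    [cexp (z0 * rho)], and a local study at [0] covers every point. *)
Definition expint (a : R) (W : R -> C) (z : C) : C :=
  CI (fun q => W q * cexp (z * rho a q))%C.

Lemma ccont_rho a q : 0 < a -> ccont (fun q => RtoC (rho a q)) q.
Proof. intros; apply ccont_RtoC, continuous_rho; auto. Qed.

Lemma ccont_expint a W z :
  0 < a -> (forall q, ccont W q) -> forall q, ccont (fun q => W q * cexp (z * rho a q))%C q.
Proof.
  intros Ha HW q. apply ccont_mult; auto.
  apply ccont_cexp, ccont_mult; [apply ccont_const|apply ccont_rho; auto].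
Qed.

Lemma ccont_Cpow f k t : ccont f t -> ccont (fun s => f s ^ k)%C t.
Proof.
  intros Hf. induction k as [|k IH]; [apply ccont_const|].
  exact (ccont_mult f (fun s => f s ^ k)%C t Hf IH).
Qed.

Lemma ccont_cexp_sum f K t : ccont f t -> ccont (fun s => cexp_sum (f s) K) t.
Proof.
  intros Hf. induction K as [|K IH]; [apply ccont_const|].
  apply ccont_plus; [exact IH|]. apply ccont_mult; [apply ccont_const|].
  apply (ccont_Cpow f (S K)); auto.
Qed.

Definition expint_coef (a : R) (W : R -> C) (k : nat) : C :=
  CI (fun q => W q * rho a q ^ k)%C.

Fixpoint expint_sum (a : R) (W : R -> C) (z : C) (K : nat) : C :=
  match K with
  | O => expint_coef a W 0
  | S K' => (expint_sum a W z K' +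
             RtoC (/ INR (fact (S K'))) * z ^ (S K') * expint_coef a W (S K'))%C
  end.

Lemma expint_sum_CI a W z K : 0 < a -> (forall q, ccont W q) ->
  expint_sum a W z K = CI (fun q => W q * cexp_sum (z * rho a q) K)%C.
Proof.
  intros Ha HW. induction K as [|K IH].
  - apply CI_ext. intros; simpl. ring.
  - change (expint_sum a W z (S K)) with (expint_sum a W z K +
             RtoC (/ INR (fact (S K))) * z ^ (S K) * expint_coef a W (S K))%C.
    rewrite IH. unfold expint_coef.
    assert (HC : forall q, ccont (fun q => W q * rho a q ^ S K)%C q).
    { intros q. apply ccont_mult; auto.
      apply (ccont_Cpow (fun q => RtoC (rho a q))), ccont_rho; auto. }
    rewrite <- CI_scal, <- CI_plus; auto.
    + apply CI_ext. intros q _.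
      change (cexp_sum (z * rho a q) (S K)) with
        (cexp_sum (z * rho a q) K + RtoC (/ INR (fact (S K))) * (z * rho a q) ^ S K)%C.
      rewrite (Cpow_mult_l z (rho a q)). ring.
    + intros q. apply ccont_mult; auto. apply ccont_cexp_sum.
      apply ccont_mult; [apply ccont_const|apply ccont_rho; auto].
    + intros q. apply ccont_mult; [apply ccont_const|auto].
Qed.

(** The Taylor remainder of the exponential is integrated, using [|z * rho| <= |z|]; [B] is the
    integral of [|W|]. This one bound yields continuity, the local study of the modulus and the
    convergence of Kummer's series. *)
Lemma expint_remainder a W : 0 < a -> (forall q, ccont W q) ->
  exists B, 0 <= B /\ forall z K,
    Cmod (expint a W z - expint_sum a W z K)
      <= B * (Cmod z ^ S K / INR (fact (S K)) * exp (Cmod z)).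
Proof.
  intros Ha HW. exists (RInt (fun q => Cmod (W q)) 0 1).
  assert (HM : forall q, continuous (fun q => Cmod (W q)) q)
    by (intros; apply continuous_Cmod; auto).
  split.
  { apply RInt_ge_0; [lra|apply cont_ex_RInt; auto|intros; apply Cmod_ge_0]. }
  intros z K. rewrite expint_sum_CI by auto. unfold expint.
  assert (HS : forall q, ccont (fun q => W q * cexp_sum (z * rho a q) K)%C q).
  { intros q. apply ccont_mult; auto. apply ccont_cexp_sum.
    apply ccont_mult; [apply ccont_const|apply ccont_rho; auto]. }
  rewrite <- CI_minus; auto using ccont_expint.
  set (M := Cmod z ^ S K / INR (fact (S K)) * exp (Cmod z)).
  replace (RInt (fun q => Cmod (W q)) 0 1 * M) with (M * RInt (fun q => Cmod (W q)) 0 1) by ring.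
  rewrite <- (RInt_scal (V := R_CompleteNormedModule)) by (apply cont_ex_RInt; auto).
  apply CI_norm.
  - intros q. apply ccont_minus; auto using ccont_expint.
  - intros q. apply (continuous_mult (K := R_AbsRing)); [apply continuous_const|auto].
  - intros q _. change (scal M (Cmod (W q))) with (M * Cmod (W q)).
    replace (W q * cexp (z * rho a q) - W q * cexp_sum (z * rho a q) K)%C
      with (W q * (cexp (z * rho a q) - cexp_sum (z * rho a q) K))%C by ring.
    rewrite Cmod_mult, Rmult_comm. apply Rmult_le_compat_r; [apply Cmod_ge_0|].
    eapply Rle_trans; [apply cexp_remainder|]. unfold M.
    assert (Hz : Cmod (z * rho a q) <= Cmod z).
    { rewrite Cmod_mult, Cmod_R. pose proof (rho_range a q Ha).
      rewrite Rabs_right by lra. pose proof (Cmod_ge_0 z). nra. }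
    pose proof (Cmod_ge_0 (z * rho a q)).
    pose proof (INR_fact_lt_0 (S K)) as HF.
    apply Rmult_le_compat; [|left; apply exp_pos| |apply exp_le; auto].
    + apply Rmult_le_pos; [apply pow_le; auto|left; apply Rinv_0_lt_compat; auto].
    + apply Rmult_le_compat_r; [left; apply Rinv_0_lt_compat; auto|].
      apply pow_incr; auto.
Qed.

Lemma expint_shift a W z0 h :
  expint a W (z0 + h) = expint a (fun q => W q * cexp (z0 * rho a q))%C h.
Proof.
  unfold expint. apply CI_ext. intros q _.
  replace ((z0 + h) * rho a q)%C with (z0 * rho a q + h * rho a q)%C by ring.
  rewrite cexp_plus. ring.
Qed.

Lemma factorial_domin (x : R) : is_lim_seq (fun K => x ^ S K / INR (fact (S K))) 0.
Proof.
  apply (is_lim_seq_incr_1 (fun K => x ^ K / INR (fact K))).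
  apply is_lim_seq_Reals, cv_speed_pow_fact.
Qed.

Lemma is_lim_seq_eventually_lt (u : nat -> R) (e : R) :
  is_lim_seq u 0 -> 0 < e -> eventually (fun k => u k < e).
Proof.
  intros Hu He. apply is_lim_seq_spec in Hu.
  destruct (Hu (mkposreal e He)) as [N HN]. exists N. intros n Hn.
  specialize (HN n Hn). simpl in HN. apply Rabs_def2 in HN. lra.
Qed.

Lemma expint_at_0 a W : expint a W 0 = expint_coef a W 0.
Proof.
  apply CI_ext. intros q _. replace (0 * rho a q)%C with (RtoC 0) by ring.
  rewrite cexp_0. simpl. ring.
Qed.

Lemma expint_cont a W z0 e : 0 < a -> (forall q, ccont W q) -> 0 < e ->
  exists d, 0 < d /\ forall h, Cmod h < d -> Cmod (expint a W (z0 + h) - expint a W z0) < e.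
Proof.
  intros Ha HW He.
  destruct (expint_remainder a (fun q => W q * cexp (z0 * rho a q))%C Ha) as [B [HB H]].
  { apply ccont_expint; auto. }
  exists (Rmin 1 (e / (B * exp 1 + 1))). split.
  { pose proof (exp_pos 1). apply Rmin_pos; [lra|].
    apply Rdiv_lt_0_compat; auto. nra. }
  intros h Hh. rewrite expint_shift.
  specialize (H h 0%nat). simpl expint_sum in H.
  rewrite <- expint_at_0, <- (expint_shift a W z0 0) in H.
  replace (z0 + 0)%C with z0 in H by ring.
  eapply Rle_lt_trans; [exact H|].
  pose proof (Rmin_l 1 (e / (B * exp 1 + 1))). pose proof (Rmin_r 1 (e / (B * exp 1 + 1))).
  pose proof (Cmod_ge_0 h). pose proof (exp_pos 1).
  assert (exp (Cmod h) <= exp 1) by (apply exp_le; lra).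
  assert (0 < exp (Cmod h)) by apply exp_pos.
  simpl. replace (Cmod h * 1 / 1) with (Cmod h) by field.
  assert (HBe : 0 < B * exp 1 + 1) by nra.
  assert (Cmod h * (B * exp 1 + 1) < e).
  { apply (Rmult_lt_reg_r (/ (B * exp 1 + 1))); [apply Rinv_0_lt_compat; auto|].
    rewrite Rmult_assoc, Rinv_r, Rmult_1_r by lra. unfold Rdiv in *. lra. }
  apply Rle_lt_trans with (B * (Cmod h * exp 1)); [|nra].
  apply Rmult_le_compat_l; auto. apply Rmult_le_compat_l; auto.
Qed.

Lemma cexp_mult_INR (v : C) (k : nat) : cexp (INR k * v) = (cexp v ^ k)%C.
Proof.
  induction k as [|k IH].
  - simpl INR. replace (0 * v)%C with (RtoC 0) by ring. apply cexp_0.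
  - rewrite S_INR, RtoC_plus, Cpow_S, <- IH, <- cexp_plus. f_equal. ring.
Qed.

Lemma expint_sum_first a W z m :
  (forall k, (1 <= k <= m)%nat -> expint_coef a W k = 0) ->
  expint_sum a W z m = expint_coef a W 0.
Proof.
  induction m as [|m IH]; intros H; [reflexivity|].
  change (expint_sum a W z (S m)) with (expint_sum a W z m +
             RtoC (/ INR (fact (S m))) * z ^ (S m) * expint_coef a W (S m))%C.
  rewrite IH, (H (S m)) by (intros; try apply H; lia). ring.
Qed.

(* The local form of the minimum modulus principle: the first non-zero Taylor coefficient
   after the constant term provides a direction in which the modulus decreases. *)
Lemma expint_no_local_min_0 a W (d : R) : 0 < a -> (forall q, ccont W q) -> 0 < d ->
  expint a W 0 <> 0 ->
  (exists h, Cmod h < d /\ Cmod (expint a W h) < Cmod (expint a W 0)) \/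
  (forall h, expint a W h = expint a W 0).
Proof.
  intros Ha HW Hd H0.
  destruct (expint_remainder a W Ha HW) as [B [HB HR]].
  destruct (classic (exists k, (1 <= k)%nat /\ expint_coef a W k <> 0)) as [Hex|Hno].
  (* If all coefficients after the constant one vanish, every partial sum equals the constant, and
     the remainder tends to [0]. *)
  2:{ right. intros h.
    assert (HS : forall K, expint_sum a W h K = expint a W 0).
    { intros K. rewrite expint_at_0. apply expint_sum_first. intros k Hk.
      apply NNPP. intros Hc. apply Hno. exists k; split; [lia|auto]. }
    apply Ceq_minus, Cmod_eq_0.
    apply Rle_antisym; [|apply Cmod_ge_0]. apply Rnot_lt_le. intros Hlt.
    pose proof (exp_pos (Cmod h)) as He.
    destruct (is_lim_seq_eventually_lt _ (Cmod (expint a W h - expint a W 0) / ((B + 1) * exp (Cmod h)))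
      (factorial_domin (Cmod h))) as [N HN].
    { apply Rdiv_lt_0_compat; auto. nra. }
    specialize (HN N (le_n N)). specialize (HR h N). rewrite HS in HR.
    assert (HF : 0 <= Cmod h ^ S N / INR (fact (S N))).
    { apply Rmult_le_pos; [apply pow_le, Cmod_ge_0|left; apply Rinv_0_lt_compat, INR_fact_lt_0]. }
    set (x := Cmod h ^ S N / INR (fact (S N))) in *.
    apply (Rmult_lt_compat_r ((B + 1) * exp (Cmod h))) in HN; [|nra].
    unfold Rdiv in HN. rewrite Rmult_assoc, Rinv_l, Rmult_1_r in HN by nra. nra. }
  left.
  destruct (dec_inh_nat_subset_has_unique_least_element
    (fun k => (1 <= k)%nat /\ expint_coef a W k <> 0)) as [m [[[Hm1 Hm] Hleast] _]].
  { intros n. apply classic. }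
  { exact Hex. }
  destruct m as [|m]; [lia|].
  assert (HS : forall h, expint_sum a W h (S m) = (expint a W 0 +
     RtoC (/ INR (fact (S m))) * h ^ S m * expint_coef a W (S m))%C).
  { intros h. change (expint_sum a W h (S m)) with (expint_sum a W h m +
             RtoC (/ INR (fact (S m))) * h ^ (S m) * expint_coef a W (S m))%C.
    rewrite expint_sum_first, expint_at_0; [reflexivity|].
    intros k Hk. apply NNPP. intros Hc. specialize (Hleast k (conj (proj1 Hk) Hc)). lia. }
  set (D := (RtoC (/ INR (fact (S m))) * expint_coef a W (S m))%C) in *.
  assert (HD : D <> 0).
  { apply Cmult_neq_0; auto. intros E. apply RtoC_inj in E.
    pose proof (Rinv_0_lt_compat _ (INR_fact_lt_0 (S m))). lra. }
  (* A root is extracted through a logarithm: with [w ^ S m = - F(0) / D], the constant term and the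
     first non-zero one add up at [e * w] to [(1 - e ^ S m) * F(0)]. *)
  destruct (cexp_surj (- expint a W 0 / D)%C) as [v [Hv _]].
  { apply Cmult_neq_0; [|intros E; apply (f_equal (fun w => (D * w)%C)) in E;
      rewrite Cinv_r in E by auto; rewrite Cmult_0_r in E; apply C1_nz; auto].
    intros E. apply H0. replace (expint a W 0) with (- - expint a W 0)%C by ring.
    rewrite E. ring. }
  set (w := cexp (RtoC (/ INR (S m)) * v)).
  assert (Hw : (w ^ S m)%C = (- expint a W 0 / D)%C).
  { unfold w. rewrite <- cexp_mult_INR, <- Hv. f_equal.
    rewrite Cmult_assoc, <- RtoC_mult, Rinv_r by (apply not_0_INR; auto). ring. }
  set (r := Cmod w). assert (Hr : 0 < r) by (apply Cmod_gt_0, cexp_neq_0).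
  set (B' := B * (r ^ S (S m) * exp r) + 1).
  assert (HB' : 0 < B').
  { unfold B'. pose proof (pow_lt r (S (S m)) Hr). pose proof (exp_pos r).
    pose proof (Rmult_lt_0_compat _ _ H H1). nra. }
  pose proof (proj1 (Cmod_gt_0 _) H0) as HF0.
  (* The three terms ensure [e < 1], [e * r < d] and [e * B' < |F(0)|]. By the last one the
     remainder, at most [e ^ S m * (e * (B' - 1))], is smaller than the gain [e ^ S m * |F(0)|]. *)
  set (e := Rmin (1 / 2) (Rmin (d / r / 2) (Cmod (expint a W 0) / B' / 2))).
  assert (He : 0 < e).
  { apply Rmin_pos; [lra|]. apply Rmin_pos; apply Rdiv_lt_0_compat; try lra;
      apply Rdiv_lt_0_compat; auto. }
  assert (He1 : e <= 1 / 2) by apply Rmin_l.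
  assert (He2 : e <= d / r / 2) by (eapply Rle_trans; [apply Rmin_r|apply Rmin_l]).
  assert (He3 : e <= Cmod (expint a W 0) / B' / 2) by (eapply Rle_trans; [apply Rmin_r|apply Rmin_r]).
  assert (He2' : e * r < d).
  { apply (Rmult_le_compat_r r) in He2; [|lra]. replace (d / r / 2 * r) with (d / 2) in He2 by (field; lra). lra. }
  assert (He3' : e * B' < Cmod (expint a W 0)).
  { apply (Rmult_le_compat_r B') in He3; [|lra].
    replace (Cmod (expint a W 0) / B' / 2 * B') with (Cmod (expint a W 0) / 2) in He3 by (field; lra). lra. }
  exists (e * w)%C.
  assert (Hh : Cmod (e * w) = e * r) by (rewrite Cmod_mult, Cmod_R, Rabs_right by lra; reflexivity).
  split; [rewrite Hh; auto|].
  specialize (HR (e * w)%C (S m)). rewrite HS, Hh in HR.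
  replace (expint a W 0 + RtoC (/ INR (fact (S m))) * (e * w) ^ S m * expint_coef a W (S m))%C
    with (RtoC (1 - e ^ S m) * expint a W 0)%C in HR.
  2:{ rewrite Cpow_mult_l, Hw, <- RtoC_pow, RtoC_minus.
      transitivity (expint a W 0 + RtoC (e ^ S m) * (D * (- expint a W 0 / D)))%C.
      - field. auto.
      - unfold D at 1. ring. }
  pose proof (pow_lt e (S m) He) as Hem.
  assert (Hem1 : e ^ S m < 1).
  { apply pow_lt_1_compat; [lra|lia]. }
  eapply Rle_lt_trans; [apply (Cmod_minus_triangle _ (RtoC (1 - e ^ S m) * expint a W 0)%C)|].
  rewrite Cmod_mult, Cmod_R, Rabs_right by lra.
  assert (HRb : B * ((e * r) ^ S (S m) / INR (fact (S (S m))) * exp (e * r)) <= e ^ S m * (e * (B' - 1))).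
  { unfold B'. replace (e ^ S m * (e * (B * (r ^ S (S m) * exp r) + 1 - 1)))
      with (B * ((e * r) ^ S (S m) * exp r)) by (rewrite Rpow_mult_distr; simpl; ring).
    apply Rmult_le_compat_l; auto.
    assert (0 < (e * r) ^ S (S m)) by (apply pow_lt, Rmult_lt_0_compat; auto).
    apply Rmult_le_compat; [|left; apply exp_pos| |apply exp_le; nra].
    - left; apply Rdiv_lt_0_compat; auto. apply INR_fact_lt_0.
    - rewrite <- (Rmult_1_r ((e * r) ^ S (S m))) at 2. apply Rmult_le_compat_l; [lra|].
      rewrite <- Rinv_1. apply Rinv_le_contravar; [lra|].
      apply (le_INR 1). apply lt_O_fact. }
  nra.
Qed.

Lemma expint_no_local_min a W z0 (d : R) : 0 < a -> (forall q, ccont W q) -> 0 < d ->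
  expint a W z0 <> 0 ->
  (exists h, Cmod h < d /\ Cmod (expint a W (z0 + h)) < Cmod (expint a W z0)) \/
  (forall h, expint a W (z0 + h) = expint a W z0).
Proof.
  intros Ha HW Hd H0.
  assert (E : expint a W z0 = expint a (fun q => W q * cexp (z0 * rho a q))%C 0).
  { rewrite <- expint_shift. f_equal. ring. }
  rewrite E in *.
  destruct (expint_no_local_min_0 a (fun q => W q * cexp (z0 * rho a q))%C d) as [[h Hh]|Hh];
    auto using ccont_expint.
  - left. exists h. rewrite expint_shift. auto.
  - right. intros h. rewrite expint_shift. auto.
Qed.

(** Let [- m] be the infimum. If it is not attained, each point of the square has a neighbourhood on
    which [g] exceeds [- m] by a margin; compactness makes the margin uniform, which contradicts the
    choice of [m]. *)
Lemma min_on_square (g : R -> R -> R) (a b : R) :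
  a <= b ->
  (forall x y e, 0 < e -> exists d, 0 < d /\
     forall u v, Rabs (u - x) < d -> Rabs (v - y) < d -> Rabs (g u v - g x y) < e) ->
  (forall x y, 0 <= g x y) ->
  exists x y, a <= x <= b /\ a <= y <= b /\
    forall u v, a <= u <= b -> a <= v <= b -> g x y <= g u v.
Proof.
  intros Hab Hc Hg.
  destruct (completeness (fun r => exists x y, a <= x <= b /\ a <= y <= b /\ r = - g x y))
    as [m [Hub Hlub]].
  { exists 0. intros r [x [y [_ [_ ->]]]]. specialize (Hg x y). lra. }
  { exists (- g a a), a, a. repeat split; lra. }
  apply NNPP. intros Hno.
  assert (Hgt : forall x y, a <= x <= b -> a <= y <= b -> - m < g x y).
  { intros x y Hx Hy. destruct (Rle_lt_dec (g x y) (- m)) as [H|H]; auto.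
    exfalso. apply Hno. exists x, y. repeat split; try lra.
    intros u v Hu Hv. enough (- g u v <= m) by lra.
    apply Hub. exists u, v. auto. }
  (* One number serves as radius of the neighbourhood and as margin above the infimum, so the
     uniform lower bound for the radii given by compactness is also a uniform margin. *)
  assert (Hd : forall x y, exists d : posreal, (a <= x <= b -> a <= y <= b ->
     forall u v, Rabs (u - x) < d -> Rabs (v - y) < d -> - m + d <= g u v)).
  { intros x y.
    destruct (classic (a <= x <= b /\ a <= y <= b)) as [[Hx Hy]|Hn].
    2:{ exists (mkposreal 1 Rlt_0_1). intros; tauto. }
    specialize (Hgt x y Hx Hy).
    destruct (Hc x y ((g x y + m) / 2)) as [d [Hd Huv]]; [lra|].
    assert (Hm : 0 < Rmin d ((g x y + m) / 2)) by (apply Rmin_pos; lra).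
    exists (mkposreal _ Hm). simpl. intros _ _ u v Hu Hv.
    pose proof (Rmin_l d ((g x y + m) / 2)). pose proof (Rmin_r d ((g x y + m) / 2)).
    specialize (Huv u v ltac:(lra) ltac:(lra)). apply Rabs_def2 in Huv. lra. }
  set (delta := fun x y => proj1_sig (constructive_indefinite_description _ (Hd x y))).
  assert (Hdelta : forall x y, a <= x <= b -> a <= y <= b -> forall u v,
    Rabs (u - x) < delta x y -> Rabs (v - y) < delta x y -> - m + delta x y <= g u v).
  { intros x y. unfold delta. destruct constructive_indefinite_description; simpl; auto. }
  destruct (compactness_value_2d a b a b delta) as [d Hcd].
  enough (m <= m - d) by (pose proof (cond_pos d); lra).
  apply Hlub. intros r [x [y [Hx [Hy ->]]]].
  apply Rnot_lt_le. intros Hlt. apply (Hcd x y Hx Hy).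
  intros [u [v [Hu [Hv [H1 [H2 H3]]]]]].
  specialize (Hdelta u v Hu Hv x y H1 H2). lra.
Qed.

(** The minimum of the modulus over the square is at most the value at [c], so it lies in the
    interior. Were it non-zero, either the modulus would decrease nearby or the function would be
    constant, and constancy contradicts the strict inequality on the boundary. *)
Lemma expint_zero_in_square a W c r : 0 < a -> (forall q, ccont W q) -> 0 < r ->
  (forall x y, Rabs x <= r -> Rabs y <= r -> Rabs x = r \/ Rabs y = r ->
     Cmod (expint a W c) < Cmod (expint a W (c + (x, y)))) ->
  exists x y, Rabs x <= r /\ Rabs y <= r /\ expint a W (c + (x, y)) = 0.
Proof.
  intros Ha HW Hr Hb.
  destruct (min_on_square (fun x y => Cmod (expint a W (c + (x, y)))) (- r) r)
    as [x [y [Hx [Hy Hmin]]]]; [lra| |intros; apply Cmod_ge_0|].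
  { intros x y e He.
    destruct (expint_cont a W (c + (x, y))%C e Ha HW He) as [d [Hd Hh]].
    exists (d / 2). split; [lra|]. intros u v Hu Hv.
    replace (c + (u, v))%C with (c + (x, y) + ((u - x)%R, (v - y)%R))%C
      by (apply C_ext; simpl; ring).
    assert (Hlt : Cmod ((u - x)%R, (v - y)%R) < d).
    { eapply Rle_lt_trans; [apply Cmod_le_Re_Im|]. simpl. lra. }
    specialize (Hh _ Hlt).
    set (A := expint a W (c + (x, y) + ((u - x)%R, (v - y)%R))%C) in *.
    set (A0 := expint a W (c + (x, y))%C) in *.
    pose proof (Cmod_minus_triangle A A0). pose proof (Cmod_minus_triangle A0 A).
    rewrite (Cmod_sym A0 A) in H0. apply Rabs_def1; lra. }
  exists x, y. repeat split; try (apply Rabs_le; lra).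
  apply NNPP. intros Hne.
  assert (H0 : Cmod (expint a W (c + (x, y))) <= Cmod (expint a W c)).
  { specialize (Hmin 0 0 ltac:(lra) ltac:(lra)).
    replace (c + (0%R, 0%R))%C with c in Hmin by (apply C_ext; simpl; unfold Re, Im; ring). exact Hmin. }
  assert (Hx' : - r < x < r /\ - r < y < r).
  { assert (~ (Rabs x = r \/ Rabs y = r)).
    { intros Hbd. specialize (Hb x y (Rabs_le _ _ Hx) (Rabs_le _ _ Hy) Hbd). lra. }
    assert (Rabs x <> r /\ Rabs y <> r) as [Nx Ny] by tauto.
    revert Nx Ny. unfold Rabs; repeat destruct Rcase_abs; lra. }
  set (d := Rmin (Rmin (r - x) (x + r)) (Rmin (r - y) (y + r))).
  assert (Hd : 0 < d) by (repeat apply Rmin_pos; lra).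
  destruct (expint_no_local_min a W (c + (x, y))%C d Ha HW Hd Hne) as [[h [Hh1 Hh2]]|Hcst].
  - assert (d <= r - x /\ d <= x + r /\ d <= r - y /\ d <= y + r) as (D1 & D2 & D3 & D4).
    { unfold d. repeat split; unfold Rmin; repeat destruct Rle_dec; lra. }
    pose proof (re_le_Cmod h). pose proof (Im_le_Cmod h).
    assert (HRe : Rabs (Re h) < d) by lra. assert (HIm : Rabs (Im h) < d) by lra.
    apply Rabs_def2 in HRe. apply Rabs_def2 in HIm.
    specialize (Hmin (x + Re h) (y + Im h) ltac:(lra) ltac:(lra)).
    replace (c + ((x + Re h)%R, (y + Im h)%R))%C with (c + (x, y) + h)%C in Hmin
      by (apply C_ext; simpl; unfold Re, Im; ring).
    lra.
  - specialize (Hb r 0). rewrite Rabs_R0, (Rabs_right r) in Hb by lra.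
    specialize (Hb ltac:(lra) ltac:(lra) (or_introl eq_refl)).
    assert (E1 : expint a W (c + (r, 0)) = expint a W (c + (x, y))).
    { rewrite <- (Hcst ((r - x)%R, (- y)%R)). f_equal. apply C_ext; simpl; ring. }
    rewrite E1 in Hb. lra.
Qed.

(** * Euler's integral for Kummer's function *)

Definition beta_weight (a n q : R) : R := rpw n (1 - rho a q).

(** With [r = rho a q] and [dq = a r^(a-1) dr] this is [a * Beta(a + k, n + 1)]. *)
Definition beta_moment (a n : R) (k : nat) : R :=
  RInt (fun q => beta_weight a n q * rho a q ^ k) 0 1.

Lemma continuous_pow (f : R -> R) k t : continuous f t -> continuous (fun s => f s ^ k) t.
Proof.
  intros Hf. induction k as [|k IH]; [apply continuous_const|].
  apply (continuous_mult (K := R_AbsRing)); assumption.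
Qed.

Lemma continuous_beta_weight a n q : 0 < a -> 0 < n -> continuous (beta_weight a n) q.
Proof.
  intros Ha Hn. apply (continuous_comp (fun q => 1 - rho a q) (rpw n)).
  - apply (continuous_minus (V := R_NormedModule)); [apply continuous_const|].
    apply continuous_rho; auto.
  - apply continuous_rpw; auto.
Qed.

Lemma continuous_beta_moment a n k q : 0 < a -> 0 < n ->
  continuous (fun q => beta_weight a n q * rho a q ^ k) q.
Proof.
  intros Ha Hn. apply (continuous_mult (K := R_AbsRing)).
  - apply continuous_beta_weight; auto.
  - apply continuous_pow, continuous_rho; auto.
Qed.

(** Integration by parts: [q * rho^k * (1 - rho)^(n+1)] vanishes at both ends, and because
    [q * rho' = rho / a] its derivative is a combination of the integrands of the moments [k] and
    [k + 1]. *)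
Lemma beta_moment_succ a n k : 0 < a -> 0 < n ->
  (a + INR k) * beta_moment a n k = (n + a + 1 + INR k) * beta_moment a n (S k).
Proof.
  intros Ha Hn.
  set (f := fun q => q * (rho a q ^ k * rpw (n + 1) (1 - rho a q))).
  set (g := fun q => (1 + INR k / a) * (beta_weight a n q * rho a q ^ k) -
                     (1 + INR k / a + (n + 1) / a) * (beta_weight a n q * rho a q ^ S k)).
  assert (Cm := fun k q => continuous_beta_moment a n k q Ha Hn).
  assert (HF : RInt g 0 1 = f 1 - f 0).
  { apply FTC_open_R.
    - intros q. apply (continuous_minus (V := R_NormedModule));
        apply (continuous_mult (K := R_AbsRing)); auto; apply continuous_const.
    - intros q _. apply (continuous_mult (K := R_AbsRing)); [apply continuous_id|].
      apply (continuous_mult (K := R_AbsRing)).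
      + apply continuous_pow, continuous_rho; auto.
      + apply continuous_beta_weight; lra.
    - intros q Hq. destruct (rho_lt_1 a q Ha Hq) as [R0 R1].
      pose proof (is_derive_rho a q Ha Hq) as DR.
      assert (DW : is_derive (fun q => rpw (n + 1) (1 - rho a q)) q
               (- (rho a q / (a * q)) * ((n + 1) * rpw (n + 1) (1 - rho a q) / (1 - rho a q)))).
      { apply (is_derive_comp (rpw (n + 1)) (fun q => 1 - rho a q)).
        - apply is_derive_rpw; lra.
        - eapply is_derive_eq; [|apply (is_derive_minus (V := R_NormedModule));
            [apply (is_derive_const (V := R_NormedModule))|exact DR]].
          unfold minus, plus, opp, zero; simpl. ring. }
      pose proof (is_derive_pow _ k q _ DR) as DP.
      eapply is_derive_eq; [|apply (is_derive_mult (K := R_AbsRing));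
        [apply (is_derive_id (K := R_AbsRing))|apply (is_derive_mult (K := R_AbsRing));
           [exact DP|exact DW|exact Rmult_comm]|exact Rmult_comm]].
      unfold g, beta_weight, plus, mult, one; simpl.
      rewrite (rpw_succ n), Rmax_left by lra.
      assert (HK : INR k * (rho a q / (a * q)) * rho a q ^ pred k = INR k * rho a q ^ k / (a * q)).
      { destruct k; [simpl; field; lra|]. simpl pred. simpl pow. field. lra. }
      rewrite HK. field. lra. }
  unfold f in HF. rewrite rho_0, rho_1, (rpw_neg (n + 1) (1 - 1)), Rmult_0_l, !Rmult_0_r in HF by lra.
  unfold g in HF.
  assert (Ci : forall k, ex_RInt (fun q => beta_weight a n q * rho a q ^ k) 0 1)
    by (intros; apply cont_ex_RInt; auto).
  rewrite (RInt_minus (V := R_CompleteNormedModule)) in HF;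
    try (apply (ex_RInt_scal (V := R_CompleteNormedModule)); auto).
  rewrite !(RInt_scal (V := R_CompleteNormedModule)) in HF by auto.
  fold (beta_moment a n k) (beta_moment a n (S k)) in HF.
  unfold minus, plus, opp, scal in HF; simpl in HF; unfold mult in HF; simpl in HF.
  apply (Rmult_eq_reg_l (/ a)); [|apply Rinv_neq_0_compat; lra].
  apply Rminus_diag_uniq. rewrite Rminus_0_r in HF. rewrite <- HF. field. lra.
Qed.

Lemma beta_moment_0_pos a n : 0 < a -> 0 < n -> 0 < beta_moment a n 0.
Proof.
  intros Ha Hn. apply RInt_gt_0; [lra| |intros; apply continuous_beta_moment; auto].
  intros q Hq. simpl. rewrite Rmult_1_r. destruct (rho_lt_1 a q Ha Hq).
  unfold beta_weight. rewrite rpw_pos by lra. apply exp_pos.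
Qed.

Lemma poch_pos x k : 0 < x -> 0 < poch x k.
Proof.
  intros Hx. induction k as [|k IH]; simpl; [lra|].
  apply Rmult_lt_0_compat; auto. pose proof (pos_INR k). lra.
Qed.

Lemma beta_moment_poch a n k : 0 < a -> 0 < n ->
  beta_moment a n k * poch (n + a + 1) k = beta_moment a n 0 * poch a k.
Proof.
  intros Ha Hn. induction k as [|k IH]; [simpl; ring|]. simpl.
  pose proof (beta_moment_succ a n k Ha Hn).
  transitivity ((n + a + 1 + INR k) * beta_moment a n (S k) * poch (n + a + 1) k); [ring|].
  rewrite <- H. rewrite <- Rmult_assoc, <- IH. ring.
Qed.

Lemma cpow_Cpow z k : cpow z k = (z ^ k)%C.
Proof. induction k as [|k IH]; [reflexivity|]. simpl cpow. rewrite IH, Cpow_S. ring. Qed.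

(** The recurrence makes the normalized moments equal to [poch a k / poch b k] with [b = n + a + 1].
    The partial sums of the two series therefore agree, and [expint_remainder] gives both the
    convergence and the sum. *)
Lemma kummer_series_expint a n z : 0 < a -> 0 < n ->
  hyp1F1_eq a (n + a + 1) z
    (RtoC (/ beta_moment a n 0) * expint a (fun q => RtoC (beta_weight a n q)) z)%C.
Proof.
  intros Ha Hn. set (W := fun q => RtoC (beta_weight a n q)).
  assert (HW : forall q, ccont W q) by (intros; apply ccont_RtoC, continuous_beta_weight; auto).
  pose proof (beta_moment_0_pos a n Ha Hn) as H0.
  assert (HC : forall k, expint_coef a W k = beta_moment a n k).
  { intros k. unfold expint_coef, beta_moment. rewrite <- CI_RtoC. apply CI_ext.
    intros q _. unfold W. rewrite RtoC_mult, RtoC_pow. reflexivity. }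
  assert (HS : forall K, sum_n (G := C_AbelianGroup) (kummer_term a (n + a + 1) z) K =
     (RtoC (/ beta_moment a n 0) * expint_sum a W z K)%C).
  { assert (HT : forall k, kummer_term a (n + a + 1) z k =
      (RtoC (/ beta_moment a n 0) * (RtoC (/ INR (fact k)) * z ^ k * expint_coef a W k))%C).
    { intros k. unfold kummer_term. rewrite HC, cpow_Cpow.
      transitivity (RtoC (/ beta_moment a n 0 * / INR (fact k) * beta_moment a n k) * z ^ k)%C.
      - f_equal. f_equal.
        pose proof (poch_pos (n + a + 1) k ltac:(lra)) as HP.
        pose proof (INR_fact_lt_0 k).
        apply (Rmult_eq_reg_r (poch (n + a + 1) k)); [|lra].
        transitivity (/ beta_moment a n 0 * / INR (fact k) *
          (beta_moment a n k * poch (n + a + 1) k)); [|ring].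
        rewrite beta_moment_poch by auto. field. lra.
      - rewrite !RtoC_mult. ring. }
    induction K as [|K IH].
    - rewrite sum_O, HT. simpl. rewrite Rinv_1. ring.
    - rewrite sum_Sn, IH, HT. change plus with Cplus.
      change (expint_sum a W z (S K)) with (expint_sum a W z K +
             RtoC (/ INR (fact (S K))) * z ^ (S K) * expint_coef a W (S K))%C. bring. }
  unfold hyp1F1_eq, is_series.
  apply (proj2 (filterlim_locally_ball_norm (K := C_AbsRing) (U := C_NormedModule) _ _)).
  intros e.
  destruct (expint_remainder a W Ha HW) as [B [HB HR]].
  pose proof (exp_pos (Cmod z)) as He.
  destruct (is_lim_seq_eventually_lt _ (e * beta_moment a n 0 / ((B + 1) * exp (Cmod z)))
      (factorial_domin (Cmod z))) as [N HN].
  { pose proof (cond_pos e). apply Rdiv_lt_0_compat; nra. }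
  exists N. intros K HK. specialize (HN K HK). specialize (HR z K).
  unfold ball_norm. rewrite HS.
  change (Cmod (RtoC (/ beta_moment a n 0) * expint_sum a W z K -
    RtoC (/ beta_moment a n 0) * expint a W z)%C < e).
  replace (RtoC (/ beta_moment a n 0) * expint_sum a W z K -
    RtoC (/ beta_moment a n 0) * expint a W z)%C with
   (RtoC (/ beta_moment a n 0) * (expint_sum a W z K - expint a W z))%C by ring.
  rewrite Cmod_mult, Cmod_R, Rabs_right, Cmod_sym
    by (left; apply Rinv_0_lt_compat; auto).
  apply (Rmult_lt_reg_l (beta_moment a n 0)); auto.
  rewrite <- Rmult_assoc, Rinv_r, Rmult_1_l by lra.
  assert (HF : 0 <= Cmod z ^ S K / INR (fact (S K))).
  { apply Rmult_le_pos; [apply pow_le, Cmod_ge_0|left; apply Rinv_0_lt_compat, INR_fact_lt_0]. }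
  set (x := Cmod z ^ S K / INR (fact (S K))) in *.
  apply (Rmult_lt_compat_r ((B + 1) * exp (Cmod z))) in HN; [|nra].
  unfold Rdiv in HN. rewrite Rmult_assoc, Rinv_l, Rmult_1_r in HN by nra. nra.
Qed.

(** * Deformation of the contour *)

Lemma ccont_clog (f : R -> C) t : 0 < Re (f t) -> ccont f t -> ccont (fun s => clog (f s)) t.
Proof.
  intros Hf [F1 F2].
  assert (HX : 0 < Re (f t) ^ 2 + Im (f t) ^ 2) by nra.
  split; simpl.
  - apply (continuous_mult (K := R_AbsRing)); [apply continuous_const|].
    apply (continuous_comp (fun s => Re (f s) ^ 2 + Im (f s) ^ 2) ln).
    + apply (continuous_plus (V := R_NormedModule)); apply continuous_pow; assumption.
    + apply continuous_ln; auto.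
  - apply (continuous_comp (fun s => Im (f s) / Re (f s)) atan).
    + apply (continuous_mult (K := R_AbsRing)); [assumption|].
      apply (continuous_comp (fun s => Re (f s)) Rinv); [assumption|].
      apply continuous_Rinv. lra.
    + apply (@ex_derive_continuous _ R_NormedModule). auto_derive; auto.
Qed.

Lemma cderiv_inv (f : R -> C) t l :
  f t <> 0 -> cderiv f t l -> cderiv (fun s => / f s)%C t (- l / (f t * f t))%C.
Proof.
  intros Hf [F1 F2].
  assert (HX : Re (f t) ^ 2 + Im (f t) ^ 2 <> 0).
  { rewrite <- Cmod_eq. apply pow_nonzero. pose proof (proj1 (Cmod_gt_0 _) Hf). lra. }
  assert (HE : (- l / (f t * f t))%C = (- l * (/ f t) * (/ f t))%C) by (field; auto).
  rewrite HE.
  assert (DX : is_derive (fun s => Re (f s) ^ 2 + Im (f s) ^ 2) t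
      (2 * Re l * Re (f t) + 2 * Im l * Im (f t))).
  { eapply is_derive_eq; [|apply (is_derive_plus (V := R_NormedModule));
      [exact (is_derive_pow _ 2 _ _ F1)|exact (is_derive_pow _ 2 _ _ F2)]].
    unfold plus; simpl. ring. }
  split; simpl.
  - eapply is_derive_eq; [|exact (is_derive_div _ _ _ _ _ F1 DX HX)].
    unfold Re, Im in *. match goal with |- @eq _ ?x ?y => change (@eq R x y) end.
    simpl in HX. field. intros E0; apply HX; lra.
  - eapply is_derive_eq; [|exact (is_derive_div _ _ _ _ _
       (is_derive_opp (V := R_NormedModule) _ _ _ F2) DX HX)].
    unfold opp; simpl.
    unfold Re, Im in *. match goal with |- @eq _ ?x ?y => change (@eq R x y) end.
    simpl in HX. field. intros E0; apply HX; lra.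
Qed.

Lemma segment_neq_0 (w : C) (t : R) : Im w <> 0 -> (1 - t * w)%C <> 0.
Proof.
  intros Hw E. pose proof (f_equal Re E) as E1. pose proof (f_equal Im E) as E2.
  simpl in E1, E2. fold (Re w) (Im w) in E1, E2.
  assert (t = 0) by (destruct (Req_dec t 0); auto; exfalso; apply Hw; nra).
  subst. lra.
Qed.

Lemma cderiv_segment (w : C) t : cderiv (fun s => 1 - s * w)%C t (- w)%C.
Proof.
  eapply cderiv_ext_val; [|apply cderiv_minus; [apply cderiv_const|apply cderiv_mult;
     [apply cderiv_id|apply cderiv_const]]]. bring.
Qed.

(* A branch of [(1 - t w)^a] along the real line, obtained by integrating its logarithmic
   derivative; this avoids the cut of the principal logarithm. *)
Lemma segment_power (a : R) (w : C) : Im w <> 0 ->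
  exists chi : R -> C, chi 0 = 1 /\ (forall t, chi t <> 0) /\
    forall t, cderiv chi t (- (a * w * chi t / (1 - t * w)))%C.
Proof.
  intros Hw. set (g := fun s : R => (- (a * w / (1 - s * w)))%C).
  assert (Cg : forall s, ccont g s).
  { intros s. apply ccont_opp, ccont_mult; [apply ccont_const|]. apply ccont_inv.
    - apply segment_neq_0; auto.
    - eapply cderiv_cont, cderiv_segment. }
  set (L := fun t : R => ((RInt (fun s => Re (g s)) 0 t, RInt (fun s => Im (g s)) 0 t) : C)).
  assert (DL : forall t, cderiv L t (g t)).
  { intros t. split.
    - exact (is_derive_RInt_cont (fun s => Re (g s)) 0 t (fun s => proj1 (Cg s))).
    - exact (is_derive_RInt_cont (fun s => Im (g s)) 0 t (fun s => proj2 (Cg s))). }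
  exists (fun t => cexp (L t)). split; [|split].
  - rewrite <- cexp_0. f_equal. unfold L. rewrite !(RInt_point (V := R_CompleteNormedModule)).
    reflexivity.
  - intros; apply cexp_neq_0.
  - intros t. eapply cderiv_ext_val; [|apply cderiv_cexp, DL]. unfold g.
    field. apply segment_neq_0; auto.
Qed.

Section Deformation.

Variables (a n : R) (z w : C).
Hypotheses (Ha : 0 < a) (Hn : 2 <= n) (Hw : 0 < Re w) (Hw' : Im w <> 0).

(** The segment from [1] (at [q = 0]) to [t w] (at [q = 1]), with the integrand [v^n e^(z (1 - v))]
    on it as [G]. Here [1 - v = (1 - t w) rho], so [a (1 - v)^(a-1) d(1 - v)] becomes
    [(1 - t w)^a dq]; this is the origin of the factor [chi]. *)
Let V (t q : R) : C := (1 - (1 - t * w) * rho a q)%C.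
Let G (t q : R) : C := cexp (n * clog (V t q) + z * (1 - V t q)).

Let Re_V t q : Re (V t q) = 1 - rho a q + t * Re w * rho a q.
Proof. unfold V. simpl. unfold Re, Im. ring. Qed.

Let Re_V_pos t q : 0 <= t <= 1 -> 0 < q < 1 -> 0 < Re (V t q).
Proof.
  intros Ht Hq. rewrite Re_V. destruct (rho_lt_1 a q Ha Hq).
  assert (0 <= t * Re w * rho a q) by (apply Rmult_le_pos; [apply Rmult_le_pos|]; lra). lra.
Qed.

Let Re_V_pos' t q : 0 < t <= 1 -> 0 < Re (V t q).
Proof.
  intros Ht. rewrite Re_V. pose proof (rho_range a q Ha).
  destruct (Req_dec (rho a q) 1) as [E|E]; [rewrite E; nra|].
  assert (0 <= t * Re w * rho a q) by (apply Rmult_le_pos; [apply Rmult_le_pos|]; lra). lra.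
Qed.

Let V_neq_0 t q : 0 < Re (V t q) -> V t q <> 0.
Proof. intros H E. rewrite E in H. simpl in H. lra. Qed.

Let ccont_V t q : ccont (V t) q.
Proof.
  apply ccont_minus; [apply ccont_const|]. apply ccont_mult; [apply ccont_const|].
  apply ccont_rho; auto.
Qed.

Let ccont_G t q : 0 < t <= 1 -> ccont (G t) q.
Proof.
  intros Ht. apply ccont_cexp, ccont_plus.
  - apply ccont_mult; [apply ccont_const|]. apply (ccont_clog (V t)); auto.
  - apply ccont_mult; [apply ccont_const|]. apply ccont_minus; [apply ccont_const|auto].
Qed.

Let cderiv_V t q : cderiv (fun s => V s q) t (rho a q * w)%C.
Proof.
  unfold V. eapply cderiv_ext_val; [|apply cderiv_minus; [apply cderiv_const|
    apply cderiv_mult; [apply cderiv_segment|apply cderiv_const]]]. bring.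
Qed.

Let G1 (t q : R) : C := (w * (rho a q * (n / V t q - z) * G t q))%C.
Let G2 (t q : R) : C :=
  (w * rho a q * (w * rho a q) * ((n / V t q - z) * (n / V t q - z) - n / (V t q * V t q)) * G t q)%C.

Let cderiv_G t q : 0 < Re (V t q) -> cderiv (fun s => G s q) t (G1 t q).
Proof.
  intros HV. unfold G.
  eapply cderiv_ext_val; [|apply cderiv_cexp, cderiv_plus; apply cderiv_mult;
    [apply cderiv_const|apply cderiv_clog; [exact HV|apply cderiv_V]|apply cderiv_const|
     apply cderiv_minus; [apply cderiv_const|apply cderiv_V]]].
  unfold G1, G. field. auto.
Qed.

Let cderiv_G1 t q : 0 < Re (V t q) -> cderiv (fun s => G1 s q) t (G2 t q).
Proof.
  intros HV. unfold G1.
  eapply cderiv_ext_val; [|apply cderiv_scal, cderiv_mult; [apply cderiv_scal, cderiv_minus;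
    [apply cderiv_mult; [apply cderiv_const|apply cderiv_inv; [auto|apply cderiv_V]]|
     apply cderiv_const]|apply cderiv_G; exact HV]].
  unfold G2, G1. field. auto.
Qed.

Let bnd := 1 + Cmod w.

Let Cmod_V t q : 0 <= t <= 1 -> Cmod (V t q) <= bnd.
Proof.
  intros Ht. unfold bnd. pose proof (rho_range a q Ha). pose proof (Cmod_ge_0 w).
  replace (V t q) with (RtoC (1 - rho a q) + RtoC (t * rho a q) * w)%C
    by (unfold V; rewrite RtoC_minus, RtoC_mult; ring).
  eapply Rle_trans; [apply Cmod_triangle|]. rewrite Cmod_mult, !Cmod_R.
  assert (0 <= t * rho a q <= 1) by nra.
  rewrite !Rabs_right by lra. nra.
Qed.

(** The square of [|V|] is split off from [|V|^n], [n >= 2]: it compensates the factor [1 / V^2] in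
    the second [t]-derivative, which is unbounded near the corner [t = 0], [q = 1], where [V]
    vanishes. *)
Let Cmod_G t q : 0 <= t <= 1 -> 0 < Re (V t q) ->
  Cmod (G t q) <= Cmod (V t q) ^ 2 * (exp ((n - 2) * ln bnd) * exp (Cmod z * (1 + bnd))).
Proof.
  intros Ht HV. unfold G. rewrite Cmod_cexp, re_plus, exp_plus.
  rewrite <- Rmult_assoc. pose proof (proj1 (Cmod_gt_0 _) (V_neq_0 _ _ HV)) as HC.
  pose proof (Cmod_V t q Ht) as HB.
  apply Rmult_le_compat; try (left; apply exp_pos).
  - rewrite re_scal_l, Re_clog by auto.
    replace (n * ln (Cmod (V t q))) with
      (ln (Cmod (V t q)) + ln (Cmod (V t q)) + (n - 2) * ln (Cmod (V t q))) by ring.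
    rewrite !exp_plus, !exp_ln by auto. simpl. rewrite Rmult_1_r.
    apply Rmult_le_compat_l; [nra|]. apply exp_le, Rmult_le_compat_l; [lra|].
    destruct HB as [HB| ->]; [left; apply ln_increasing; auto|right; reflexivity].
  - apply exp_le. eapply Rle_trans; [apply Re_le_Cmod|]. rewrite Cmod_mult.
    apply Rmult_le_compat_l; [apply Cmod_ge_0|].
    eapply Rle_trans; [apply Cmod_triangle|]. rewrite Cmod_opp, Cmod_1. lra.
Qed.

Let derivative_bounds : exists M, forall t q, 0 <= t <= 1 -> 0 < Re (V t q) ->
  Cmod (G1 t q) <= M /\ Cmod (G2 t q) <= M.
Proof.
  set (e := exp ((n - 2) * ln bnd) * exp (Cmod z * (1 + bnd))).
  assert (He : 0 < e) by (apply Rmult_lt_0_compat; apply exp_pos).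
  pose proof (Cmod_ge_0 z) as Hz. pose proof (Cmod_ge_0 w) as Hw0.
  set (A := n + Cmod z * bnd).
  exists (Cmod w * (A * bnd * e) + Cmod w * Cmod w * ((A * A + n) * e)).
  intros t q Ht HV. pose proof (V_neq_0 _ _ HV) as HV0.
  pose proof (proj1 (Cmod_gt_0 _) HV0) as HC.
  pose proof (Cmod_V t q Ht) as HB. pose proof (Cmod_G t q Ht HV) as HG. fold e in HG.
  pose proof (rho_range a q Ha) as HR.
  set (v := Cmod (V t q)) in *.
  assert (HA : n + Cmod z * v <= A) by (unfold A; nra).
  assert (HA0 : 0 <= n + Cmod z * v) by nra.
  assert (Hb0 : 0 < bnd) by lra.
  assert (H1 : Cmod ((n - z * V t q) * (/ V t q) * G t q) <= A * bnd * e).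
  { rewrite !Cmod_mult, Cmod_inv by auto. fold v.
    assert (Cmod (n - z * V t q) <= A).
    { eapply Rle_trans; [apply Cmod_triangle|]. rewrite Cmod_opp, Cmod_mult, Cmod_R, Rabs_right by lra.
      exact HA. }
    pose proof (Cmod_ge_0 (n - z * V t q)).
    apply Rle_trans with (A * / v * (v ^ 2 * e)).
    - apply Rmult_le_compat; auto; try apply Cmod_ge_0.
      + apply Rmult_le_pos; [auto|left; apply Rinv_0_lt_compat; auto].
      + apply Rmult_le_compat_r; [left; apply Rinv_0_lt_compat; auto|auto].
    - replace (A * / v * (v ^ 2 * e)) with (A * v * e) by (field; lra).
      apply Rmult_le_compat_r; [lra|]. apply Rmult_le_compat_l; lra. }
  assert (H2 : Cmod (((n - z * V t q) * (n - z * V t q) - n) * (/ V t q * / V t q) * G t q)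
     <= (A * A + n) * e).
  { rewrite !Cmod_mult, !Cmod_inv by auto. fold v.
    assert (Cmod ((n - z * V t q) * (n - z * V t q) - n) <= A * A + n).
    { eapply Rle_trans; [apply Cmod_triangle|]. rewrite Cmod_opp, Cmod_mult, Cmod_R, Rabs_right by lra.
      assert (Cmod (n - z * V t q) <= A).
      { eapply Rle_trans; [apply Cmod_triangle|]. rewrite Cmod_opp, Cmod_mult, Cmod_R, Rabs_right by lra.
        exact HA. }
      pose proof (Cmod_ge_0 (n - z * V t q)). nra. }
    assert (Hv : 0 < / v) by (apply Rinv_0_lt_compat; auto).
    apply Rle_trans with ((A * A + n) * (/ v * / v) * (v ^ 2 * e)).
    - apply Rmult_le_compat; auto; try apply Cmod_ge_0.
      + apply Rmult_le_pos; [apply Cmod_ge_0|nra].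
      + apply Rmult_le_compat_r; [nra|auto].
    - right. field. lra. }
  assert (P1 : 0 <= A * bnd * e) by (eapply Rle_trans; [apply Cmod_ge_0|exact H1]).
  assert (P2 : 0 <= (A * A + n) * e) by (eapply Rle_trans; [apply Cmod_ge_0|exact H2]).
  assert (HS : forall r X P, 0 <= r <= 1 -> 0 <= X -> X <= P -> r * X <= P) by (intros; nra).
  split.
  - replace (G1 t q) with (w * (rho a q * ((n - z * V t q) * (/ V t q) * G t q)))%C
      by (unfold G1; field; auto).
    rewrite !(Cmod_mult w), Cmod_mult, Cmod_R, Rabs_right by lra.
    pose proof (Cmod_ge_0 ((n - z * V t q) * (/ V t q) * G t q)).
    assert (0 <= Cmod w * Cmod w * ((A * A + n) * e)) by nra.
    assert (HX : rho a q * Cmod ((n - z * V t q) * (/ V t q) * G t q) <= A * bnd * e)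
      by (apply HS; auto).
    apply (Rmult_le_compat_l (Cmod w)) in HX; lra.
  - replace (G2 t q) with (w * w * (RtoC (rho a q * rho a q) *
       (((n - z * V t q) * (n - z * V t q) - n) * (/ V t q * / V t q) * G t q)))%C
      by (unfold G2; rewrite RtoC_mult; field; auto).
    rewrite (Cmod_mult (w * w)), (Cmod_mult w w), (Cmod_mult (RtoC _)), Cmod_R, Rabs_right by nra.
    pose proof (Cmod_ge_0 (((n - z * V t q) * (n - z * V t q) - n) * (/ V t q * / V t q) * G t q)).
    assert (rho a q * rho a q * Cmod (((n - z * V t q) * (n - z * V t q) - n) * (/ V t q * / V t q) * G t q)
       <= (A * A + n) * e) by (apply HS; auto; split; [nra|clear - HR; nra]).
    assert (0 <= Cmod w * (A * bnd * e)) by (apply Rmult_le_pos; auto).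
    apply (Rmult_le_compat_l (Cmod w * Cmod w)) in H0; [lra|].
    apply Rmult_le_pos; auto.
Qed.

Let G0 (q : R) : C := (RtoC (beta_weight a n q) * cexp (z * rho a q))%C.

Let G_at_0 q : 0 < q < 1 -> G 0 q = G0 q.
Proof.
  intros Hq. destruct (rho_lt_1 a q Ha Hq). unfold G, G0, beta_weight.
  rewrite rpw_pos, <- cexp_RtoC, <- cexp_plus by lra. f_equal.
  replace (V 0 q) with (RtoC (1 - rho a q) * 1)%C by (unfold V; rewrite RtoC_minus; ring).
  rewrite clog_scal by (simpl; lra).
  replace (clog 1) with (RtoC 0).
  - rewrite RtoC_mult, RtoC_minus. ring.
  - unfold clog. simpl. replace (1 * (1 * 1) + 0 * (0 * 1)) with 1 by ring.
    replace (0 / 1) with 0 by field. rewrite ln_1, atan_0. apply C_ext; simpl; ring.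
Qed.

Let ccont_G0 q : ccont G0 q.
Proof.
  apply ccont_mult; [apply ccont_RtoC, continuous_beta_weight; lra|].
  apply ccont_cexp, ccont_mult; [apply ccont_const|apply ccont_rho; auto].
Qed.

(** At [t = 0] the segment ends at the point [0], where [clog] gives no logarithm. [G0], written
    with [rpw], is continuous up to that end and agrees with [G 0] inside. *)
Let GG (t q : R) : C := if Rle_dec t 0 then G0 q else G t q.

Let ccont_GG t q : 0 <= t <= 1 -> ccont (GG t) q.
Proof.
  intros Ht. unfold GG. destruct (Rle_dec t 0); [apply ccont_G0|apply ccont_G; lra].
Qed.

Let GG_eq t q : 0 <= t <= 1 -> 0 < q < 1 -> GG t q = G t q.
Proof.
  intros Ht Hq. unfold GG. destruct (Rle_dec t 0); auto.
  replace t with 0 by lra. symmetry; apply G_at_0; auto.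
Qed.

Let N (t : R) : C := CI (GG (clamp t)).

(** [N] is Lipschitz, by the uniform bound on [G1]. This includes [t = 0], where the later
    integration in [t] relies on continuity alone. *)
Let ccont_N t : ccont N t.
Proof.
  destruct derivative_bounds as [M HM].
  assert (HL : forall s u, Cmod (N s - N u) <= M * Rabs (s - u)).
  { intros s u. unfold N. pose proof (clamp_range s) as Hs. pose proof (clamp_range u) as Hu.
    rewrite <- CI_minus by auto.
    apply CI_norm_const.
    - intros q. apply (ccont_minus (GG (clamp s)) (GG (clamp u))); auto.
    - intros q Hq. rewrite !GG_eq by auto.
      eapply Rle_trans; [apply (mean_value_const_abs (fun t => G t q) (fun t => G1 t q) M 0 1); auto|].
      + intros x Hx. apply HM; auto.
      + apply Rmult_le_compat_l; [|apply clamp_lip].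
        eapply Rle_trans; [apply Cmod_ge_0|apply (HM 0 q); [lra|apply Re_V_pos; auto; lra]]. }
  assert (HM0 : 0 <= M).
  { specialize (HL 1 0). rewrite Rminus_0_r, Rabs_R1 in HL.
    pose proof (Cmod_ge_0 (N 1 - N 0)). lra. }
  split; apply continuous_R_iff; intros e He; exists (e / (M + 1)); (split;
    [apply Rdiv_lt_0_compat; lra|]); intros y Hy; specialize (HL y t).
  all: apply (Rmult_lt_compat_l (M + 1)) in Hy; [|lra];
    replace ((M + 1) * (e / (M + 1))) with e in Hy by (field; lra);
    pose proof (Rabs_pos (y - t)).
  - pose proof (re_le_Cmod (N y - N t)) as HRe.
    unfold Cminus in HRe at 1. rewrite re_plus, re_opp in HRe. unfold Rminus. lra.
  - pose proof (Im_le_Cmod (N y - N t)) as HIm.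
    unfold Cminus in HIm at 1. rewrite im_plus, im_opp in HIm. unfold Rminus. lra.
Qed.

Let H1 (t q : R) : C := (rho a q * (n / V t q - z) * G t q)%C.

Let ccont_H1 t q : 0 < t <= 1 -> ccont (H1 t) q.
Proof.
  intros Ht. unfold H1. apply ccont_mult; [apply ccont_mult|apply ccont_G; auto].
  - apply ccont_rho; auto.
  - apply ccont_minus; [|apply ccont_const]. apply ccont_mult; [apply ccont_const|].
    apply (ccont_inv (V t)); auto.
Qed.

(** Differentiation under the integral sign: the Taylor remainder in [t] is at most [M (u - t)^2]
    uniformly in [q], and integration preserves this bound. *)
Let cderiv_N t : 0 < t < 1 -> cderiv N t (w * CI (H1 t))%C.
Proof.
  intros Ht. destruct derivative_bounds as [M HM].
  assert (HQ : forall u, 0 <= u <= 1 ->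
     Cmod (N u - N t - (u - t)%R * (w * CI (H1 t))) <= M * (u - t) ^ 2).
  { intros u Hu. unfold N. rewrite !clamp_id by lra.
    assert (Hc : forall q, ccont (fun q => w * H1 t q)%C q).
    { intros q. apply ccont_mult; [apply ccont_const|apply ccont_H1; lra]. }
    assert (Hu' : forall q, ccont (GG u) q) by (intros; apply ccont_GG; lra).
    assert (Ht' : forall q, ccont (GG t) q) by (intros; apply ccont_GG; lra).
    assert (HH : forall q, ccont (H1 t) q) by (intros; apply ccont_H1; lra).
    rewrite <- (CI_scal w (H1 t) HH), <- (CI_scal (u - t)%R _ Hc), <- (CI_minus (GG u) (GG t) Hu' Ht'),
      <- CI_minus.
    - apply CI_norm_const.
      + intros q. apply ccont_minus; [apply (ccont_minus (GG u) (GG t)); apply ccont_GG; lra|].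
        apply ccont_mult; [apply ccont_const|apply Hc].
      + intros q Hq. rewrite !GG_eq by lra.
        apply (taylor1 (fun s => G s q) (fun s => G1 s q) (fun s => G2 s q) M 0 1); try lra; auto.
        intros s Hs. apply HM; auto.
    - intros q. apply (ccont_minus (GG u) (GG t)); apply ccont_GG; lra.
    - intros q. apply ccont_mult; [apply ccont_const|apply Hc]. }
  set (l := (w * CI (H1 t))%C) in *.
  assert (HM0 : 0 <= M).
  { eapply Rle_trans; [apply Cmod_ge_0|apply (HM t (1 / 2)); [lra|apply Re_V_pos'; lra]]. }
  assert (HD : forall (g : R -> R) (d : R),
     (forall u, 0 <= u <= 1 -> Rabs (g u - g t - (u - t) * d) <= M * (u - t) ^ 2) ->
     is_derive g t d).
  { intros g d Hg. apply is_derive_Reals. intros e He.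
    assert (Hm : 0 < Rmin (Rmin t (1 - t)) (e / (M + 1))).
    { repeat apply Rmin_pos; try lra. apply Rdiv_lt_0_compat; lra. }
    exists (mkposreal _ Hm). intros h Hh Hlt. simpl in Hlt.
    assert (B1 : Rabs h < t) by (eapply Rlt_le_trans; [exact Hlt|]; eapply Rle_trans; [apply Rmin_l|apply Rmin_l]).
    assert (B2 : Rabs h < 1 - t) by (eapply Rlt_le_trans; [exact Hlt|]; eapply Rle_trans; [apply Rmin_l|apply Rmin_r]).
    assert (B3 : Rabs h < e / (M + 1)) by (eapply Rlt_le_trans; [exact Hlt|apply Rmin_r]).
    pose proof (Rabs_def2 _ _ B1). pose proof (Rabs_def2 _ _ B2).
    specialize (Hg (t + h) ltac:(lra)). replace (t + h - t) with h in Hg by ring.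
    replace ((g (t + h) - g t) / h - d) with ((g (t + h) - g t - h * d) / h) by (field; auto).
    pose proof (Rabs_pos_lt _ Hh) as Hh'.
    rewrite Rabs_div by auto. apply (Rmult_lt_reg_r (Rabs h)); auto.
    unfold Rdiv. rewrite Rmult_assoc, Rinv_l, Rmult_1_r by lra.
    eapply Rle_lt_trans; [exact Hg|]. rewrite <- pow2_abs.
    apply (Rmult_lt_compat_l (M + 1)) in B3; [|lra].
    replace ((M + 1) * (e / (M + 1))) with e in B3 by (field; lra). nra. }
  split; apply HD; intros u Hu; eapply Rle_trans; [|apply HQ; exact Hu| |apply HQ; exact Hu].
  - eapply Rle_trans; [|apply re_le_Cmod]. right. f_equal. simpl. unfold Re, Im. ring.
  - eapply Rle_trans; [|apply Im_le_Cmod]. right. f_equal. simpl. unfold Re, Im. ring.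
Qed.

(** Integration by parts in [q]. Since [q * dV/dq = - (1 - t w) rho / a], the operator [q d/dq] acts
    on [G] as a multiple of the [t]-derivative: the derivative of [q * G] is
    [G - ((1 - t w) / a) * H1], and only the end [q = 1] contributes. *)
Let H1_integral t : 0 < t < 1 ->
  ((1 - t * w) * CI (H1 t))%C = (a * (N t - G t 1))%C.
Proof.
  intros Ht. set (c := (1 - t * w)%C).
  assert (HF : CI (fun q => G t q - (c * (/ a)%R) * H1 t q)%C = (RtoC 1 * G t 1 - RtoC 0 * G t 0)%C).
  { apply (FTC_open (fun q => RtoC q * G t q)%C).
    - intros q. apply ccont_minus; [apply ccont_G; lra|].
      apply ccont_mult; [apply ccont_const|apply ccont_H1; lra].
    - intros q _. apply ccont_mult; [eapply cderiv_cont, cderiv_id|apply ccont_G; lra].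
    - intros q Hq. assert (HV : 0 < Re (V t q)) by (apply Re_V_pos'; lra).
      assert (DV : cderiv (V t) q (- (c * RtoC (rho a q / (a * q))))%C).
      { eapply cderiv_ext_val; [|apply cderiv_minus; [apply cderiv_const|apply cderiv_scal,
          cderiv_RtoC, is_derive_rho; auto]]. fold c. ring. }
      eapply cderiv_ext_val; [|apply cderiv_mult; [apply cderiv_id|apply cderiv_cexp, cderiv_plus;
        apply cderiv_mult; [apply cderiv_const|apply cderiv_clog; [exact HV|exact DV]|apply cderiv_const|
        apply cderiv_minus; [apply cderiv_const|exact DV]]]].
      cbv beta. change (cexp (n * clog (V t q) + z * (1 - V t q)))%C with (G t q). unfold H1.
      replace (RtoC (rho a q / (a * q))) with (RtoC (rho a q) * RtoC (/ a)%R * / RtoC q)%C.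
      + field. split; auto. intros E; apply RtoC_inj in E; lra.
      + rewrite <- RtoC_inv, <- !RtoC_mult by lra. f_equal. field. lra. }
  rewrite CI_minus, CI_scal in HF.
  - replace (N t) with (CI (G t)).
    + replace (G t 1) with (CI (G t) - c * (/ a)%R * CI (H1 t))%C by (rewrite HF; ring).
      transitivity (RtoC (a * / a) * (c * CI (H1 t)))%C.
      * rewrite Rinv_r by lra. ring.
      * rewrite RtoC_mult. ring.
    + unfold N. rewrite clamp_id by lra. apply CI_ext. intros q Hq. rewrite GG_eq; lra || auto.
  - intros; apply ccont_H1; lra.
  - intros; apply ccont_G; lra.
  - intros; apply ccont_mult; [apply ccont_const|apply ccont_H1; lra].
Qed.

(* Deformation of the path from [0] to [1] into the path through [w], in the form of the
   first order equation for [(1 - t w)^a N t] along the side from [0] to [w]. *)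
Lemma contour_deformation (chi : R -> C) :
  chi 0 = 1 -> (forall t, cderiv chi t (- (a * w * chi t / (1 - t * w)))%C) ->
  expint a (fun q => RtoC (beta_weight a n q)) z =
   (chi 1%R * CI (fun q => cexp (n * clog (1 - (1 - w) * rho a q) + z * ((1 - w) * rho a q)))
    + a * w * cexp (n * clog w) *
      CI (fun t => chi t / (1 - t * w) * (RtoC (rpw n t) * cexp (z * (1 - t * w)))))%C.
Proof.
  intros Hc0 Hc.
  set (J := fun t : R => (chi t / (1 - t * w) * (RtoC (rpw n t) * cexp (z * (1 - t * w))))%C).
  assert (CS : forall t, ccont (fun t : R => 1 - t * w)%C t)
    by (intros; eapply cderiv_cont, cderiv_segment).
  assert (CJ : forall t, ccont J t).
  { intros t. apply ccont_mult; [apply ccont_mult|apply ccont_mult].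
    - eapply cderiv_cont, Hc.
    - apply ccont_inv; [apply segment_neq_0; auto|auto].
    - apply ccont_RtoC, continuous_rpw; lra.
    - apply ccont_cexp, ccont_mult; [apply ccont_const|auto]. }
  (* In the derivative of [chi * N] the terms in [N] cancel by the choice of [chi]; what remains is
     the end value [G t 1 = (t w)^n e^(z (1 - t w))]. *)
  assert (HF : CI (fun t => - (a * w * cexp (n * clog w)) * J t)%C = (chi 1%R * N 1 - chi 0%R * N 0)%C).
  { apply (FTC_open (fun t => chi t * N t)%C).
    - intros t. apply ccont_mult; [apply ccont_const|apply CJ].
    - intros t _. apply ccont_mult; [eapply cderiv_cont, Hc|apply ccont_N].
    - intros t Ht. eapply cderiv_ext_val; [|apply cderiv_mult; [apply Hc|apply cderiv_N; auto]].
      pose proof (segment_neq_0 w t Hw') as Hs.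
      assert (HI : CI (H1 t) = (a * (N t - G t 1) / (1 - t * w))%C).
      { rewrite <- H1_integral by auto. field. auto. }
      rewrite HI.
      assert (HG1 : G t 1 = (RtoC (rpw n t) * cexp (n * clog w) * cexp (z * (1 - t * w)))%C).
      { unfold G. replace (V t 1) with (RtoC t * w)%C by (unfold V; rewrite rho_1; ring).
        rewrite clog_scal, rpw_pos, <- cexp_RtoC, <- !cexp_plus by lra. f_equal.
        rewrite RtoC_mult. ring. }
      rewrite HG1. unfold J. field. auto. }
  rewrite CI_scal in HF by auto. rewrite Hc0 in HF.
  assert (HN0 : N 0 = expint a (fun q => RtoC (beta_weight a n q)) z).
  { unfold N. rewrite clamp_id by lra. apply CI_ext. intros q Hq.
    rewrite GG_eq, G_at_0 by (auto; lra). reflexivity. }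
  assert (HN1 : N 1 = CI (fun q => cexp (n * clog (1 - (1 - w) * rho a q) + z * ((1 - w) * rho a q)))).
  { unfold N. rewrite clamp_id by lra. apply CI_ext. intros q Hq.
    rewrite GG_eq by (auto; lra). unfold G, V.
    f_equal. f_equal; [f_equal; f_equal; ring|ring]. }
  rewrite <- HN0, <- HN1. fold J.
  replace (N 0) with (chi 1%R * N 1 - (chi 1%R * N 1 - 1 * N 0))%C by ring.
  rewrite <- HF. ring.
Qed.

End Deformation.

(** * Contribution of the endpoint *)

Lemma continuous_exp_scal (f : R -> R) (k t : R) :
  continuous f t -> continuous (fun s => exp (- (k * f s))) t.
Proof.
  intros Hf. apply (continuous_comp (fun s => - (k * f s)) exp); [|apply continuous_exp].
  apply (continuous_opp (V := R_NormedModule)), (continuous_mult (K := R_AbsRing)); auto.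
  apply continuous_const.
Qed.

(** The integral of [a r^(a-1) e^(-s r)] over [0,1], an incomplete Gamma integral of order [s^(-a)]
    for large [s]. It is the unit in which the endpoint contribution is measured. *)
Definition laplace (a s : R) : R := RInt (fun q => exp (- (s * rho a q))) 0 1.

Lemma laplace_ex_RInt a s u v : 0 < a -> ex_RInt (fun q => exp (- (s * rho a q))) u v.
Proof. intros Ha. apply cont_ex_RInt. intros; apply continuous_exp_scal, continuous_rho; auto. Qed.

Lemma RInt_cst (c u v : R) : RInt (fun _ => c) u v = (v - u) * c.
Proof. rewrite (RInt_const (V := R_CompleteNormedModule)). reflexivity. Qed.

Lemma laplace_le_1 a s : 0 < a -> 0 <= s -> laplace a s <= 1.
Proof.
  intros Ha Hs. replace 1 with (RInt (fun _ => 1) 0 1) by (rewrite RInt_cst; bring).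
  apply RInt_le; [lra|apply laplace_ex_RInt; auto|apply cont_ex_RInt; intros; apply continuous_const|].
  intros q _. rewrite <- exp_0. apply exp_le. pose proof (rho_range a q Ha). nra.
Qed.

Lemma rho_eq a q : 0 < q < 1 -> rho a q = exp (/ a * ln q).
Proof. intros Hq. unfold rho. rewrite clamp_id, rpw_pos by lra. reflexivity. Qed.

Lemma RInt_le_subinterval (f : R -> R) (u v : R) :
  (forall t, continuous f t) -> (forall t, 0 <= f t) -> 0 <= u -> u <= v -> v <= 1 ->
  RInt f u v <= RInt f 0 1.
Proof.
  intros Hc Hf Hu Huv Hv.
  pose proof (RInt_Chasles (V := R_CompleteNormedModule) f 0 u 1
    (cont_ex_RInt _ _ _ Hc) (cont_ex_RInt _ _ _ Hc)) as E1.
  pose proof (RInt_Chasles (V := R_CompleteNormedModule) f u v 1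
    (cont_ex_RInt _ _ _ Hc) (cont_ex_RInt _ _ _ Hc)) as E2.
  unfold plus in E1, E2; simpl in E1, E2.
  pose proof (RInt_ge_0 f 0 u Hu (cont_ex_RInt _ _ _ Hc) ltac:(auto)).
  pose proof (RInt_ge_0 f v 1 Hv (cont_ex_RInt _ _ _ Hc) ltac:(auto)). lra.
Qed.

(** For [q <= n^(-a)] one has [rho <= 1 / n], so the integrand is at least [e^(-k)] there. *)
Lemma laplace_lower a n k : 0 < a -> 1 <= n -> 0 < k ->
  exp (- k - a * ln n) <= laplace a (n * k).
Proof.
  intros Ha Hn Hk. set (q0 := exp (- (a * ln n))).
  assert (Hln : 0 <= ln n) by (rewrite <- ln_1; destruct Hn as [Hn| <-];
    [left; apply ln_increasing; lra|lra]).
  assert (Hq0 : 0 < q0 <= 1).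
  { split; [apply exp_pos|]. rewrite <- exp_0. apply exp_le. nra. }
  apply Rle_trans with (RInt (fun q => exp (- (n * k * rho a q))) 0 q0).
  2:{ apply (RInt_le_subinterval (fun q => exp (- (n * k * rho a q)))); try lra.
      - intros; apply continuous_exp_scal, continuous_rho; auto.
      - intros; left; apply exp_pos. }
  replace (exp (- k - a * ln n)) with (RInt (fun _ => exp (- k)) 0 q0).
  2:{ rewrite RInt_cst. unfold q0. rewrite Rminus_0_r, <- exp_plus. f_equal. ring. }
  apply RInt_le; [lra|apply cont_ex_RInt; intros; apply continuous_const|
    apply laplace_ex_RInt; auto|].
  intros q Hq. apply exp_le. rewrite rho_eq by lra.
  assert (Hr : exp (/ a * ln q) <= / n).
  { rewrite <- (exp_ln n) by lra. rewrite <- exp_Ropp. apply exp_le.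
    assert (ln q < - (a * ln n)) by (rewrite <- (ln_exp (- (a * ln n))); apply ln_increasing; [lra|apply Hq]).
    apply (Rmult_le_reg_l a); auto. rewrite <- Rmult_assoc, Rinv_r, Rmult_1_l by lra. lra. }
  apply Ropp_le_contravar. apply (Rmult_le_compat_l (n * k)) in Hr; [|nra].
  replace (n * k * / n) with k in Hr by (field; lra). exact Hr.
Qed.

(** The substitution [q = 8^(-a) q'] divides [rho] by [8], so the left side is the part of the
    integral over [[0, 8^(-a)]]. An error known only with the weaker rate [s / 8] thus becomes
    comparable with the main term. *)
Lemma laplace_scaling a s : 0 < a ->
  exp (- (a * ln 8)) * laplace a (s / 8) <= laplace a s.
Proof.
  intros Ha. set (th := exp (- (a * ln 8))).
  assert (H8 : 0 < ln 8) by (rewrite <- ln_1; apply ln_increasing; lra).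
  assert (Hth : 0 < th <= 1).
  { split; [apply exp_pos|]. rewrite <- exp_0. apply exp_le. nra. }
  set (f := fun q => exp (- (s * rho a q))).
  assert (Cf : forall q, continuous f q)
    by (intros; apply continuous_exp_scal, continuous_rho; auto).
  assert (E : th * laplace a (s / 8) = RInt f 0 th).
  { pose proof (RInt_comp_lin (V := R_CompleteNormedModule) f th 0 0 1
      (cont_ex_RInt _ _ _ Cf)) as E0.
    replace (th * 0 + 0) with 0 in E0 by ring. replace (th * 1 + 0) with th in E0 by ring.
    rewrite <- E0. unfold laplace.
    rewrite <- (RInt_scal (V := R_CompleteNormedModule)) by (apply laplace_ex_RInt; auto).
    apply (RInt_ext (V := R_CompleteNormedModule)). intros q. rewrite Rmin_left, Rmax_right by lra.
    intros Hq. unfold f. f_equal. f_equal. f_equal. rewrite Rplus_0_r.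
    rewrite !rho_eq by nra. rewrite ln_mult by lra. unfold th. rewrite ln_exp.
    replace (/ a * (- (a * ln 8) + ln q)) with (- ln 8 + / a * ln q) by (field; lra).
    rewrite exp_plus, exp_Ropp, exp_ln by lra. field. }
  rewrite E. apply RInt_le_subinterval; auto; try lra. intros; left; apply exp_pos.
Qed.

Lemma exp_ge_square (x : R) : 0 <= x -> x * x <= 4 * exp x.
Proof.
  intros Hx. replace x with (x / 2 + x / 2) at 3 by field. rewrite exp_plus.
  pose proof (exp_ineq1_le (x / 2)). nra.
Qed.

Lemma ln_le_sub_1 (x : R) : 0 < x -> ln x <= x - 1.
Proof. intros Hx. pose proof (exp_ineq1_le (ln x)). rewrite exp_ln in H by auto. lra. Qed.

Section Endpoint.

Variables (a : R) (xi : C).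
Hypotheses (Ha : 0 < a) (Hx : 1 <= Re xi) (Hy : Im xi <> 0).

Let c : C := (1 - Cconj xi)%C.
Let k : R := Cmod (1 - xi) ^ 2.

Let k_eq : k = (Re xi - 1) ^ 2 + Im xi ^ 2.
Proof. unfold k. rewrite Cmod_eq. simpl. unfold Re, Im. ring. Qed.

Let k_pos : 0 < k.
Proof. rewrite k_eq. assert (0 < Im xi ^ 2) by (apply pow2_gt_0; auto). nra. Qed.

Let V (r : R) : C := (1 - c * r)%C.
Let Psi (r : R) : C := (clog (V r) + xi * (c * r))%C.

Let Re_V r : Re (V r) = 1 + r * (Re xi - 1).
Proof. unfold V, c. simpl. unfold Re, Im. ring. Qed.

Let Re_V_ge_1 r : 0 <= r <= 1 -> 1 <= Re (V r).
Proof. intros Hr. rewrite Re_V. nra. Qed.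

(** By [ln X <= X - 1] with [X = |V r|^2] the left side is at most [- k r + k r^2 / 2], and
    [r <= 1]. *)
Lemma endpoint_phase_decay r : 0 <= r <= 1 ->
  Re (clog (1 - (1 - Cconj xi) * r) + xi * ((1 - Cconj xi) * r)) <= - (k / 2 * r).
Proof.
  intros Hr. rewrite re_plus. fold c. fold (V r).
  change (Re (clog (V r))) with (/ 2 * ln (Re (V r) ^ 2 + Im (V r) ^ 2)).
  assert (E : Re (V r) ^ 2 + Im (V r) ^ 2 = 1 + (2 * r * (Re xi - 1) + r ^ 2 * k)).
  { rewrite k_eq, Re_V. replace (Im (V r)) with (- (r * Im xi)); [ring|].
    unfold V, c. simpl. unfold Re, Im. ring. }
  assert (P : 0 < Re (V r) ^ 2 + Im (V r) ^ 2).
  { pose proof (Re_V_ge_1 r Hr). nra. }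
  pose proof (ln_le_sub_1 _ P) as HL. rewrite E in HL at 2.
  assert (E2 : Re (xi * (c * r)) = r * (Re xi - (Re xi ^ 2 + Im xi ^ 2))).
  { unfold c. simpl. unfold Re, Im. ring. }
  rewrite E2. pose proof k_pos as HK. pose proof k_eq as Ek.
  assert (r ^ 2 * k <= r * k) by (apply Rmult_le_compat_r; nra).
  assert (Er : r * k = r * ((Re xi - 1) ^ 2 + Im xi ^ 2)) by (rewrite <- Ek; reflexivity).
  lra.
Qed.

Let cderiv_cr r : cderiv (fun r : R => c * r)%C r c.
Proof. eapply cderiv_ext_val; [|apply cderiv_scal, cderiv_id]. bring. Qed.

Let cderiv_V r : cderiv V r (- c)%C.
Proof.
  eapply cderiv_ext_val; [|apply cderiv_minus; [apply cderiv_const|apply cderiv_cr]]. bring.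
Qed.

Let V_neq_0 r : 0 <= r <= 1 -> V r <> 0.
Proof. intros Hr E. pose proof (Re_V_ge_1 r Hr). rewrite E in H. simpl in H. lra. Qed.

(** Taylor expansion at [r = 0]: the slope is [- c + xi c = - c (1 - xi) = - k], and the second
    derivative [- c^2 / V^2] has modulus at most [|c|^2 = k] because [|V| >= Re V >= 1]. *)
Lemma endpoint_phase_quadratic r : 0 <= r <= 1 ->
  Cmod (clog (1 - (1 - Cconj xi) * r) + xi * ((1 - Cconj xi) * r) + RtoC (k * r)) <= k * r ^ 2.
Proof.
  intros Hr.
  assert (Hcc : Cmod c ^ 2 = k).
  { rewrite Cmod_eq, k_eq. unfold c. simpl. unfold Re, Im. ring. }
  pose proof (taylor1 Psi (fun r => - c / V r + xi * c)%C (fun r => - (c * c) * (/ V r * / V r))%C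
    k 0 1 0 r) as HT.
  assert (HV0 : V 0 = 1) by (unfold V; ring).
  assert (HP0 : Psi 0 = 0).
  { unfold Psi. rewrite HV0. replace (clog 1) with (RtoC 0); [ring|].
    unfold clog. simpl. replace (1 * (1 * 1) + 0 * (0 * 1)) with 1 by ring.
    replace (0 / 1) with 0 by field. rewrite ln_1, atan_0. apply C_ext; simpl; ring. }
  replace (clog (1 - (1 - Cconj xi) * r) + xi * ((1 - Cconj xi) * r) + RtoC (k * r))%C
    with (Psi r - Psi 0%R - (r - 0)%R * (- c / V 0%R + xi * c))%C.
  - rewrite <- (Rminus_0_r r) at 3. apply HT; auto; try lra.
    + intros s Hs. apply cderiv_plus.
      * apply cderiv_clog; [pose proof (Re_V_ge_1 s Hs); lra|apply cderiv_V].
      * apply cderiv_scal, cderiv_cr.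
    + intros s Hs. eapply cderiv_ext_val; [|apply cderiv_plus; [apply cderiv_mult;
        [apply cderiv_const|apply cderiv_inv; [apply V_neq_0; auto|apply cderiv_V]]|apply cderiv_const]].
      cbv beta. field. apply V_neq_0; auto.
    + intros s Hs. rewrite Cmod_mult, Cmod_opp, !Cmod_mult, !Cmod_inv by (apply V_neq_0; auto).
      rewrite <- Hcc.
      assert (H1 : / Cmod (V s) <= 1).
      { rewrite <- Rinv_1. apply Rinv_le_contravar; [lra|].
        eapply Rle_trans; [apply (Re_V_ge_1 s Hs)|apply Re_le_Cmod]. }
      assert (H2 : 0 < / Cmod (V s)).
      { apply Rinv_0_lt_compat, Cmod_gt_0, V_neq_0; auto. }
      pose proof (Cmod_ge_0 c). simpl. rewrite Rmult_1_r.
      rewrite <- (Rmult_1_r (Cmod c * Cmod c)) at 2. apply Rmult_le_compat_l; nra.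
  - rewrite HP0, HV0. fold c. fold (V r). fold (Psi r).
    assert (Ek : RtoC k = (c * (1 - xi))%C).
    { rewrite k_eq. unfold c. apply C_ext; simpl; unfold Re, Im; ring. }
    rewrite RtoC_mult, Rminus_0_r, Ek. field.
Qed.

(** Half of the decay [e^(-n k r / 2)] is spent on [om]. With [X = n k r / 8] the remaining
    [e^(-2 X)] is shared: one [e^(-X)] absorbs the polynomial factors through [X^2 e^(-X) <= 4] and
    [X e^(-X) <= 1], whence the constants [64 * 4] and [8], and the other integrates to
    [laplace a (n * k / 8)]. *)
Lemma endpoint_contribution (n : R) (om : C) : 1 <= n ->
  Cmod om * Cmod c <= n * k / 4 ->
  Cmod (CI (fun q => cexp (n * clog (1 - (1 - Cconj xi) * rho a q) +
          (n * xi + om) * ((1 - Cconj xi) * rho a q))) - laplace a (n * k))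
   <= (64 * 4 / k + 8 * Cmod c * Cmod om / k) / n * exp (a * ln 8) * laplace a (n * k).
Proof.
  intros Hn Hom.
  assert (HcV : forall q, ccont (fun q => V (rho a q)) q).
  { intros q. apply ccont_minus; [apply ccont_const|].
    apply ccont_mult; [apply ccont_const|apply ccont_rho; auto]. }
  assert (HE : forall q, ccont (fun q => cexp (n * clog (1 - (1 - Cconj xi) * rho a q) +
          (n * xi + om) * ((1 - Cconj xi) * rho a q)))%C q).
  { intros q. apply ccont_cexp, ccont_plus.
    - apply ccont_mult; [apply ccont_const|].
      apply (ccont_clog (fun q => V (rho a q))); auto.
      pose proof (Re_V_ge_1 _ (rho_range a q Ha)). lra.
    - apply ccont_mult; [apply ccont_const|]. apply ccont_mult; [apply ccont_const|].
      apply ccont_rho; auto. }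
  assert (HL : forall s q, continuous (fun q => exp (- (s * rho a q))) q)
    by (intros; apply continuous_exp_scal, continuous_rho; auto).
  unfold laplace at 1. rewrite <- CI_RtoC.
  rewrite <- CI_minus; [|auto|intros; apply ccont_RtoC; auto].
  set (K := (64 * 4 / k + 8 * Cmod c * Cmod om / k) / n).
  assert (HK : 0 <= K).
  { unfold K. pose proof (Cmod_ge_0 c). pose proof (Cmod_ge_0 om).
    apply Rmult_le_pos; [|left; apply Rinv_0_lt_compat; lra].
    apply Rplus_le_le_0_compat; apply Rmult_le_pos; try (left; apply Rinv_0_lt_compat; auto); try lra.
    apply Rmult_le_pos; lra. }
  apply Rle_trans with (K * laplace a (n * k / 8)).
  2:{ rewrite Rmult_assoc. apply Rmult_le_compat_l; auto.
      apply (Rmult_le_reg_l (exp (- (a * ln 8)))); [apply exp_pos|].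
      rewrite <- Rmult_assoc, <- exp_plus, Rplus_opp_l, exp_0, Rmult_1_l.
      apply laplace_scaling; auto. }
  unfold laplace. rewrite <- (RInt_scal (V := R_CompleteNormedModule)) by (apply laplace_ex_RInt; auto).
  apply CI_norm.
  - intros q. apply ccont_minus; auto. apply ccont_RtoC; auto.
  - intros q. apply (continuous_mult (K := R_AbsRing)); [apply continuous_const|auto].
  - intros q _. change (scal K (exp (- (n * k / 8 * rho a q)))) with (K * exp (- (n * k / 8 * rho a q))).
    pose proof (rho_range a q Ha) as HR. set (r := rho a q) in *.
    pose proof (endpoint_phase_decay r HR) as H1.
    pose proof (endpoint_phase_quadratic r HR) as H2.
    set (P := (clog (1 - (1 - Cconj xi) * r) + xi * ((1 - Cconj xi) * r))%C) in *.
    replace (n * clog (1 - (1 - Cconj xi) * r) + (n * xi + om) * ((1 - Cconj xi) * r))%C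
      with (n * P + om * c * r)%C by (unfold P, c; ring).
    rewrite <- cexp_RtoC. pose proof k_pos as Hk.
    assert (HC : Cmod (om * c * r) <= Cmod om * Cmod c * r).
    { rewrite !Cmod_mult, Cmod_R, Rabs_right by lra. lra. }
    eapply Rle_trans; [apply (cexp_diff_le _ _ (- (n * k / 4 * r)))|].
    { rewrite re_plus, re_scal_l. pose proof (Re_le_Cmod (om * c * r)).
      assert (n * Re P <= - (n * k / 2 * r)) by nra.
      assert (Cmod om * Cmod c * r <= n * k / 4 * r) by (apply Rmult_le_compat_r; lra). lra. }
    { assert (0 <= n * k * r) by (apply Rmult_le_pos; [apply Rmult_le_pos|]; lra).
      simpl. lra. }
    assert (HD : Cmod (n * P + om * c * r - RtoC (- (n * k * r))) <=
       n * k * r ^ 2 + Cmod om * Cmod c * r).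
    { replace (n * P + om * c * r - RtoC (- (n * k * r)))%C
        with (n * (P + RtoC (k * r)) + om * c * r)%C by (rewrite !RtoC_opp, !RtoC_mult; ring).
      eapply Rle_trans; [apply Cmod_triangle|]. apply Rplus_le_compat; auto.
      rewrite Cmod_mult, Cmod_R, Rabs_right by lra. rewrite !Rmult_assoc.
      apply Rmult_le_compat_l; [lra|]. exact H2. }
    set (X := n * k / 8 * r).
    replace (- (n * k / 4 * r)) with (- X + - X) by (unfold X; field).
    rewrite exp_plus, <- Rmult_assoc. apply Rmult_le_compat_r; [left; apply exp_pos|].
    eapply Rle_trans; [apply Rmult_le_compat_r; [left; apply exp_pos|exact HD]|].
    assert (Hnk : 0 < n * k) by (apply Rmult_lt_0_compat; lra).
    assert (HX : 0 <= X) by (apply Rmult_le_pos; lra).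
    assert (Er : r = 8 * X / (n * k)) by (unfold X; field; split; lra).
    assert (HK' : n * k * r ^ 2 + Cmod om * Cmod c * r =
       / n * (64 / k * (X * X) + 8 * Cmod c * Cmod om / k * X)).
    { rewrite Er at 1 2. field. split; lra. }
    rewrite HK'. unfold K.
    assert (HX2 : X * X * exp (- X) <= 4).
    { rewrite exp_Ropp. apply (Rmult_le_reg_r (exp X)); [apply exp_pos|].
      rewrite Rmult_assoc, Rinv_l by (pose proof (exp_pos X); lra).
      pose proof (exp_ge_square X HX). lra. }
    assert (HX1 : X * exp (- X) <= 1).
    { rewrite exp_Ropp. apply (Rmult_le_reg_r (exp X)); [apply exp_pos|].
      rewrite Rmult_assoc, Rinv_l by (pose proof (exp_pos X); lra).
      pose proof (exp_ineq1_le X). lra. }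
    replace ((64 * 4 / k + 8 * Cmod c * Cmod om / k) / n)
      with (/ n * (64 * 4 / k + 8 * Cmod c * Cmod om / k)) by (unfold Rdiv; ring).
    rewrite Rmult_assoc.
    apply Rmult_le_compat_l; [left; apply Rinv_0_lt_compat; lra|].
    rewrite Rmult_plus_distr_r, (Rmult_assoc (64 / k)), (Rmult_assoc (8 * Cmod c * Cmod om / k)).
    assert (P1 : 0 <= 64 / k) by (left; apply Rdiv_lt_0_compat; lra).
    assert (P2 : 0 <= 8 * Cmod c * Cmod om / k).
    { pose proof (Cmod_ge_0 c). pose proof (Cmod_ge_0 om).
      apply Rmult_le_pos; [|left; apply Rinv_0_lt_compat; auto]. apply Rmult_le_pos; lra. }
    apply (Rmult_le_compat_l _ _ _ P1) in HX2. apply (Rmult_le_compat_l _ _ _ P2) in HX1.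
    unfold Rdiv in *. lra.
Qed.

End Endpoint.

(** * Contribution of the saddle point *)

(** [L0] comes from [e^x >= (1 + x / 2)^2 >= x^2 / 4] at [x = al * L]. It is applied with
    [L = ln n], to let a power of [n] dominate a logarithm. *)
Lemma linear_le_exp (K al : R) : 0 < al ->
  exists L0, 1 <= L0 /\ forall L, L0 <= L -> K * L <= exp (al * L).
Proof.
  intros Hal. exists (Rmax 1 (4 * K / (al * al))). split; [apply Rmax_l|]. intros L HL.
  pose proof (Rmax_l 1 (4 * K / (al * al))). pose proof (Rmax_r 1 (4 * K / (al * al))).
  replace (al * L) with (al * L / 2 + al * L / 2) by field. rewrite exp_plus.
  pose proof (exp_ineq1_le (al * L / 2)) as HE.
  assert (Haa : 0 < al * al) by nra.
  assert (HK : 4 * K <= al * al * L).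
  { assert (4 * K / (al * al) <= L) as H1 by lra.
    apply (Rmult_le_compat_l (al * al)) in H1; [|lra].
    replace (al * al * (4 * K / (al * al))) with (4 * K) in H1 by (field; lra). exact H1. }
  assert (HaL : 0 < al * L) by (apply Rmult_lt_0_compat; lra).
  apply Rle_trans with ((al * L / 2) * (al * L / 2)); [|apply Rmult_le_compat; lra].
  apply (Rmult_le_compat_r L) in HK; nra.
Qed.

Section Saddle.

Variables (lam : R).
Hypothesis (Hlam : 1 < lam).

(* The [n]-th power of [lam t e^(1 - lam t)], normalized to have maximum [1] at [t = 1/lam]. *)
Definition saddle_weight (lam n t : R) : R := rpw n (lam * t) * exp (n * (1 - lam * t)).

Let t0 := / lam.

Let t0_range : 0 < t0 < 1.
Proof.
  unfold t0. split; [apply Rinv_0_lt_compat; lra|]. rewrite <- Rinv_1.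
  apply Rinv_lt_contravar; lra.
Qed.

Lemma continuous_saddle_weight n t : 0 < n -> continuous (saddle_weight lam n) t.
Proof.
  intros Hn. apply (continuous_mult (K := R_AbsRing)).
  - apply (continuous_comp (fun t => lam * t) (rpw n)).
    + apply (@ex_derive_continuous _ R_NormedModule). auto_derive; auto.
    + apply continuous_rpw; auto.
  - apply (@ex_derive_continuous _ R_NormedModule). auto_derive; auto.
Qed.

Lemma saddle_weight_ge_0 n t : 0 <= saddle_weight lam n t.
Proof. apply Rmult_le_pos; [apply rpw_ge_0|left; apply exp_pos]. Qed.

(** The left side minus the right side has derivative [(x - 1) (1 / lam - 1 / x)], positive before
    [1] and negative between [1] and [lam], so its maximum is its value [0] at [1]. Validity on the
    whole range yields a Gaussian bound for the weight on all of (0,1]. *)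
Lemma ln_concave_bound (X : R) : 0 < X <= lam -> ln X - X + 1 <= - ((X - 1) ^ 2 / (2 * lam)).
Proof.
  intros HX.
  set (p := fun x => ln x - x + 1 + (x - 1) ^ 2 / (2 * lam)).
  set (p' := fun x => (x - 1) * (/ lam - / x)).
  assert (D : forall x, 0 < x -> is_derive p x (p' x)).
  { intros x Hx. unfold p, p'. auto_derive; [lra|]. field. lra. }
  assert (C : forall x, 0 < x -> continuous p x).
  { intros x Hx. apply (@ex_derive_continuous _ R_NormedModule). eexists; apply D; auto. }
  assert (H1 : p 1 = 0) by (unfold p; rewrite ln_1; field; lra).
  assert (Hp : p X <= p 1).
  { destruct (Rle_dec 1 X) as [H|H].
    - apply (nonincreasing_of_derive p p' 1 X); auto.
      + intros t Ht; apply D; lra.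
      + intros t Ht; apply C; lra.
      + intros t Ht. unfold p'. assert (/ lam <= / t) by (apply Rinv_le_contravar; lra). nra.
    - enough (- p 1 <= - p X) by lra.
      apply (nonincreasing_of_derive (fun x => - p x) (fun x => - p' x) X 1); try lra.
      + intros t Ht. apply (is_derive_opp (V := R_NormedModule)), D; lra.
      + intros t Ht. apply (continuous_opp (V := R_NormedModule)), C; lra.
      + intros t Ht. unfold p'. assert (/ lam <= / t) by (apply Rinv_le_contravar; lra). nra. }
  rewrite H1 in Hp. unfold p in Hp. lra.
Qed.

Lemma saddle_weight_decay n t : 0 < n -> 0 < t <= 1 ->
  saddle_weight lam n t <= exp (- (n * lam / 2 * (t - t0) ^ 2)).
Proof.
  intros Hn Ht. unfold saddle_weight. assert (HX : 0 < lam * t) by nra.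
  rewrite rpw_pos, <- exp_plus by auto. apply exp_le.
  pose proof (ln_concave_bound (lam * t) ltac:(nra)) as HL.
  apply (Rmult_le_compat_l n) in HL; [|lra].
  replace (- (n * lam / 2 * (t - t0) ^ 2)) with (n * (- ((lam * t - 1) ^ 2 / (2 * lam))))
    by (unfold t0; field; lra). lra.
Qed.

Definition saddle_mass (lam n : R) : R := RInt (saddle_weight lam n) 0 1.

Lemma saddle_mass_le_1 n : 0 < n -> saddle_mass lam n <= 1.
Proof.
  intros Hn. unfold saddle_mass.
  replace 1 with (RInt (fun _ => 1) 0 1) at 2 by (rewrite RInt_cst; bring).
  apply RInt_le; [lra|apply cont_ex_RInt; intros; apply continuous_saddle_weight; auto|
    apply cont_ex_RInt; intros; apply continuous_const|].
  intros t Ht. eapply Rle_trans; [apply saddle_weight_decay; lra|].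
  rewrite <- exp_0. apply exp_le. pose proof (pow2_ge_0 (t - t0)).
  assert (0 <= n * lam / 2) by nra. nra.
Qed.

(** The window [[t0, t0 + (1 - t0) / n]] is so short that the weight stays above a constant on it.
    The true order is [n^(-1/2)], but any power of [n] serves. *)
Lemma saddle_mass_lower n : 1 <= n ->
  (1 - t0) * exp (- lam ^ 2 * (1 - t0) ^ 2) * / n <= saddle_mass lam n.
Proof.
  intros Hn. pose proof t0_range as Ht0. set (eta := 1 - t0).
  assert (Heta : 0 < eta < 1) by (unfold eta; lra).
  assert (Hin : 0 < / n <= 1).
  { split; [apply Rinv_0_lt_compat; lra|]. rewrite <- Rinv_1. apply Rinv_le_contravar; lra. }
  assert (Cw : forall t, continuous (saddle_weight lam n) t)
    by (intros; apply continuous_saddle_weight; lra).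
  apply Rle_trans with (RInt (saddle_weight lam n) t0 (t0 + eta * / n)).
  2:{ apply RInt_le_subinterval; auto using saddle_weight_ge_0; try lra; unfold eta in *; nra. }
  replace (eta * exp (- lam ^ 2 * eta ^ 2) * / n)
    with (RInt (fun _ => exp (- lam ^ 2 * eta ^ 2)) t0 (t0 + eta * / n))
    by (rewrite RInt_cst; bring).
  apply RInt_le; [nra|apply cont_ex_RInt; intros; apply continuous_const|
    apply cont_ex_RInt; auto|].
  intros t Ht. unfold saddle_weight.
  assert (HX : 1 < lam * t).
  { replace 1 with (lam * t0) by (unfold t0; field; lra). apply Rmult_lt_compat_l; lra. }
  rewrite rpw_pos, <- exp_plus by lra. apply exp_le.
  assert (Hl : - (lam * t - 1) ^ 2 <= ln (lam * t) - lam * t + 1).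
  { assert (H1 : - ln (lam * t) <= / (lam * t) - 1).
    { rewrite <- ln_Rinv by lra. apply ln_le_sub_1, Rinv_0_lt_compat; lra. }
    assert (H2 : / (lam * t) = 1 - (lam * t - 1) + (lam * t - 1) ^ 2 * / (lam * t)) by (field; lra).
    assert (H3 : / (lam * t) <= 1) by (rewrite <- Rinv_1; apply Rinv_le_contravar; lra).
    pose proof (pow2_ge_0 (lam * t - 1)). nra. }
  assert (Hd : lam * t - 1 = lam * (t - t0)) by (unfold t0; field; lra).
  assert (Hs : (lam * t - 1) ^ 2 <= lam ^ 2 * eta ^ 2 * / n).
  { rewrite Hd, Rpow_mult_distr, Rmult_assoc. apply Rmult_le_compat_l; [apply pow2_ge_0|].
    assert ((t - t0) ^ 2 <= (eta * / n) ^ 2) by (apply pow_incr; lra).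
    assert (/ n * / n <= / n) by nra. pose proof (pow2_ge_0 eta).
    rewrite Rpow_mult_distr in H. simpl in *. nra. }
  assert (Hs' : n * (lam * t - 1) ^ 2 <= lam ^ 2 * eta ^ 2).
  { apply (Rmult_le_compat_l n) in Hs; [|lra].
    replace (n * (lam ^ 2 * eta ^ 2 * / n)) with (lam ^ 2 * eta ^ 2) in Hs by (field; lra). exact Hs. }
  apply (Rmult_le_compat_l n) in Hl; [|lra]. lra.
Qed.

(** The range is cut at [|t - t0| = n^(-1/4)]. Inside, the factors other than the weight change by
    [O(n^(-1/4) log n)], which costs at most [ep / 2] times the weight. Outside, the weight is at
    most [e^(- lam sqrt(n) / 2)], which beats the powers of [n] that [om = O(log n)] can produce. *)
Lemma saddle_contribution (Phi : R -> C) (w : C) (C2 K ep : R) :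
  (forall t, ccont Phi t) ->
  (forall t, 0 <= t <= 1 -> Cmod (Phi t - Phi t0) <= C2 * Rabs (t - t0)) ->
  0 <= C2 -> 0 < K -> 0 < ep ->
  exists L0, 1 <= L0 /\ forall n om, L0 <= ln n -> 0 < n -> Cmod om <= K * ln n ->
    Cmod (CI (fun t => Phi t * (saddle_weight lam n t * cexp (- om * w * RtoC (t - t0))))%C
          - Phi t0 * saddle_mass lam n) <= ep * saddle_mass lam n.
Proof.
  intros CPhi LPhi HC2 HK Hep. pose proof t0_range as Ht0.
  set (S := K * Cmod w). set (A1 := C2 + Cmod (Phi t0) * S).
  assert (HS : 0 <= S) by (apply Rmult_le_pos; [lra|apply Cmod_ge_0]).
  assert (HA1 : 0 <= A1).
  { apply Rplus_le_le_0_compat; auto. apply Rmult_le_pos; [apply Cmod_ge_0|auto]. }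
  set (m0 := ep / 2 * ((1 - t0) * exp (- lam ^ 2 * (1 - t0) ^ 2))).
  assert (Hm0 : 0 < m0).
  { apply Rmult_lt_0_compat; [lra|]. apply Rmult_lt_0_compat; [lra|apply exp_pos]. }
  (* With [L = ln n] the three thresholds give [6 A1 L / ep <= n^(1/4)] and [S L <= n^(1/4)] for the
     inner range, and an exponent linear in [L] dominated by [sqrt(n)] for the outer one. *)
  destruct (linear_le_exp (6 * A1 / ep) (1 / 4) ltac:(lra)) as [L1 [HL1 B1]].
  destruct (linear_le_exp S (1 / 4) ltac:(lra)) as [L2 [HL2 B2]].
  destruct (linear_le_exp (2 * (A1 + S + 1 + Rabs (ln m0))) (1 / 2) ltac:(lra)) as [L3 [HL3 B3]].
  exists (Rmax L1 (Rmax L2 L3)). split; [eapply Rle_trans; [exact HL1|apply Rmax_l]|].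
  intros n om HL Hn0 Hom. set (L := ln n) in *.
  assert (L1 <= L) by (eapply Rle_trans; [apply Rmax_l|exact HL]).
  assert (L2 <= L) by (eapply Rle_trans; [apply Rmax_l|eapply Rle_trans; [apply Rmax_r|exact HL]]).
  assert (L3 <= L) by (eapply Rle_trans; [apply Rmax_r|eapply Rle_trans; [apply Rmax_r|exact HL]]).
  specialize (B1 L ltac:(auto)). specialize (B2 L ltac:(auto)). specialize (B3 L ltac:(auto)).
  assert (En : n = exp L) by (unfold L; rewrite exp_ln; auto).
  assert (Hn : 1 <= n).
  { rewrite En, <- exp_0. apply exp_le. lra. }
  set (d := exp (- (1 / 4 * L))).
  assert (Hd : 0 < d) by apply exp_pos.
  assert (Hdi : d * exp (1 / 4 * L) = 1).
  { unfold d. rewrite <- exp_plus, Rplus_opp_l. apply exp_0. }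
  set (s := Cmod om * Cmod w).
  assert (Hs0 : 0 <= s) by (apply Rmult_le_pos; apply Cmod_ge_0).
  assert (Hs : s <= S * L).
  { unfold s, S. replace (K * Cmod w * L) with (K * L * Cmod w) by ring.
    apply Rmult_le_compat_r; [apply Cmod_ge_0|auto]. }
  set (A := C2 + Cmod (Phi t0) * s).
  assert (HA0 : 0 <= A).
  { apply Rplus_le_le_0_compat; auto. apply Rmult_le_pos; [apply Cmod_ge_0|auto]. }
  assert (HA : A <= A1 * L).
  { unfold A, A1. pose proof (Cmod_ge_0 (Phi t0)).
    apply (Rmult_le_compat_l (Cmod (Phi t0))) in Hs; auto. nra. }
  (* This is [m0 / n], at most [ep / 2] times the mass by [saddle_mass_lower]; it will bound the
     integrand outside the cut. *)
  set (T := exp (- (ln m0 * -1) - L)).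
  assert (HT : A * (exp s * exp (- (n * lam / 2 * d ^ 2))) <= T).
  { assert (A <= exp A) by (generalize (exp_ineq1_le A); lra).
    apply Rle_trans with (exp A * (exp s * exp (- (n * lam / 2 * d ^ 2)))).
    { apply Rmult_le_compat_r; auto. left; apply Rmult_lt_0_compat; apply exp_pos. }
    rewrite <- !exp_plus. apply exp_le.
    assert (E : n * d ^ 2 = exp (1 / 2 * L)).
    { rewrite En. unfold d. simpl. rewrite Rmult_1_r, <- !exp_plus. f_equal. field. }
    assert (exp (1 / 2 * L) <= lam * exp (1 / 2 * L)) by (generalize (exp_pos (1 / 2 * L)); nra).
    replace (n * lam / 2 * d ^ 2) with (lam * exp (1 / 2 * L) / 2) by (rewrite <- E; field).
    pose proof (Rle_abs (- ln m0)) as HM. rewrite Rabs_Ropp in HM.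
    pose proof (Rabs_pos (ln m0)).
    assert (Rabs (ln m0) <= Rabs (ln m0) * L) by nra.
    lra. }
  assert (HTm : T <= ep / 2 * saddle_mass lam n).
  { unfold T. replace (- (ln m0 * -1) - L) with (ln m0 + - L) by ring.
    rewrite exp_plus, exp_ln, exp_Ropp, <- En by auto.
    pose proof (saddle_mass_lower n Hn) as HM. unfold m0.
    apply (Rmult_le_compat_l (ep / 2)) in HM; [|lra]. lra. }
  assert (HsL : s * d <= 1).
  { rewrite <- Hdi, (Rmult_comm d). apply Rmult_le_compat_r; lra. }
  assert (HAd : A * d * 3 <= ep / 2).
  { assert (A * 6 <= ep * exp (1 / 4 * L)).
    { apply (Rmult_le_compat_l ep) in B1; [|lra].
      replace (ep * (6 * A1 / ep * L)) with (6 * (A1 * L)) in B1 by (field; lra). lra. }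
    apply (Rmult_le_compat_r d) in H2; [|lra].
    replace (ep * exp (1 / 4 * L) * d) with ep in H2 by (rewrite Rmult_assoc, (Rmult_comm _ d), Hdi; ring).
    lra. }
  assert (Cw : forall t, continuous (saddle_weight lam n) t)
    by (intros; apply continuous_saddle_weight; lra).
  assert (Cl : forall t, ccont (fun t => RtoC (t - t0)) t).
  { intros t. apply ccont_RtoC, (continuous_minus (V := R_NormedModule));
      [apply continuous_id|apply continuous_const]. }
  assert (CF : forall t, ccont (fun t => Phi t * (saddle_weight lam n t *
      cexp (- om * w * RtoC (t - t0))))%C t).
  { intros t. apply ccont_mult; auto. apply ccont_mult; [apply ccont_RtoC; auto|].
    apply ccont_cexp, ccont_mult; [apply ccont_const|auto]. }
  assert (CM : forall t, ccont (fun t => Phi t0 * RtoC (saddle_weight lam n t))%C t).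
  { intros t. apply ccont_mult; [apply ccont_const|apply ccont_RtoC; auto]. }
  unfold saddle_mass at 1. rewrite <- CI_RtoC.
  rewrite <- (CI_scal (Phi t0)), <- CI_minus; auto; [|intros; apply ccont_RtoC; auto].
  apply Rle_trans with (RInt (fun t => ep / 2 * saddle_weight lam n t + T) 0 1).
  - apply CI_norm.
    + intros t. apply ccont_minus; auto.
    + intros t. apply (continuous_plus (V := R_NormedModule)); [|apply continuous_const].
      apply (continuous_mult (K := R_AbsRing)); [apply continuous_const|auto].
    + intros t Ht. pose proof (saddle_weight_ge_0 n t) as Hw0.
      set (W := saddle_weight lam n t) in *. set (e := cexp (- om * w * RtoC (t - t0))).
      replace (Phi t * (W * e) - Phi t0 * W)%C with (W * ((Phi t - Phi t0) * e + Phi t0 * (e - 1)))%C by ring.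
      rewrite Cmod_mult, Cmod_R, Rabs_right by lra.
      set (dl := Rabs (t - t0)).
      assert (Hdl : 0 <= dl <= 1).
      { split; [apply Rabs_pos|]. unfold dl. apply Rabs_le. lra. }
      assert (Hv : Cmod (- om * w * RtoC (t - t0)) = s * dl).
      { rewrite !Cmod_mult, Cmod_opp, Cmod_R. reflexivity. }
      assert (He : Cmod e <= exp (s * dl)).
      { unfold e. rewrite Cmod_cexp, <- Hv. apply exp_le, Re_le_Cmod. }
      assert (He1 : Cmod (e - 1) <= s * dl * exp (s * dl)).
      { unfold e. rewrite <- cexp_0. eapply Rle_trans; [apply (cexp_diff_le _ _ (s * dl))|].
        - rewrite <- Hv. apply Re_le_Cmod.
        - simpl. nra.
        - replace (- om * w * RtoC (t - t0) - 0)%C with (- om * w * RtoC (t - t0))%C by ring.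
          rewrite Hv. lra. }
      assert (HB : Cmod ((Phi t - Phi t0) * e + Phi t0 * (e - 1)) <= A * dl * exp (s * dl)).
      { eapply Rle_trans; [apply Cmod_triangle|]. rewrite !Cmod_mult.
        replace (A * dl * exp (s * dl)) with
          (C2 * dl * exp (s * dl) + Cmod (Phi t0) * (s * dl * exp (s * dl))) by (unfold A; ring).
        apply Rplus_le_compat.
        - apply Rmult_le_compat; try apply Cmod_ge_0; auto. apply LPhi; lra.
        - apply Rmult_le_compat_l; [apply Cmod_ge_0|auto]. }
      assert (HT0 : 0 < T) by apply exp_pos.
      destruct (Rle_dec dl d) as [Hle|Hgt].
      * assert (HE3 : exp (s * dl) <= 3).
        { eapply Rle_trans; [|apply exp_le_3]. apply exp_le.
          apply Rle_trans with (s * d); auto. apply Rmult_le_compat_l; auto. }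
        assert (A * dl * exp (s * dl) <= A * d * 3).
        { pose proof (exp_pos (s * dl)). apply Rmult_le_compat; try lra.
          - apply Rmult_le_pos; lra.
          - apply Rmult_le_compat_l; auto. }
        apply Rle_trans with (W * (ep / 2)); [|lra]. apply Rmult_le_compat_l; lra.
      * assert (HW : W <= exp (- (n * lam / 2 * d ^ 2))).
        { eapply Rle_trans; [apply saddle_weight_decay; lra|]. apply exp_le.
          assert (d ^ 2 <= (t - t0) ^ 2).
          { rewrite <- (pow2_abs (t - t0)). apply pow_incr. fold dl. lra. }
          assert (0 <= n * lam / 2) by nra. nra. }
        assert (HE : A * dl * exp (s * dl) <= A * exp s).
        { pose proof (exp_pos (s * dl)). apply Rmult_le_compat; try lra.
          - apply Rmult_le_pos; lra.
          - rewrite <- (Rmult_1_r A) at 2. apply Rmult_le_compat_l; lra.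
          - apply exp_le. nra. }
        assert (0 <= ep / 2 * W) by (apply Rmult_le_pos; lra).
        apply Rle_trans with (exp (- (n * lam / 2 * d ^ 2)) * (A * exp s)).
        -- apply Rmult_le_compat; auto; [apply Cmod_ge_0|lra].
        -- lra.
  - rewrite (RInt_plus (V := R_CompleteNormedModule)), (RInt_scal (V := R_CompleteNormedModule)), RInt_cst.
    + unfold plus, scal; simpl; unfold mult; simpl. fold (saddle_mass lam n). lra.
    + apply cont_ex_RInt; auto.
    + apply (ex_RInt_scal (V := R_CompleteNormedModule)), cont_ex_RInt; auto.
    + apply cont_ex_RInt; intros; apply continuous_const.
Qed.

End Saddle.

(** * Zeros near the curve *)

Lemma continuous_bounded_above (g : R -> R) :
  (forall t, continuous g t) -> exists M, forall t, 0 <= t <= 1 -> g t <= M.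
Proof.
  intros Hg. destruct (continuity_ab_maj g 0 1) as [x [Hx _]]; [lra| |].
  - intros; apply continuity_pt_cont; auto.
  - exists (g x). exact Hx.
Qed.

(** The first order remainder gives [|1 - e^v| >= |v| - |v|^2], whose minimum on [[1/4, 1/2]] is
    [3/16]. *)
Lemma Cmod_1_minus_cexp (v : C) : 1 / 4 <= Cmod v <= 1 / 2 -> 3 / 16 <= Cmod (1 - cexp v).
Proof.
  intros Hv. pose proof (cexp_remainder v 1) as H.
  assert (He : exp (Cmod v) <= 2).
  { apply Rle_trans with (exp (1 / 2)); [apply exp_le; lra|].
    pose proof exp_le_3 as H3. replace 1 with (1 / 2 + 1 / 2) in H3 by field.
    rewrite exp_plus in H3. pose proof (exp_pos (1 / 2)). nra. }
  replace (cexp_sum v 1) with (1 + v)%C in H by (simpl; rewrite Rinv_1; ring).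
  assert (H2 : Cmod (cexp v - (1 + v)) <= Cmod v ^ 2).
  { eapply Rle_trans; [exact H|]. simpl. replace (1 + 1) with 2 by ring.
    assert (0 <= Cmod v * (Cmod v * 1) / 2) by nra. nra. }
  pose proof (Cmod_minus_triangle v (- (cexp v - (1 + v)))%C) as H3.
  replace (v - - (cexp v - (1 + v)))%C with (- (1 - cexp v))%C in H3 by ring.
  rewrite !Cmod_opp in H3. nra.
Qed.

Section Zeros.

Variables (a : R) (xi : C).
Hypotheses (Ha : 0 < a) (Hxi : S_plus xi) (Hy : Im xi <> 0).

Let w : C := Cconj xi.
Let lam : R := Re xi ^ 2 + Im xi ^ 2.
Let t0 : R := / lam.
(** Since [t0 * conj xi = 1 / xi], this is the value of [1 - v] at the saddle. *)
Let kap : C := (1 - t0 * w)%C.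
Let k : R := Cmod (1 - xi) ^ 2.

Let Hx : 1 <= Re xi.
Proof. exact (proj1 Hxi). Qed.

Let lam_gt_1 : 1 < lam.
Proof. unfold lam. assert (0 < Im xi ^ 2) by (apply pow2_gt_0; auto). nra. Qed.

Let t0_range : 0 < t0 < 1.
Proof.
  pose proof lam_gt_1. unfold t0. split; [apply Rinv_0_lt_compat; lra|]. rewrite <- Rinv_1.
  apply Rinv_lt_contravar; lra.
Qed.

Let Im_w : Im w <> 0.
Proof. unfold w. rewrite im_conj. lra. Qed.

Let Re_w : 0 < Re w.
Proof. unfold w. rewrite re_conj. lra. Qed.

Let w_neq_0 : w <> 0.
Proof. intros E. apply Im_w. rewrite E. reflexivity. Qed.

Let kap_neq_0 : kap <> 0.
Proof. apply segment_neq_0; auto. Qed.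

Let k_pos : 0 < k.
Proof.
  apply pow_lt, Cmod_gt_0. intros E. apply Hy. apply (f_equal Im) in E. simpl in E.
  unfold Im in *. lra.
Qed.

Let xi_w : (xi * w)%C = lam.
Proof. unfold w, lam. apply C_ext; simpl; unfold Re, Im; ring. Qed.

(** As [xi * w = lam] is real, the large part of the phase on [v = t w] is [n (ln t - lam t)] up to
    constants. These are collected in front so that the weight has maximum [1] and the last
    exponential equals [1] at [t0]. *)
Let saddle_integrand (n t : R) (om : C) : 0 < t ->
  (RtoC (rpw n t) * cexp ((n * xi + om) * (1 - t * w)))%C =
  (cexp (n * xi - n * (ln lam + 1) + om * kap) *
    (saddle_weight lam n t * cexp (- om * w * RtoC (t - t0))))%C.
Proof.
  intros Ht. pose proof lam_gt_1 as Hlam. unfold saddle_weight.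
  rewrite !rpw_pos, ln_mult by nra.
  rewrite <- exp_plus, <- !cexp_RtoC, <- !cexp_plus. f_equal.
  replace ((n * xi + om) * (1 - t * w))%C with (n * xi - n * t * (xi * w) + om * (1 - t * w))%C by ring.
  rewrite xi_w. unfold kap.
  rewrite !RtoC_plus, !RtoC_mult, !RtoC_plus, !RtoC_minus, !RtoC_mult. ring.
Qed.

Variable chi : R -> C.
Hypotheses (chi_0 : chi 0 = 1) (chi_neq_0 : forall t, chi t <> 0).
Hypothesis chi_deriv : forall t, cderiv chi t (- (a * w * chi t / (1 - t * w)))%C.

(** The branch of [(1 - t w)^(a - 1)] determined by [chi]. *)
Let Phi (t : R) : C := (chi t / (1 - t * w))%C.

Let Phi_deriv t : cderiv Phi t ((1 - a) * w * chi t / ((1 - t * w) * (1 - t * w)))%C.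
Proof.
  pose proof (segment_neq_0 w t Im_w).
  eapply cderiv_ext_val; [|apply cderiv_mult; [apply chi_deriv|
    apply cderiv_inv; [exact H|apply cderiv_segment]]].
  cbv beta. field. auto.
Qed.

Let Phi_cont t : ccont Phi t.
Proof. eapply cderiv_cont, Phi_deriv. Qed.

Let Phi_lipschitz :
  exists C2, 0 <= C2 /\ forall t, 0 <= t <= 1 -> Cmod (Phi t - Phi t0) <= C2 * Rabs (t - t0).
Proof.
  set (D := fun t : R => ((1 - a) * w * chi t / ((1 - t * w) * (1 - t * w)))%C).
  destruct (continuous_bounded_above (fun t => Cmod (D t))) as [M HM].
  { intros t. apply continuous_Cmod. unfold D. apply ccont_mult.
    - apply ccont_mult; [apply ccont_const|]. eapply cderiv_cont, chi_deriv.
    - pose proof (segment_neq_0 w t Im_w).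
      apply ccont_inv; [apply Cmult_neq_0; auto|].
      apply ccont_mult; eapply cderiv_cont, cderiv_segment. }
  exists M. split; [eapply Rle_trans; [apply Cmod_ge_0|apply (HM 0); lra]|].
  intros t Ht. apply (mean_value_const_abs Phi D M 0 1); auto. lra.
Qed.

Let Phi_neq_0 : Phi t0 <> 0.
Proof.
  apply Cmult_neq_0; auto. intros E.
  pose proof (segment_neq_0 w t0 Im_w) as H.
  apply (f_equal (Cmult (1 - t0 * w))) in E. rewrite Cinv_r, Cmult_0_r in E by auto.
  apply C1_nz; auto.
Qed.

(** Quotient of the main terms of the saddle and the endpoint contributions at [om = 0]. *)
Let ratio (n : R) : C :=
  (a * w * cexp (n * clog w + (n * xi - n * (ln lam + 1))) * Phi t0 * saddle_mass lam n
     / (chi 1%R * laplace a (n * k)))%C.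

Let laplace_pos n : 1 <= n -> 0 < laplace a (n * k).
Proof. intros Hn. eapply Rlt_le_trans; [apply exp_pos|apply laplace_lower; auto]. Qed.

Let saddle_mass_pos n : 1 <= n -> 0 < saddle_mass lam n.
Proof.
  intros Hn. eapply Rlt_le_trans; [|apply saddle_mass_lower; auto].
  pose proof t0_range. fold t0. apply Rmult_lt_0_compat; [|apply Rinv_0_lt_compat; lra].
  apply Rmult_lt_0_compat; [lra|apply exp_pos].
Qed.

(** [e1] and [e2] are the relative errors themselves, at the endpoint and at the saddle. The last
    two thresholds ensure [|om| |1 - conj xi| <= n k / 4], as the endpoint estimate requires, and
    push its error, of order [ln n / n], below [eta]. *)
Let expint_asymptotics (K eta : R) : 0 < K -> 0 < eta ->
  exists L0, 1 <= L0 /\ forall n om, L0 <= ln n -> 2 <= n -> Cmod om <= K * ln n ->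
   exists e1 e2, Cmod e1 <= eta /\ Cmod e2 <= eta /\
     expint a (fun q => RtoC (beta_weight a n q)) (n * xi + om) =
     (chi 1%R * laplace a (n * k) * ((1 + e1) + ratio n * cexp (om * kap) * (1 + e2)))%C.
Proof.
  intros HK Heta. destruct Phi_lipschitz as [C2 [HC2 HPhi]].
  pose proof (proj1 (Cmod_gt_0 _) Phi_neq_0) as HP0.
  set (c := Cmod (1 - Cconj xi)). assert (Hc : 0 <= c) by apply Cmod_ge_0.
  destruct (saddle_contribution lam lam_gt_1 Phi w C2 K (eta * Cmod (Phi t0)))
    as [L1 [HL1 B1]]; auto; [nra|].
  destruct (linear_le_exp (4 * K * c / k) 1 ltac:(lra)) as [L2 [HL2 B2]].
  destruct (linear_le_exp ((64 * 4 / k + 8 * c * K / k) * exp (a * ln 8) / eta) 1 ltac:(lra))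
    as [L3 [HL3 B3]].
  exists (Rmax L1 (Rmax L2 L3)). split; [eapply Rle_trans; [exact HL1|apply Rmax_l]|].
  intros n om HL Hn Hom.
  assert (H1 : L1 <= ln n) by (eapply Rle_trans; [apply Rmax_l|exact HL]).
  assert (H2 : L2 <= ln n) by (eapply Rle_trans; [apply Rmax_l|eapply Rle_trans; [apply Rmax_r|exact HL]]).
  assert (H3 : L3 <= ln n) by (eapply Rle_trans; [apply Rmax_r|eapply Rle_trans; [apply Rmax_r|exact HL]]).
  specialize (B1 n om H1 ltac:(lra) Hom). specialize (B2 _ H2). specialize (B3 _ H3).
  rewrite Rmult_1_l, exp_ln in B2, B3 by lra.
  pose proof k_pos as Hk. pose proof (laplace_pos n ltac:(lra)) as HG.
  pose proof (saddle_mass_pos n ltac:(lra)) as Hm.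
  pose proof (Cmod_ge_0 om) as Hom0.
  pose proof (endpoint_contribution a xi Ha Hx Hy n om ltac:(lra)) as HE.
  fold c k in HE.
  set (E := CI (fun q => cexp (n * clog (1 - (1 - Cconj xi) * rho a q) +
          (n * xi + om) * ((1 - Cconj xi) * rho a q)))) in *.
  set (D := CI (fun t => Phi t * (saddle_weight lam n t * cexp (- om * w * RtoC (t - t0))))%C).
  fold t0 in B1. fold D in B1.
  assert (HG0 : RtoC (laplace a (n * k)) <> 0) by (intros X; apply RtoC_inj in X; lra).
  assert (Hm0 : RtoC (saddle_mass lam n) <> 0) by (intros X; apply RtoC_inj in X; lra).
  exists ((E - laplace a (n * k)) / laplace a (n * k))%C,
    ((D - Phi t0 * saddle_mass lam n) / (Phi t0 * saddle_mass lam n))%C.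
  split; [|split].
  - rewrite Cmod_div, Cmod_R, Rabs_right by (auto; lra).
    apply (Rmult_le_reg_r (laplace a (n * k))); auto. unfold Rdiv at 1.
    rewrite Rmult_assoc, Rinv_l, Rmult_1_r by lra.
    eapply Rle_trans; [apply HE|].
    + apply (Rmult_le_compat_r c) in Hom; auto.
      apply (Rmult_le_compat_l (k / 4)) in B2; [|lra].
      replace (k / 4 * (4 * K * c / k * ln n)) with (K * ln n * c) in B2 by (field; lra). lra.
    + apply Rmult_le_compat_r; [lra|].
      apply (Rmult_le_compat_l eta) in B3; [|lra].
      replace (eta * ((64 * 4 / k + 8 * c * K / k) * exp (a * ln 8) / eta * ln n))
        with ((64 * 4 / k * ln n + 8 * c / k * (K * ln n)) * exp (a * ln 8)) in B3 by (field; lra).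
      apply (Rmult_le_reg_l n); [lra|].
      replace (n * ((64 * 4 / k + 8 * c * Cmod om / k) / n * exp (a * ln 8)))
        with ((64 * 4 / k * 1 + 8 * c / k * Cmod om) * exp (a * ln 8)) by (field; lra).
      rewrite (Rmult_comm n). eapply Rle_trans; [|exact B3].
      apply Rmult_le_compat_r; [left; apply exp_pos|].
      assert (0 < / k) by (apply Rinv_0_lt_compat; auto).
      apply Rplus_le_compat; apply Rmult_le_compat_l; auto; try lra.
      unfold Rdiv. nra.
  - rewrite Cmod_div by (apply Cmult_neq_0; auto).
    rewrite Cmod_mult, Cmod_R, Rabs_right by lra.
    assert (HPm : 0 < Cmod (Phi t0) * saddle_mass lam n) by (apply Rmult_lt_0_compat; auto).
    apply (Rmult_le_reg_r (Cmod (Phi t0) * saddle_mass lam n)); auto. unfold Rdiv.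
    rewrite Rmult_assoc, Rinv_l, Rmult_1_r by lra. lra.
  - rewrite (contour_deformation a n (n * xi + om) w Ha Hn Re_w Im_w chi chi_0 chi_deriv).
    unfold w at 1 2. fold E.
    assert (HJ : CI (fun t => chi t / (1 - t * w) * (RtoC (rpw n t) *
        cexp ((n * xi + om) * (1 - t * w))))%C =
      (cexp (n * xi - n * (ln lam + 1) + om * kap) * D)%C).
    { unfold D. rewrite <- CI_scal.
      - apply CI_ext. intros t Ht. rewrite saddle_integrand by lra. unfold Phi. ring.
      - intros t. apply ccont_mult; [apply Phi_cont|]. apply ccont_mult.
        + apply ccont_RtoC, continuous_saddle_weight; auto. lra.
        + apply ccont_cexp, ccont_mult; [apply ccont_const|]. apply ccont_RtoC.
          apply (continuous_minus (V := R_NormedModule)); [apply continuous_id|apply continuous_const]. }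
    rewrite HJ. unfold ratio. rewrite !cexp_plus. field. repeat split; auto.
Qed.

(** The equation of the curve enters here: the real part of the exponent in [ratio] is
    [n (Re xi - 1 - ln lam / 2) = 0], so no exponential factor survives and only a quotient of
    integrals of polynomial size is left. *)
Let Cmod_ratio n : 1 <= n ->
  Cmod (ratio n) = a * Cmod w * Cmod (Phi t0) / Cmod (chi 1) * (saddle_mass lam n / laplace a (n * k)).
Proof.
  intros Hn. pose proof (laplace_pos n Hn) as HG. pose proof (saddle_mass_pos n Hn) as Hm.
  assert (HG0 : RtoC (laplace a (n * k)) <> 0) by (intros X; apply RtoC_inj in X; lra).
  unfold ratio. rewrite Cmod_div by (apply Cmult_neq_0; auto).
  rewrite !Cmod_mult, Cmod_cexp, !Cmod_R, !Rabs_right by lra.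
  replace (Re (n * clog w + (n * xi - n * (ln lam + 1)))) with 0.
  - rewrite exp_0. field. split; [lra|]. pose proof (proj1 (Cmod_gt_0 _) (chi_neq_0 1)). lra.
  - unfold Cminus. rewrite !re_plus, re_opp.
    replace (n * (ln lam + 1))%C with (RtoC (n * (ln lam + 1))) by (rewrite RtoC_mult, RtoC_plus; reflexivity).
    rewrite !re_scal_l, re_RtoC.
    change (Re (clog w)) with (/ 2 * ln (Re w ^ 2 + Im w ^ 2)).
    assert (E : Re w ^ 2 + Im w ^ 2 = lam) by (unfold w, lam; rewrite re_conj, im_conj; ring).
    rewrite E. pose proof (proj2 Hxi) as HS. fold lam in HS.
    assert (Re xi = 1 + / 2 * ln lam) by lra. rewrite H. field.
Qed.

Let ratio_neq_0 n : 1 <= n -> ratio n <> 0.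
Proof.
  intros Hn. apply Cmod_gt_0. rewrite Cmod_ratio by auto.
  pose proof (proj1 (Cmod_gt_0 _) (chi_neq_0 1)). pose proof (proj1 (Cmod_gt_0 _) w_neq_0).
  pose proof (proj1 (Cmod_gt_0 _) Phi_neq_0). pose proof (laplace_pos n Hn).
  pose proof (saddle_mass_pos n Hn).
  apply Rmult_lt_0_compat; apply Rdiv_lt_0_compat; auto.
  apply Rmult_lt_0_compat; [apply Rmult_lt_0_compat|]; auto.
Qed.

Let log_ratio_bound : exists K, 0 <= K /\
  forall n, 1 <= ln n -> 1 <= n -> Rabs (ln (Cmod (ratio n))) <= K * ln n.
Proof.
  pose proof (proj1 (Cmod_gt_0 _) (chi_neq_0 1)) as P1. pose proof (proj1 (Cmod_gt_0 _) w_neq_0) as P2.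
  pose proof (proj1 (Cmod_gt_0 _) Phi_neq_0) as P3. pose proof t0_range as Ht0. pose proof k_pos as Hk.
  set (C0 := a * Cmod w * Cmod (Phi t0) / Cmod (chi 1)).
  assert (HC0 : 0 < C0).
  { apply Rdiv_lt_0_compat; auto. apply Rmult_lt_0_compat; [apply Rmult_lt_0_compat|]; auto. }
  set (m1 := (1 - t0) * exp (- lam ^ 2 * (1 - t0) ^ 2)).
  assert (Hm1 : 0 < m1) by (apply Rmult_lt_0_compat; [lra|apply exp_pos]).
  exists (Rabs (ln C0) + Rabs (ln m1) + k + 1 + a).
  pose proof (Rabs_pos (ln C0)). pose proof (Rabs_pos (ln m1)).
  split; [lra|]. intros n HL Hn.
  pose proof (laplace_pos n Hn) as HG. pose proof (saddle_mass_pos n Hn) as Hm.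
  rewrite Cmod_ratio by auto. fold C0.
  rewrite ln_mult, ln_div by (auto; apply Rdiv_lt_0_compat; auto).
  assert (G1 : ln (laplace a (n * k)) <= 0).
  { rewrite <- ln_1. destruct (laplace_le_1 a (n * k) Ha ltac:(nra)) as [X| ->]; [|lra].
    left; apply ln_increasing; auto. }
  assert (G2 : - k - a * ln n <= ln (laplace a (n * k))).
  { rewrite <- (ln_exp (- k - a * ln n)).
    destruct (laplace_lower a n k Ha Hn Hk) as [X| ->]; [|lra].
    left; apply ln_increasing; auto. apply exp_pos. }
  assert (M1 : ln (saddle_mass lam n) <= 0).
  { rewrite <- ln_1. destruct (saddle_mass_le_1 lam lam_gt_1 n ltac:(lra)) as [X| ->]; [|lra].
    left; apply ln_increasing; auto. }
  assert (M2 : ln m1 - ln n <= ln (saddle_mass lam n)).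
  { rewrite <- ln_div by lra.
    destruct (saddle_mass_lower lam lam_gt_1 n Hn) as [X|X]; fold t0 in X; fold m1 in X.
    - left; apply ln_increasing; auto. apply Rdiv_lt_0_compat; lra.
    - right. f_equal. exact X. }
  pose proof (Rle_abs (ln C0)). pose proof (Rle_abs (- ln C0)). rewrite Rabs_Ropp in H2.
  pose proof (Rle_abs (- ln m1)). rewrite Rabs_Ropp in H3.
  assert (Rabs (ln C0) <= Rabs (ln C0) * ln n) by nra.
  assert (Rabs (ln m1) <= Rabs (ln m1) * ln n) by nra.
  assert (k <= k * ln n) by nra. assert (0 <= a * ln n) by nra.
  apply Rabs_le. nra.
Qed.

Lemma zeros_near_with_branch (ep : R) : 0 < ep ->
  exists B, 0 < B /\ forall b, B < b ->
    exists z, hyp1F1_eq a b z 0 /\ Cmod (z / b - xi) < ep.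
Proof.
  intros Hep. destruct log_ratio_bound as [K1 [HK1 HR]].
  pose proof (proj1 (Cmod_gt_0 _) kap_neq_0) as Hkap.
  (* On the boundary of the square of half-side [r] one has [r <= |t| <= 2 r], that is
     [1/4 <= |t kap| <= 1/2], the range of [Cmod_1_minus_cexp]. *)
  set (r := / (4 * Cmod kap)). assert (Hr : 0 < r) by (apply Rinv_0_lt_compat; lra).
  (* The logarithm [u] of [- 1 / ratio n] has real part at most [K1 L] and imaginary part at most
     [8] in absolute value, and [L >= 1]; the term [2 r] accounts for the square around
     [om = u / kap]. *)
  set (K := (K1 + 8) / Cmod kap + 2 * r).
  assert (HK0 : 0 <= (K1 + 8) / Cmod kap) by (left; apply Rdiv_lt_0_compat; lra).
  assert (HK : 0 < K) by (unfold K; lra).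
  (* With [1/32] the bracket is at most [2/32] at the centre, while on the boundary it is at least
     [3/16 - 3/32 = 3/32]; there [|e^(t kap)| <= 2] doubles the second error. *)
  destruct (expint_asymptotics K (1 / 32) HK ltac:(lra)) as [L1 [HL1 B1]].
  (* Makes [|om + t - (a + 1) xi|] at most [ep n / 2]; the term [(a + 1) xi] is the price of
     dividing by [b] instead of [n]. *)
  destruct (linear_le_exp (2 * (K + (a + 1) * Cmod xi) / ep) 1 ltac:(lra)) as [L2 [HL2 B2]].
  set (L0 := Rmax L1 L2).
  assert (HL0 : L1 <= L0 /\ L2 <= L0) by (split; [apply Rmax_l|apply Rmax_r]).
  exists (exp L0 + a + 1). pose proof (exp_pos L0).
  split; [lra|]. intros b Hb. set (n := b - a - 1).
  assert (HnL : exp L0 < n) by (unfold n; lra).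
  assert (Hn : 2 <= n). { pose proof (exp_ineq1_le L0). lra. }
  assert (HL : L0 < ln n) by (rewrite <- (ln_exp L0); apply ln_increasing; auto).
  set (L := ln n) in *.
  specialize (B2 L ltac:(lra)). unfold L in B2 at 2. rewrite Rmult_1_l, exp_ln in B2 by lra.
  specialize (HR n ltac:(fold L; lra) ltac:(lra)). fold L in HR.
  pose proof (ratio_neq_0 n ltac:(lra)) as Hrat.
  destruct (cexp_surj (- / ratio n)%C) as [u [Hu [Hu1 Hu2]]].
  { intros E. apply C1_nz. transitivity (- (ratio n * - / ratio n))%C; [field; auto|].
    rewrite E. ring. }
  rewrite Cmod_opp, Cmod_inv, ln_Rinv in Hu1 by (auto; apply Cmod_gt_0; auto).
  assert (HuL : Cmod u <= (K1 + 8) * L).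
  { eapply Rle_trans; [apply Cmod_le_Re_Im|]. rewrite Hu1, Rabs_Ropp. nra. }
  set (om := (u / kap)%C).
  assert (Hom : Cmod om <= (K1 + 8) / Cmod kap * L).
  { unfold om. rewrite Cmod_div by auto. unfold Rdiv. apply (Rmult_le_compat_r (/ Cmod kap)) in HuL.
    - lra.
    - left; apply Rinv_0_lt_compat; auto. }
  assert (Homt : forall t, Cmod t <= 2 * r -> Cmod (om + t) <= K * L).
  { intros t Ht. eapply Rle_trans; [apply Cmod_triangle|]. unfold K.
    assert (2 * r <= 2 * r * L) by nra. lra. }
  set (W := fun q => RtoC (beta_weight a n q)).
  assert (HA : forall t, Cmod t <= 2 * r -> exists e1 e2, Cmod e1 <= 1 / 32 /\ Cmod e2 <= 1 / 32 /\
     expint a W (n * xi + om + t) =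
     (chi 1%R * laplace a (n * k) * ((1 - cexp (t * kap)) + (e1 - cexp (t * kap) * e2)))%C).
  { intros t Ht.
    destruct (B1 n (om + t)%C ltac:(fold L; lra) Hn (Homt t Ht)) as [e1 [e2 [He1 [He2 HE]]]].
    exists e1, e2. split; [auto|split; [auto|]].
    replace (n * xi + om + t)%C with (n * xi + (om + t))%C by ring. unfold W. rewrite HE.
    replace ((om + t) * kap)%C with (u + t * kap)%C by (unfold om; field; auto).
    rewrite cexp_plus, Hu. field. auto. }
  set (g := Cmod (chi 1%R * laplace a (n * k))).
  assert (Hg : 0 < g).
  { apply Cmod_gt_0, Cmult_neq_0; auto. pose proof (laplace_pos n ltac:(lra)).
    intros X; apply RtoC_inj in X; lra. }
  assert (HW : forall q, ccont W q).
  { intros; apply ccont_RtoC, continuous_beta_weight; auto; lra. }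
  destruct (expint_zero_in_square a W (n * xi + om) r Ha HW Hr) as [x [y [Hx' [Hy' HZ]]]].
  { intros x y Hx' Hy' Hbd. set (t := (x, y) : C).
    assert (Ht1 : Cmod t <= 2 * r).
    { eapply Rle_trans; [apply Cmod_le_Re_Im|]. simpl. lra. }
    assert (Ht2 : r <= Cmod t).
    { destruct Hbd as [<-|<-]; [apply (re_le_Cmod t)|apply (Im_le_Cmod t)]. }
    assert (Hv : 1 / 4 <= Cmod (t * kap) <= 1 / 2).
    { rewrite Cmod_mult. assert (r * Cmod kap = 1 / 4) by (unfold r; field; lra).
      split; nra. }
    pose proof (Cmod_1_minus_cexp _ Hv) as Hb1.
    assert (He2 : Cmod (cexp (t * kap)) <= 2).
    { rewrite Cmod_cexp. apply Rle_trans with (exp (1 / 2)).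
      - apply exp_le. pose proof (Re_le_Cmod (t * kap)). lra.
      - pose proof exp_le_3 as H3. replace 1 with (1 / 2 + 1 / 2) in H3 by field.
        rewrite exp_plus in H3. pose proof (exp_pos (1 / 2)). nra. }
    destruct (HA t Ht1) as [e1 [e2 [E1 [E2 ->]]]].
    destruct (HA 0) as [f1 [f2 [F1 [F2 F0]]]]; [rewrite Cmod_0; lra|].
    replace (n * xi + om + 0)%C with (n * xi + om)%C in F0 by ring.
    replace (0 * kap)%C with (RtoC 0) in F0 by ring. rewrite cexp_0 in F0.
    rewrite F0, !(Cmod_mult (chi 1%R * laplace a (n * k))). fold g.
    apply Rmult_lt_compat_l; auto.
    assert (Q1 : Cmod (1 - 1 + (f1 - 1 * f2)) <= 2 / 32).
    { replace (1 - 1 + (f1 - 1 * f2))%C with (f1 + - f2)%C by ring.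
      eapply Rle_trans; [apply Cmod_triangle|]. rewrite Cmod_opp. lra. }
    assert (Q2 : Cmod (e1 - cexp (t * kap) * e2) <= 3 / 32).
    { eapply Rle_trans; [apply Cmod_triangle|]. rewrite Cmod_opp, Cmod_mult.
      pose proof (Cmod_ge_0 e2). pose proof (Cmod_ge_0 (cexp (t * kap))). nra. }
    pose proof (Cmod_minus_triangle (1 - cexp (t * kap))%C
      (1 - cexp (t * kap) + (e1 - cexp (t * kap) * e2))%C) as Q3.
    replace (1 - cexp (t * kap) - (1 - cexp (t * kap) + (e1 - cexp (t * kap) * e2)))%C
      with (- (e1 - cexp (t * kap) * e2))%C in Q3 by ring.
    rewrite Cmod_opp in Q3. lra. }
  set (t := (x, y) : C) in *.
  assert (Ht1 : Cmod t <= 2 * r).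
  { eapply Rle_trans; [apply Cmod_le_Re_Im|]. simpl. lra. }
  exists (n * xi + om + t)%C. split.
  - pose proof (kummer_series_expint a n (n * xi + om + t) Ha ltac:(lra)) as HS.
    fold W in HS. rewrite HZ, Cmult_0_r in HS.
    replace (n + a + 1) with b in HS by (unfold n; ring). exact HS.
  - assert (Hb0 : 0 < b) by (unfold n in Hn; lra).
    assert (Hb1 : RtoC b <> 0) by (intros X; apply RtoC_inj in X; lra).
    replace ((n * xi + om + t) / b - xi)%C with ((om + t - RtoC (a + 1) * xi) / b)%C.
    + rewrite Cmod_div, Cmod_R, (Rabs_right b) by (auto; lra).
      apply (Rmult_lt_reg_r b); auto. unfold Rdiv. rewrite Rmult_assoc, Rinv_l, Rmult_1_r by lra.
      apply Rle_lt_trans with ((K + (a + 1) * Cmod xi) * L).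
      * eapply Rle_trans; [apply Cmod_triangle|].
        rewrite Cmod_opp, Cmod_mult, Cmod_R, (Rabs_right (a + 1)) by lra.
        specialize (Homt t Ht1). pose proof (Cmod_ge_0 xi).
        assert ((a + 1) * Cmod xi <= (a + 1) * Cmod xi * L).
        { assert (0 <= (a + 1) * Cmod xi) by (apply Rmult_le_pos; lra). nra. }
        lra.
      * apply (Rmult_le_compat_l (ep / 2)) in B2; [|lra].
        replace (ep / 2 * (2 * (K + (a + 1) * Cmod xi) / ep * L))
          with ((K + (a + 1) * Cmod xi) * L) in B2 by (field; lra).
        assert (n < b) by (unfold n; lra). nra.
    + replace (RtoC n) with (RtoC b - RtoC (a + 1))%C by (rewrite <- RtoC_minus; f_equal; unfold n; ring).
      field. auto.
Qed.

End Zeros.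

(** * The whole curve, and the choice of one zero for each [b] *)

Lemma zeros_near_nonreal (a : R) (xi : C) (ep : R) :
  0 < a -> S_plus xi -> Im xi <> 0 -> 0 < ep ->
  exists B, 0 < B /\ forall b, B < b ->
    exists z, hyp1F1_eq a b z 0 /\ Cmod (z / b - xi) < ep.
Proof.
  intros Ha Hxi Hy Hep.
  destruct (segment_power a (Cconj xi)) as [chi [H0 [Hnz Hd]]].
  { rewrite im_conj. lra. }
  exact (zeros_near_with_branch a xi Ha Hxi Hy chi H0 Hnz Hd ep Hep).
Qed.

(** A real point satisfies [ln x = x - 1], and the strict inequality [e^y > 1 + y] for [y <> 0]
    leaves only [x = 1]. *)
Lemma S_plus_real (xi : C) : S_plus xi -> Im xi = 0 -> xi = 1.
Proof.
  intros [H1 H2] H3. rewrite H3 in H2. replace (Re xi ^ 2 + 0 ^ 2) with (Re xi * Re xi) in H2 by ring.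
  rewrite ln_mult in H2 by lra. apply C_ext; auto. simpl.
  destruct (Req_dec (Re xi) 1) as [E|E]; auto. exfalso.
  assert (Hl : ln (Re xi) <> 0).
  { intros Hl. apply E. rewrite <- (exp_ln (Re xi)), Hl by lra. apply exp_0. }
  pose proof (exp_ineq1 (ln (Re xi)) Hl) as H. rewrite exp_ln in H by lra. lra.
Qed.

(** With [d = Re xi - 1] the equation of the curve reads [|xi|^2 = e^(2 d)]. Its upper half is
    therefore parametrized by the imaginary part [sqrt (e^(2 d) - (1 + d)^2)], positive for [d > 0]
    and tending to [0] with [d]. *)
Lemma S_plus_near_1 (ep : R) : 0 < ep ->
  exists xi, S_plus xi /\ Im xi <> 0 /\ Cmod (xi - 1) < ep.
Proof.
  intros Hep.
  set (f := fun d => sqrt (exp (2 * d) - (1 + d) ^ 2)).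
  assert (Cf : continuous f 0).
  { apply (continuous_comp (fun d => exp (2 * d) - (1 + d) ^ 2) sqrt); [|apply continuous_sqrt].
    apply (@ex_derive_continuous _ R_NormedModule). auto_derive. auto. }
  destruct (proj1 (continuous_R_iff f 0) Cf (ep / 2) ltac:(lra)) as [d [Hd H]].
  set (e := Rmin (d / 2) (ep / 4)).
  assert (He : 0 < e) by (apply Rmin_pos; lra).
  assert (He1 : e <= d / 2) by apply Rmin_l. assert (He2 : e <= ep / 4) by apply Rmin_r.
  assert (Hpos : 0 < exp (2 * e) - (1 + e) ^ 2).
  { replace (2 * e) with (e + e) by ring. rewrite exp_plus.
    pose proof (exp_ineq1 e ltac:(lra)). nra. }
  assert (Hf : 0 < f e) by (apply sqrt_lt_R0; auto).
  assert (Hf2 : f e ^ 2 = exp (2 * e) - (1 + e) ^ 2).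
  { apply pow2_sqrt. lra. }
  exists ((1 + e)%R, f e). split; [|split].
  - split; simpl; [lra|].
    replace ((1 + e) * ((1 + e) * 1) + f e * (f e * 1)) with ((1 + e) ^ 2 + f e ^ 2) by ring.
    rewrite Hf2. replace ((1 + e) ^ 2 + (exp (2 * e) - (1 + e) ^ 2)) with (exp (2 * e)) by ring.
    rewrite ln_exp. field.
  - simpl. lra.
  - eapply Rle_lt_trans; [apply Cmod_le_Re_Im|]. simpl.
    replace (1 + e + - (1)) with e by ring. rewrite Ropp_0, Rplus_0_r.
    assert (H0 : f 0 = 0).
    { unfold f. rewrite Rmult_0_r, exp_0. replace (1 - (1 + 0) ^ 2) with 0 by ring. apply sqrt_0. }
    specialize (H e). rewrite H0, !Rminus_0_r in H.
    rewrite (Rabs_right e) in * by lra. specialize (H ltac:(lra)). lra.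
Qed.

Lemma zeros_near (a : R) (xi : C) (ep : R) :
  0 < a -> S_plus xi -> 0 < ep ->
  exists B, 0 < B /\ forall b, B < b ->
    exists z, hyp1F1_eq a b z 0 /\ Cmod (z / b - xi) < ep.
Proof.
  intros Ha Hxi Hep. destruct (Req_dec (Im xi) 0) as [Hy|Hy]; [|apply zeros_near_nonreal; auto].
  rewrite (S_plus_real xi Hxi Hy) in *.
  destruct (S_plus_near_1 (ep / 2) ltac:(lra)) as [xi' [H1 [H2 H3]]].
  destruct (zeros_near_nonreal a xi' (ep / 2) Ha H1 H2 ltac:(lra)) as [B [HB H]].
  exists B. split; auto. intros b Hb. destruct (H b Hb) as [z [Hz1 Hz2]].
  exists z. split; auto.
  replace (z / b - 1)%C with ((z / b - xi') + (xi' - 1))%C by ring.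
  eapply Rle_lt_trans; [apply Cmod_triangle|]. lra.
Qed.

(** The slack [d] allows a nearly best element to be chosen without showing that the infimum is
    attained. *)
Lemma almost_minimizer {T : Type} (P : T -> Prop) (g : T -> R) (d : R) :
  (forall x, 0 <= g x) -> (exists x, P x) -> 0 < d ->
  exists x, P x /\ forall y, P y -> g x <= g y + d.
Proof.
  intros Hg [x0 Hx0] Hd.
  destruct (completeness (fun r => exists x, P x /\ r = - g x)) as [m [Hub Hlub]].
  - exists 0. intros r [x [_ ->]]. specialize (Hg x). lra.
  - exists (- g x0), x0. auto.
  - apply NNPP. intros Hno.
    enough (m <= m - d) by lra.
    apply Hlub. intros r [x [Hx ->]]. apply Rnot_lt_le. intros Hlt. apply Hno.
    exists x. split; auto. intros y Hy.
    assert (- g y <= m) by (apply Hub; exists y; auto). lra.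
Qed.

Theorem theoremB5 (a : R) (xi0 : C) (ha : 0 < a) (hxi0 : S_plus xi0) :
  exists (B : R) (zstar : R -> C),
    0 < B /\
    (forall b : R, B < b -> hyp1F1_eq a b (zstar b) (RtoC 0)) /\
    filterlim (fun b : R => Cdiv (zstar b) (RtoC b))
      (Rbar_locally p_infty) (locally xi0).
Proof.
  destruct (zeros_near a xi0 1 ha hxi0 ltac:(lra)) as [B [HB HZ]].
  (* [zeros_near] gives a zero that depends on the tolerance, whereas [zstar b] must serve all
     tolerances. A zero whose quotient by [b] is closest to [xi0] up to [/ b] inherits every such
     estimate with that slack. *)
  assert (Hex : forall b, exists z, B < b -> hyp1F1_eq a b z 0 /\
    forall z', hyp1F1_eq a b z' 0 -> Cmod (z / b - xi0) <= Cmod (z' / b - xi0) + / b).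
  { intros b. destruct (Rlt_dec B b) as [Hb|Hb].
    - destruct (almost_minimizer (fun z => hyp1F1_eq a b z 0) (fun z => Cmod (z / b - xi0)) (/ b))
        as [z Hz].
      + intros; apply Cmod_ge_0.
      + destruct (HZ b Hb) as [z [Hz _]]. exists z; auto.
      + apply Rinv_0_lt_compat; lra.
      + exists z; auto.
    (* An arbitrary value for [b <= B], where nothing is claimed. *)
    - exists 0. intros; contradiction. }
  exists B, (fun b => proj1_sig (constructive_indefinite_description _ (Hex b))).
  split; [auto|split].
  - intros b Hb. destruct constructive_indefinite_description as [z Hz]; simpl.
    apply (Hz Hb).
  - apply (proj2 (filterlim_locally_ball_norm (K := C_AbsRing) (U := C_NormedModule) _ _)).
    intros e. destruct (zeros_near a xi0 (e / 2) ha hxi0) as [B' [HB' HZ']].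
    { pose proof (cond_pos e). lra. }
    (* The bound [2 / e] makes the slack [/ b] smaller than [e / 2]. *)
    exists (Rmax (Rmax B B') (2 / e)). intros b Hb.
    pose proof (Rmax_l (Rmax B B') (2 / e)). pose proof (Rmax_r (Rmax B B') (2 / e)).
    pose proof (Rmax_l B B'). pose proof (Rmax_r B B').
    destruct constructive_indefinite_description as [z Hz]; simpl.
    destruct (Hz ltac:(lra)) as [_ Hmin].
    destruct (HZ' b ltac:(lra)) as [z' [Hz1 Hz2]].
    specialize (Hmin z' Hz1).
    change (Cmod (z / b - xi0) < e).
    assert (/ b < e / 2).
    { pose proof (cond_pos e). rewrite <- (Rinv_inv (e / 2)). apply Rinv_lt_contravar.
      - apply Rmult_lt_0_compat; [apply Rinv_0_lt_compat; lra|lra].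
      - replace (/ (e / 2)) with (2 / e) by (field; lra). lra. }
    lra.
Qed.
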